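(* Let $A$ be a field or $\mathbb Z$. Let $X$ be a projective scheme over $A$. Let $\mathcal L$ be a line bundle over $X$ very ample over $A$. Let $i:Y\to X$ be a hyperplane section with respect to $\mathcal L$, with associated graded ideal $I_\bullet\subset\bigoplus_n H^0(X,\mathcal L^{\otimes n})$. Let $(D_YX,\mathcal L')$ be the deformation to the projective completion of the cone associated to $(X,Y,\mathcal L)$. Then: 1. the line bundle $\mathcal L'$ over $D_YX$ is ample over $A$; 2. the restriction of $\mathcal L'$ over $1$ is the line bundle $\mathcal L$ on $X$; 3. the restriction of $\mathcal L'$ over $\infty$ is the canonical line bundle $\mathcal O(1)$ associated to the generated in degree $1$ graded algebra $\bigoplus_{l\ge 0} I_\bullet^l/I_\bullet^{l+1}$.
   Context: Let $S_\bullet=\bigoplus_{n\ge 0} H^0(X,\mathcal L^{\otimes n})$. A closed immersion $i:Y\to X$ is a *hyperplane section with respect to $\mathcal L$* if the graded ideal $I_\bullet\subset S_\bullet$ associated to $i$ is generated in degree 1. Write $\mathbb P^1_A=\mathrm{Proj}\,A[u,t]$, $0=\{u=0\}$, $\infty=\{t=0\}$, $1=[1:1]$. $D_YX\to\mathbb P^1_A$ is obtained by gluing $X\times_A\mathrm{Spec}\,A[u/t]$ over $\{u\ne\infty\}$ with $\mathrm{Proj}\,S'_\bullet$ over $\{u\neq0\}$, where $S'_\bullet=\bigoplus_{l\in\mathbb Z}I_\bullet^l(t/u)^{-l}$ ($I_\bullet^l=S_\bullet$ for $l\le0$), a graded $A[t/u]$-algebra with grading induced from $S_\bullet$, via the canonical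 identification of both with $X\times_A(\mathbb A^1_A-\{0\})$ over $\{u\ne0,\infty\}$. The fiber of $D_YX$ over $1$ is $X$, and the fiber over $\infty$ is $\mathrm{Proj}$ of $S'_\bullet/(t/u)S'_\bullet=\bigoplus_{l\ge 0} I_\bullet^l/I_\bullet^{l+1}$. All Proj's, and the phrase ''generated in degree 1'' in item 3, refer to the grading induced from $S_\bullet$ (not the index $l$). Let $t_1,\dots,t_M\in H^0(X,\mathcal L)$ generate $I_\bullet$ and let $s_0,\dots,s_N\in H^0(X,\mathcal L)$ induce a closed immersion $X\to\mathbb P^N_A$. Then $D_YX$ is the schematic closure of the image of the map $(x,u)\mapsto([s_0(x):\dots:s_N(x):ut_1(x):\dots:ut_M(x)],[u:1])$ from $X\times_A\mathbb A^1_A$ to $\mathbb P^{N+M}_A\times_A\mathbb P^1_A$, and $\mathcal L'$ is the pullback to $D_YX$ of $\mathcal O_{\mathbb P^{N+M}}(1)\boxtimes\mathcal O_{\mathbb P^1}(1)$; it does not depend on the choices of the $s_i,t_j$. The pair $(D_YX,\mathcal L')$ is the deformation to the projective completion of the cone associated to $(X,Y,\mathcal L)$.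
   Formalization: In item 3, the graded algebra is asserted to be generated in degree 1 only when the section ring of L is; in general (e.g. Y = X with L not normally generated) it is not. It is shown generated by degree 1 over its l = 0 part, and the restriction to O(1) is unconditional. *)

(* Defs.v *)
From HB Require Import structures.
From mathcomp Require Import all_boot all_order all_algebra.
From mathcomp Require Import all_classical topology.
From mathcomp Require mpoly.
Import -(notations) mpoly.

Set Implicit Arguments.
Unset Strict Implicit.
Unset Printing Implicit Defensive.

Import GRing.Theory.
Local Open Scope classical_set_scope.
Local Open Scope ring_scope.

(* Objects that are only defined up to unique isomorphism (Spec, Proj, tensor
   products, pullbacks, the graded algebras below) are given by records that
   say when an object, together with its structure maps, is one of them, in
   the style of a localization predicate. *)

Definition field_or_Z (A : comNzRingType) : Prop :=
  (forall a : A, a != 0 -> exists b, b * a = 1) \/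
  (exists f : {rmorphism int -> A}, bijective f).

(* A sheaf of abelian groups is given by its espace etale: the
   stalks [F x] and the predicate [reg x f], read "the family of germs [f] is a
   section on some neighbourhood of x".  The sections over an open set U are
   the families f, taken up to equality on U, with [reg x f] for all x in U;
   restriction is the identity on families and gluing is automatic. *)

Record is_sheaf (X : topologicalType) (F : X -> zmodType)
    (reg : X -> (forall x, F x) -> Prop) : Prop := {
  reg_near : forall x f, reg x f -> \forall y \near x, reg y f;
  reg_ext : forall x f g,
    reg x f -> (\forall y \near x, f y = g y) -> reg x g;
  regB : forall x f g, reg x f -> reg x g -> reg x (fun y => f y - g y);
  reg_germ : forall x (a : F x), exists f, reg x f /\ f x = a;
  reg_eq0 : forall x f, reg x f -> f x = 0 -> \forall y \near x, f y = 0
}.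

Record lrs := {
  sp :> topologicalType;
  Ost : sp -> comUnitRingType;
  Oreg : sp -> (forall x, Ost x) -> Prop;
  Osheaf : @is_sheaf sp Ost Oreg;
  Oreg1 : forall x, Oreg x (fun y => 1);
  OregM : forall x f g, Oreg x f -> Oreg x g -> Oreg x (fun y => f y * g y);
  Olocal : forall x (a : Ost x), (a \is a GRing.unit) || (1 - a \is a GRing.unit)
}.

Definition secO (X : lrs) (U : set X) (f : forall x, Ost x) : Prop :=
  forall x : X, U x -> Oreg x f.

Record prime_of_sections (X : lrs) (U : set X)
    (q : (forall x : X, Ost x) -> Prop) : Prop := {
  ps_sec : forall f, q f -> secO U f;
  ps_ext : forall f g, q f -> (forall x, U x -> f x = g x) -> q g;
  ps_0 : q (fun x => 0);
  psD : forall f g, q f -> q g -> q (fun x => f x + g x);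
  psM : forall f g, secO U f -> q g -> q (fun x => f x * g x);
  ps_1 : ~ q (fun x => 1);
  ps_prime : forall f g, secO U f -> secO U g ->
    q (fun x => f x * g x) -> q f \/ q g
}.

(* U is affine when U -> Spec O(U), x |-> {f | f(x) = 0 in the residue field},
   is a homeomorphism and O(U) -> O_x is the localization at that prime. *)
Record affine_open (X : lrs) (U : set X) : Prop := {
  aff_open : open U;
  aff_surj : forall q, prime_of_sections U q ->
    exists2 x, U x & forall f, secO U f -> (q f <-> f x \isn't a GRing.unit);
  aff_inj : forall x y, U x -> U y ->
    (forall f, secO U f ->
       (f x \is a GRing.unit) = (f y \is a GRing.unit)) -> x = y;
  aff_basis : forall x (V : set X), U x -> open V -> V x ->
    exists2 f, secO U f & f x \is a GRing.unit /\
      (forall y, U y -> f y \is a GRing.unit -> V y);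
  aff_frac : forall x (a : Ost x), U x ->
    exists f g, [/\ secO U f, secO U g, g x \is a GRing.unit & a * g x = f x];
  aff_ker : forall x f, U x -> secO U f -> f x = 0 ->
    exists g, [/\ secO U g, g x \is a GRing.unit &
                  forall y, U y -> g y * f y = 0]
}.

(* Schemes over Spec A; the structure morphism is given by A -> O(X). *)
Record ascheme (A : comNzRingType) := {
  sch :> lrs;
  str : forall x : sch, {rmorphism A -> Ost x};
  str_reg : forall (x : sch) a, Oreg x (fun y => str y a);
  sch_affine : forall x : sch, exists2 U : set sch, affine_open U & U x
}.

Record mor (A : comNzRingType) (X Y : ascheme A) := {
  mapp :> X -> Y;
  mst : forall x : X, {rmorphism Ost (mapp x) -> Ost x};
  m_cont : continuous mapp;
  m_local : forall x a, mst x a \is a GRing.unit -> a \is a GRing.unit;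
  m_reg : forall x g, Oreg (mapp x) g -> Oreg x (fun y => mst y (g (mapp y)));
  m_str : forall x a, mst x (str (mapp x) a) = str x a
}.

Program Definition idmor (A : comNzRingType) (X : ascheme A) : mor X X :=
  {| mapp := idfun; mst := fun x => idfun : {rmorphism Ost x -> Ost x} |}.
Next Obligation. by move=> A X x; exact: cvg_id. Qed.
Next Obligation. by []. Qed.
Next Obligation. by []. Qed.
Next Obligation. by []. Qed.

Program Definition compmor (A : comNzRingType) (X Y Z : ascheme A)
    (f : mor Y Z) (g : mor X Y) : mor X Z :=
  {| mapp := fun x => f (g x);
     mst := fun x => mst g x \o mst f (g x)
       : {rmorphism Ost (f (g x)) -> Ost x} |}.
Next Obligation.
by move=> A X Y Z f g x; apply: continuous_comp; [exact: m_cont|exact: m_cont].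
Qed.
Next Obligation. by move=> A X Y Z f g x a /= /m_local/m_local. Qed.
Next Obligation.
move=> A X Y Z f g x s sreg; exact: (m_reg (m := g) (m_reg (m := f) sreg)).
Qed.
Next Obligation. by move=> A X Y Z f g x a /=; rewrite !m_str. Qed.

(* The stalk maps of two morphisms are compared on germs of sections of the
   target, because their source types depend on the image points. *)
Definition mor_eq (A : comNzRingType) (X Y : ascheme A) (f g : mor X Y) :=
  forall x, f x = g x /\
    forall s, Oreg (f x) s -> mst f x (s (f x)) = mst g x (s (g x)).

Definition closed_immersion (A : comNzRingType) (X Y : ascheme A)
    (f : mor X Y) : Prop :=
  [/\ injective f, forall C : set X, closed C -> closed (f @` C) &
      forall x b, exists a, mst f x a = b].

Definition open_immersion (A : comNzRingType) (X Y : ascheme A)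
    (f : mor X Y) : Prop :=
  [/\ injective f, forall U : set X, open U -> open (f @` U) &
      forall x, bijective (mst f x)].

Record modsheaf (X : lrs) := {
  Mst :> forall x : X, lmodType (Ost x);
  Mreg : X -> (forall x, Mst x) -> Prop;
  Msheaf : @is_sheaf X Mst Mreg;
  MregZ : forall x a m, Oreg x a -> Mreg x m -> Mreg x (fun y => a y *: m y)
}.

Definition line_bundle (X : lrs) (L : modsheaf X) : Prop :=
  forall x, exists2 e : forall y, L y, Mreg x e &
    \forall y \near x, forall m : L y, exists! r, m = r *: e y.

Definition semilinear_along (R R' : comUnitRingType) (f : R -> R')
    (V : lmodType R) (W : lmodType R') (h : V -> W) : Prop :=
  (forall m m', h (m + m') = h m + h m') /\
  (forall r m, h (r *: m) = f r *: h m).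

(* [h] exhibits N as f^* M: on stalks N_x is the scalar extension of M_(f x)
   along O_(f x) -> O_x. *)
Record is_pullback (A : comNzRingType) (X Y : ascheme A) (f : mor X Y)
    (M : modsheaf Y) (N : modsheaf X) (h : forall x, M (f x) -> N x) : Prop := {
  pb_lin : forall x, semilinear_along (mst f x) (h x);
  pb_reg : forall x m, Mreg (f x) m -> Mreg x (fun y => h y (m (f y)));
  pb_univ : forall x (Q : lmodType (Ost x)) (phi : M (f x) -> Q),
    semilinear_along (mst f x) phi ->
    exists2 psi : {linear N x -> Q}, (forall m, psi (h x m) = phi m) &
      forall psi' : {linear N x -> Q},
        (forall m, psi' (h x m) = phi m) -> psi' =1 psi
}.

Definition bilinear_map (R : comUnitRingType) (V W Q : lmodType R)
    (b : V -> W -> Q) : Prop :=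
  (forall w, linear (b ^~ w)) /\ (forall v, linear (b v)).

(* [b] exhibits N as the tensor product of L and M. *)
Record is_tensor (X : lrs) (L M N : modsheaf X)
    (b : forall x, L x -> M x -> N x) : Prop := {
  ts_lin : forall x, bilinear_map (b x);
  ts_reg : forall x l m, Mreg x l -> Mreg x m ->
    Mreg x (fun y => b y (l y) (m y));
  ts_univ : forall x (Q : lmodType (Ost x)) (phi : L x -> M x -> Q),
    bilinear_map phi ->
    exists2 psi : {linear N x -> Q}, (forall l m, psi (b x l m) = phi l m) &
      forall psi' : {linear N x -> Q},
        (forall l m, psi' (b x l m) = phi l m) -> psi' =1 psi
}.

(* The stalks of the tensor algebra, i.e. the direct sum of all L^{(x) n}. *)
Record tensor_algebra (X : lrs) (L : modsheaf X) := {
  Tst :> forall x : X, algType (Ost x);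
  Tin : forall x, {linear L x -> Tst x};
  T_univ : forall x (B : algType (Ost x)) (phi : {linear L x -> B}),
    exists2 psi : {lrmorphism Tst x -> B}, (forall l, psi (Tin x l) = phi l) &
      forall psi' : {lrmorphism Tst x -> B},
        (forall l, psi' (Tin x l) = phi l) -> psi' =1 psi
}.

(* w lies in the stalk at x of L^{(x) n} *)
Fixpoint tdeg (X : lrs) (L : modsheaf X) (T : tensor_algebra L) (n : nat)
    (x : X) (w : T x) : Prop :=
  match n with
  | 0%N => exists r, w = r%:A
  | n'.+1 => exists m (l : 'I_m -> L x) (v : 'I_m -> T x),
      (forall j, tdeg n' (v j)) /\ w = \sum_(j < m) Tin T x (l j) * v j
  end.

(* f is a section of L^{(x) n} on some neighbourhood of x *)
Fixpoint treg (X : lrs) (L : modsheaf X) (T : tensor_algebra L) (n : nat)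
    (x : X) (f : forall y, T y) : Prop :=
  match n with
  | 0%N => exists2 r, Oreg x r & \forall y \near x, f y = (r y)%:A
  | n'.+1 => exists m (l : 'I_m -> forall y, L y) (g : 'I_m -> forall y, T y),
      (forall j, Mreg x (l j) /\ treg n' x (g j)) /\
      \forall y \near x, f y = \sum_(j < m) Tin T y (l j y) * g j y
  end.

(* w generates the stalk at x of L^{(x) n} *)
Definition tgen (X : lrs) (L : modsheaf X) (T : tensor_algebra L) (n : nat)
    (x : X) (w : T x) : Prop :=
  tdeg n w /\ forall w', tdeg n w' -> exists r, w' = r *: w.

(* Over the affine base Spec A, relative ampleness is ampleness on X: X is
   quasi-compact and the affine loci X_s, for s a global section of some
   L^{(x) n} with n > 0, cover X. *)
Definition ample (A : comNzRingType) (X : ascheme A) (L : modsheaf X)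
    (T : tensor_algebra L) : Prop :=
  [/\ line_bundle L, compact [set: X] &
      forall x : X, exists n (s : forall y, T y),
        [/\ (0 < n)%N, forall y, treg n y s, tgen n (s x) &
            affine_open [set y | tgen n (s y)]]].

Record gralg (A : comNzRingType) := {
  gring :> comPzRingType;
  gstr : {rmorphism A -> gring};
  deg : nat -> gring -> Prop;
  degB : forall n a b, deg n a -> deg n b -> deg n (a - b);
  deg_str : forall a, deg 0 (gstr a);
  degM : forall m n a b, deg m a -> deg n b -> deg (m + n) (a * b);
  deg_sum : forall a, exists n (c : nat -> gring),
    (forall i, deg i (c i)) /\ a = \sum_(i < n) c i;
  deg_free : forall n (c : nat -> gring), (forall i, deg i (c i)) ->
    \sum_(i < n) c i = 0 -> forall i, (i < n)%N -> c i = 0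
}.

(* equivalently, R is generated by R_1 as an algebra over R_0 *)
Definition generated_in_degree1 (A : comNzRingType) (R : gralg A) : Prop :=
  forall n (a : R), deg n.+1 a -> exists m (b c : 'I_m -> R),
    (forall j, deg 1 (b j) /\ deg n (c j)) /\ a = \sum_(j < m) b j * c j.

Definition ideal_generated_in_degree1 (A : comNzRingType) (R : gralg A)
    (I : R -> Prop) : Prop :=
  forall a, I a -> exists m (b c : 'I_m -> R),
    (forall j, I (b j) /\ deg 1 (b j)) /\ a = \sum_(j < m) c j * b j.

Record proj_prime (A : comNzRingType) (R : gralg A) (q : R -> Prop) : Prop := {
  pr_0 : q 0;
  prD : forall a b, q a -> q b -> q (a + b);
  prM : forall a b, q b -> q (a * b);
  pr_1 : ~ q 1;
  pr_prime : forall a b, q (a * b) -> q a \/ q b;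
  pr_hom : forall a, q a -> exists n (c : nat -> R),
    (forall i, deg i (c i) /\ q (c i)) /\ a = \sum_(i < n) c i;
  pr_irr : exists n a, [/\ (0 < n)%N, deg n a & ~ q a]
}.

(* a / b is a fraction of degree k in the homogeneous localization at q *)
Definition frac_at (A : comNzRingType) (R : gralg A) (q : R -> Prop)
    (k : nat) (a b : R) : Prop :=
  exists d, [/\ deg (d + k) a, deg d b & ~ q b].

(* [is_proj R P]: P is Proj R.  The germ [fr x a b] is the fraction a / b;
   its value is only constrained when [frac_at (pt_prime x) 0 a b]. *)
Record is_proj (A : comNzRingType) (R : gralg A) (P : ascheme A) := {
  pt_prime : P -> R -> Prop;
  fr : forall x : P, R -> R -> Ost x;
  pt_primeP : forall x, proj_prime (pt_prime x);
  pt_inj : forall x y, (forall a, pt_prime x a <-> pt_prime y a) -> x = y;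
  pt_surj : forall q, proj_prime q ->
    exists x, forall a, pt_prime x a <-> q a;
  proj_open : forall U : set P, open U <->
    forall x, U x -> exists n a, [/\ (0 < n)%N, deg n a, ~ pt_prime x a &
      forall y, ~ pt_prime y a -> U y];
  fr_eq : forall x a b c d,
    frac_at (pt_prime x) 0 a b -> frac_at (pt_prime x) 0 c d ->
    (fr x a b = fr x c d <->
     exists n e, [/\ deg n e, ~ pt_prime x e & e * (a * d - c * b) = 0]);
  fr_surj : forall x r, exists a b,
    frac_at (pt_prime x) 0 a b /\ r = fr x a b;
  frD : forall x a b c d,
    frac_at (pt_prime x) 0 a b -> frac_at (pt_prime x) 0 c d ->
    fr x a b + fr x c d = fr x (a * d + c * b) (b * d);
  frM : forall x a b c d,
    frac_at (pt_prime x) 0 a b -> frac_at (pt_prime x) 0 c d ->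
    fr x a b * fr x c d = fr x (a * c) (b * d);
  fr_str : forall x a, fr x (gstr R a) 1 = str x a;
  fr_reg : forall x f, Oreg x f <-> exists a b,
    \forall y \near x, frac_at (pt_prime y) 0 a b /\ f y = fr y a b
}.

(* [is_twist1 HP M]: M is the sheaf O(1) on P = Proj R, with stalks the degree
   1 parts of the homogeneous localizations. *)
Record is_twist1 (A : comNzRingType) (R : gralg A) (P : ascheme A)
    (HP : is_proj R P) (M : modsheaf P) := {
  fr1 : forall x : P, R -> R -> M x;
  fr1_eq : forall x a b c d,
    frac_at (pt_prime HP x) 1 a b -> frac_at (pt_prime HP x) 1 c d ->
    (fr1 x a b = fr1 x c d <->
     exists n e, [/\ deg n e, ~ pt_prime HP x e & e * (a * d - c * b) = 0]);
  fr1_surj : forall x m, exists a b,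
    frac_at (pt_prime HP x) 1 a b /\ m = fr1 x a b;
  fr1D : forall x a b c d,
    frac_at (pt_prime HP x) 1 a b -> frac_at (pt_prime HP x) 1 c d ->
    fr1 x a b + fr1 x c d = fr1 x (a * d + c * b) (b * d);
  fr1Z : forall x a b c d,
    frac_at (pt_prime HP x) 0 a b -> frac_at (pt_prime HP x) 1 c d ->
    fr HP x a b *: fr1 x c d = fr1 x (a * c) (b * d);
  fr1_reg : forall x f, Mreg x f <-> exists a b,
    \forall y \near x, frac_at (pt_prime HP y) 1 a b /\ f y = fr1 y a b
}.

Lemma mpoly_deg_sum (A : comNzRingType) n (p : mpoly n A) :
  exists m (c : nat -> mpoly n A),
    (forall i, c i \is ishomog1 i (@mdeg n)) /\ p = \sum_(i < m) c i.
Proof.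
exists (mmeasure (@mdeg n) p), (fun i => pihomog (@mdeg n) i p).
by split; [move=> i; exact: pihomogP|exact: pihomog_partitionE].
Qed.

Lemma mpoly_deg_free (A : comNzRingType) n m (c : nat -> mpoly n A) :
  (forall i, c i \is ishomog1 i (@mdeg n)) ->
  \sum_(i < m) c i = 0 -> forall i, (i < m)%N -> c i = 0.
Proof.
move=> hc s0 i im; have := congr1 (pihomog (@mdeg n) i) s0.
rewrite raddf_sum raddf0 (bigD1 (Ordinal im)) //= pihomog_dE //.
rewrite big1 ?addr0 // => j ji; exact: (@pihomog_ne0 _ _ _ j).
Qed.

Program Definition mpoly_gralg (A : comNzRingType) (n : nat) : gralg A :=
  {| gring := mpoly n A;
     gstr := @mpolyC n A : {rmorphism A -> mpoly n A};
     deg := fun d p => p \is ishomog1 d (@mdeg n) |}.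
Next Obligation. by move=> A n d a b ha hb; exact: rpredB. Qed.
Next Obligation.
move=> A n a; change (mpolyC n a \is ishomog1 0 (@mdeg n)).
by rewrite -alg_mpolyC; apply: rpredZ; exact: dhomog1.
Qed.
Next Obligation. by move=> A n d e a b; exact: dhomogM. Qed.
Next Obligation. by move=> A n p; exact: mpoly_deg_sum. Qed.
Next Obligation. by move=> A n m c; exact: mpoly_deg_free. Qed.

Definition xvar (A : comNzRingType) (n : nat) (i : 'I_n) : mpoly_gralg A n :=
  mpolyX A (mnm1 i).

Record projspace (A : comNzRingType) (n : nat) := {
  pspace :> ascheme A;
  pspaceP : is_proj (mpoly_gralg A n.+1) pspace;
  pO1 : modsheaf pspace;
  pO1P : is_twist1 pspaceP pO1
}.

Definition projective (A : comNzRingType) (X : ascheme A) : Prop :=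
  exists n (P : projspace A n) (f : mor X P), closed_immersion f.

(* X is proper over A wherever this is used, so that immersions into projective
   space are closed. *)
Definition very_ample (A : comNzRingType) (X : ascheme A) (L : modsheaf X) :
    Prop :=
  exists n (P : projspace A n) (f : mor X P) h,
    closed_immersion f /\ @is_pullback A X P f (pO1 P) L h.

(* f is the morphism [s_0 : ... : s_n] defined by the sections s_i of L *)
Definition induced_by (A : comNzRingType) (X : ascheme A) (L : modsheaf X)
    (n : nat) (P : projspace A n) (f : mor X P)
    (s : 'I_n.+1 -> forall x, L x) : Prop :=
  exists2 h, @is_pullback A X P f (pO1 P) L h &
    forall i x, h x (fr1 (pO1P P) (f x) (xvar A i) 1) = s i x.

(* The direct sum of the H^0(X, L^{(x) n}); [ev x] takes germs at x. *)
Record section_ring (A : comNzRingType) (X : ascheme A) (L : modsheaf X)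
    (T : tensor_algebra L) := {
  sring :> gralg A;
  ev : forall x, {rmorphism sring -> T x};
  ev_inj : forall a b, (forall x, ev x a = ev x b) -> a = b;
  ev_deg : forall n a, deg n a <-> forall x, treg n x (fun y => ev y a);
  ev_surj : forall n (f : forall x, T x), (forall x, treg n x f) ->
    exists a, forall x, ev x a = f x;
  ev_str : forall x a, ev x (gstr sring a) = (str x a)%:A
}.

(* a vanishes on Y: its germ at each point of Y dies in i^* of the tensor
   algebra, that is, lies in ker(O_X -> i_* O_Y) times the tensor algebra. *)
Definition ideal_of (A : comNzRingType) (X Y : ascheme A) (L : modsheaf X)
    (T : tensor_algebra L) (S : section_ring T) (i : mor Y X) (a : S) : Prop :=
  forall y : Y, exists m (k : 'I_m -> Ost (i y)) (w : 'I_m -> T (i y)),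
    (forall j, mst i y (k j) = 0) /\ ev S (i y) a = \sum_(j < m) k j *: w j.

Definition hyperplane_section (A : comNzRingType) (X Y : ascheme A)
    (L : modsheaf X) (T : tensor_algebra L) (S : section_ring T)
    (i : mor Y X) : Prop :=
  closed_immersion i /\ ideal_generated_in_degree1 (@ideal_of A X Y L T S i).

Fixpoint idpow (R : comPzRingType) (I : R -> Prop) (n : nat) (a : R) : Prop :=
  match n with
  | 0%N => True
  | n'.+1 => exists m (b c : 'I_m -> R),
      (forall j, I (b j) /\ idpow I n' (c j)) /\ a = \sum_(j < m) b j * c j
  end.

Definition idpowz (R : comPzRingType) (I : R -> Prop) (l : int) (a : R) :
    Prop :=
  match l with Posz n => idpow I n a | Negz _ => True end.

(* The extended Rees algebra: the sum over l in Z of the I^l tau^(-l), where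
   tau = t/u, graded by the degree of S.  [re l a] is a tau^(-l), constrained
   only for a in I^l. *)
Record rees (A : comNzRingType) (S : gralg A) (I : S -> Prop) := {
  ralg :> gralg A;
  re : int -> S -> ralg;
  reB : forall l a b, idpowz I l a -> idpowz I l b ->
    re l (a - b) = re l a - re l b;
  reM : forall l m a b, idpowz I l a -> idpowz I m b ->
    re l a * re m b = re (l + m) (a * b);
  re_str : forall a, gstr ralg a = re 0 (gstr S a);
  re_free : forall m (c : int -> S), (forall l, idpowz I l (c l)) ->
    \sum_(k < m.*2.+1) re (k%:Z - m%:Z) (c (k%:Z - m%:Z)) = 0 ->
    forall k, (k < m.*2.+1)%N -> c (k%:Z - m%:Z) = 0;
  re_gen : forall f, exists m (c : int -> S), (forall l, idpowz I l (c l)) /\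
    f = \sum_(k < m.*2.+1) re (k%:Z - m%:Z) (c (k%:Z - m%:Z));
  re_deg : forall n f, deg n f <-> exists m (c : int -> S),
    (forall l, idpowz I l (c l) /\ deg n (c l)) /\
    f = \sum_(k < m.*2.+1) re (k%:Z - m%:Z) (c (k%:Z - m%:Z))
}.

Definition tau (A : comNzRingType) (S : gralg A) (I : S -> Prop)
    (R : rees I) : R := re R (-1) 1.

(* The sum over l >= 0 of the I^l / I^(l+1), graded by the degree of S.
   [gc l a] is the class of a in I^l / I^(l+1), constrained only for a in
   I^l. *)
Record assoc_graded (A : comNzRingType) (S : gralg A) (I : S -> Prop) := {
  galg :> gralg A;
  gc : nat -> S -> galg;
  gcB : forall l a b, idpow I l a -> idpow I l b ->
    gc l (a - b) = gc l a - gc l b;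
  gcM : forall l m a b, idpow I l a -> idpow I m b ->
    gc l a * gc m b = gc (l + m) (a * b);
  gc_str : forall a, gstr galg a = gc 0 (gstr S a);
  gc_eq0 : forall l a, idpow I l a -> (gc l a = 0 <-> idpow I l.+1 a);
  gc_free : forall m (c : nat -> S), (forall l, idpow I l (c l)) ->
    \sum_(l < m) gc l (c l) = 0 -> forall l, (l < m)%N -> gc l (c l) = 0;
  gc_gen : forall f, exists m (c : nat -> S), (forall l, idpow I l (c l)) /\
    f = \sum_(l < m) gc l (c l);
  gc_deg : forall n f, deg n f <-> exists m (c : nat -> S),
    (forall l, idpow I l (c l) /\ deg n (c l)) /\ f = \sum_(l < m) gc l (c l)
}.

(* G is generated, as an algebra over its part S/I of index l = 0, by elements
   of degree 1 for the grading induced from S. *)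
Definition generated_in_degree1_over_index0 (A : comNzRingType) (S : gralg A)
    (I : S -> Prop) (G : assoc_graded I) : Prop :=
  forall Q : G -> Prop,
    (forall a, Q (gc G 0 a)) -> (forall f, deg 1 f -> Q f) ->
    (forall f g, Q f -> Q g -> Q (f + g)) ->
    (forall f g, Q f -> Q g -> Q (f * g)) ->
    forall f, Q f.

(* X x_A Spec A[v], as the relative spectrum of O_X[v] *)
Record affine_line (A : comNzRingType) (X : ascheme A) := {
  aline :> ascheme A;
  apr : mor aline X;
  acoord : forall z : aline, Ost z;
  acoord_reg : forall z, Oreg z acoord;
  apr_affine : forall U : set X, affine_open U -> affine_open (apr @^-1` U);
  acoord_gen : forall (U : set X) g, affine_open U ->
    secO (apr @^-1` U) g ->
    exists n (c : nat -> forall x : X, Ost x), (forall k, secO U (c k)) /\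
      forall z, U (apr z) ->
        g z = \sum_(k < n) mst apr z (c k (apr z)) * acoord z ^+ k;
  acoord_free : forall (U : set X) n (c : nat -> forall x : X, Ost x),
    affine_open U -> (forall k, secO U (c k)) ->
    (forall z, U (apr z) ->
       \sum_(k < n) mst apr z (c k (apr z)) * acoord z ^+ k = 0) ->
    forall k, (k < n)%N -> forall x, U x -> c k x = 0
}.

(* the coordinates of P^1_A = Proj A[u,t] *)
Definition uvar (A : comNzRingType) : mpoly_gralg A 2 := xvar A (0 : 'I_2).
Definition tvar (A : comNzRingType) : mpoly_gralg A 2 := xvar A (1 : 'I_2).

Section Deformation.
Variables (A : comNzRingType) (X Y : ascheme A) (L : modsheaf X).
Variables (T : tensor_algebra L) (S : section_ring T) (i : mor Y X).

Local Notation I := (@ideal_of A X Y L T S i).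

(* D_Y X -> P^1_A, glued from the charts Z = X x_A Spec A[v], v = u/t, and
   W = Proj S', S' the extended Rees algebra.  By [def_ovl0] and [def_ovlinf]
   the charts meet in the loci where v, resp. tau, is invertible.  By
   [def_ident_pt] and [def_ident] the identification of these loci is the
   canonical one of both with X x_A (A^1_A - 0): at corresponding points z and
   w, the fraction a tau^(-l) / b is the function (a / b) v^l, for a, b in S of
   the same degree with b generating at the image of z in X. *)
Record deformation := {
  def_rees : rees I;
  def_Z : affine_line X;
  def_W : ascheme A;
  def_proj : is_proj def_rees def_W;
  def_D : ascheme A;
  def_j0 : mor def_Z def_D;
  def_jinf : mor def_W def_D;
  def_j0_open : open_immersion def_j0;
  def_jinf_open : open_immersion def_jinf;
  def_cover : forall d, (exists z, def_j0 z = d) \/ (exists w, def_jinf w = d);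
  def_ovl0 : forall z, (exists w, def_j0 z = def_jinf w) <->
    acoord z \is a GRing.unit;
  def_ovlinf : forall w, (exists z, def_j0 z = def_jinf w) <->
    ~ pt_prime def_proj w (tau def_rees);
  def_ident_pt : forall z w, def_j0 z = def_jinf w ->
    forall n b, deg n b ->
    (~ pt_prime def_proj w (re def_rees 0 b) <->
     tgen n (ev S (apr def_Z z) b));
  def_ident : forall z w, def_j0 z = def_jinf w ->
    forall n (l : int) a b (c : Ost (apr def_Z z)),
    idpowz I l a -> deg n a -> deg n b ->
    tgen n (ev S (apr def_Z z) b) ->
    ev S (apr def_Z z) a = c *: ev S (apr def_Z z) b ->
    forall xi, Oreg (def_j0 z) xi ->
    mst def_jinf w (xi (def_jinf w)) =
      fr def_proj w (re def_rees l a) (re def_rees 0 b) ->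
    mst def_j0 z (xi (def_j0 z)) = mst (apr def_Z) z c * acoord z ^ l;
  def_P1 : projspace A 1;
  def_p : mor def_D def_P1;
  def_p0 : forall z,
    ~ pt_prime (pspaceP def_P1) (def_p (def_j0 z)) (tvar A) /\
    mst (compmor def_p def_j0) z
        (fr (pspaceP def_P1) (def_p (def_j0 z)) (uvar A) (tvar A)) = acoord z;
  def_pinf : forall w,
    ~ pt_prime (pspaceP def_P1) (def_p (def_jinf w)) (uvar A) /\
    mst (compmor def_p def_jinf) w
        (fr (pspaceP def_P1) (def_p (def_jinf w)) (tvar A) (uvar A)) =
      fr def_proj w (tau def_rees) 1
}.

(* L' is the restriction to D_Y X of the exterior product of O(1) on P^(N+M)
   and O(1) on P^1, where D_Y X -> P^(N+M) x P^1 extends the map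
   (x, v) |-> ([s_0 : ... : s_N : v t_1 : ... : v t_M], [v : 1]) on
   X x_A Spec A[v]. *)
Definition def_bundle (Df : deformation) (L' : modsheaf (def_D Df)) : Prop :=
  exists (N M : nat) (s : 'I_N.+1 -> forall x, L x)
    (t : 'I_M -> forall x, L x),
  (forall k x, Mreg x (s k)) /\ (forall k x, Mreg x (t k)) /\
  (forall a : S, I a <-> exists c : 'I_M -> S, forall x,
     ev S x a = \sum_(k < M) ev S x (c k) * Tin T x (t k x)) /\
  (exists (PN : projspace A N) (psi : mor X PN),
     closed_immersion psi /\ induced_by psi s) /\
  exists (PNM : projspace A (N + M)) (Phi : mor (def_D Df) PNM)
    (LZ : modsheaf (def_Z Df))
    (hZ : forall z, L (apr (def_Z Df) z) -> LZ z),
  is_pullback hZ /\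
  induced_by (compmor Phi (def_j0 Df))
    (fun (k : 'I_(N.+1 + M)) z =>
       match fintype.split k return LZ z with
       | inl k1 => hZ z (s k1 (apr (def_Z Df) z))
       | inr k2 => acoord z *: hZ z (t k2 (apr (def_Z Df) z))
       end) /\
  exists (E1 E2 : modsheaf (def_D Df)) h1 h2 b,
  @is_pullback A (def_D Df) PNM Phi (pO1 PNM) E1 h1 /\
  @is_pullback A (def_D Df) (def_P1 Df) (def_p Df) (pO1 (def_P1 Df)) E2 h2 /\
  @is_tensor (def_D Df) E1 E2 L' b.

End Deformation.

(* k exhibits F as the fibre of p over the section {l = 0} of P^1, l a linear
   form in u, t: a closed subscheme of D locally cut out by the equation l / g,
   for g a linear form that does not vanish. *)
Definition is_fiber (A : comNzRingType) (P1 : projspace A 1)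
    (D F : ascheme A) (p : mor D P1) (l : mpoly_gralg A 2) (k : mor F D) :
    Prop :=
  [/\ closed_immersion k,
      forall d, (exists x, k x = d) <-> pt_prime (pspaceP P1) (p d) l &
      forall x g, deg 1 g -> ~ pt_prime (pspaceP P1) (p (k x)) g ->
        forall r, mst k x r = 0 <->
          exists c, r = c * mst p (k x) (fr (pspaceP P1) (p (k x)) l g)].

(* k : Proj R' -> Proj R is the morphism induced by q : R -> R' *)
Definition proj_map (A : comNzRingType) (R R' : gralg A) (P P' : ascheme A)
    (HP : is_proj R P) (HP' : is_proj R' P') (q : R -> R') (k : mor P' P) :
    Prop :=
  forall x,
    (forall a, pt_prime HP (k x) a <-> pt_prime HP' x (q a)) /\
    (forall a b, frac_at (pt_prime HP (k x)) 0 a b ->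
       mst k x (fr HP (k x) a b) = fr HP' x (q a) (q b)).

(* Main.v *)
(* On the chart at infinity W = Proj S' the homogeneous coordinates of the map
   Phi : D -> P^(N+M) must be xi = (s_0, ..., s_N, t_1/tau, ..., t_M/tau): this holds where tau
   is invertible, and tau is a nonzerodivisor on W.  The xi have no common zero
   on W because every section of positive degree is in the radical of
   (s_0, ..., s_N): since X is closed in P^N, c s_k^m is for large m a form of
   degree m + deg c in the s_j, and Cayley-Hamilton applied to c acting on the
   ideal generated by the monomials of a large degree makes c integral with
   coefficients in (s_0, ..., s_N).  Hence the loci of the sections x_k t (k <= N)
   and x_k u of L', with u, t the coordinates of P^1, are the affine opens X_(s_k) x A^1 and D_+(xi_k), and they
   cover D.  The fibre over 1 is the image of the section v = 1 of X x A^1 -> X;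
   the fibre over infinity is {tau = 0} = Proj (S'/tau S').  In both cases the
   restriction of L' is recognized by comparing the transition functions
   x_l / x_k of its local generators. *)

Require Import Defs.
From HB Require Import structures.
From mathcomp Require Import all_boot all_order all_algebra.
From mathcomp Require Import all_classical topology.
From mathcomp Require Import ring zify.
From mathcomp Require mpoly.
Import -(notations) mpoly.
Set Implicit Arguments.
Unset Strict Implicit.
Unset Printing Implicit Defensive.
Import GRing.Theory.
Local Open Scope classical_set_scope.
Local Open Scope ring_scope.

(** * Existence of prime ideals *)

(** Sections over an open set are families of germs, and affineness is a list of conditions on them.
    One pattern serves for compactness, annihilation by powers and the description of functions on
    charts: the elements with a good property (a locus of invertibility that satisfies a given
    predicate, a usable denominator, an annihilator) generate an ideal; either this ideal contains a
    power of a prescribed element, or Zorn's lemma gives a prime that contains the generators and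
    avoids the prescribed element, and the point of that prime leads to a contradiction. On Proj the
    pattern has to run with homogeneous primes, because it is what shows that the charts of a closed
    subscheme are affine and that their functions are fractions of homogeneous elements. The
    sections of the two fibres are built on stalks from relations shown to be total, functional and
    compatible with the ring operations. Points such as [apr (sigma x)] and [x] are equal without
    being convertible, so functions are moved as families of germs rather than as single germs. *)

Section PrimeExistence.
Variable R : comPzRingType.
Implicit Types (B P J : R -> Prop) (a b c x : R).

(** The inductive form lets a property stable under [c * b + x] propagate to the whole span by
    [elim], which is how the covering arguments use it. *)
Inductive gen_by B P : R -> Prop :=
| gen_by0 : gen_by B P 0
| gen_by_add c b x : B c -> P b -> gen_by B P x -> gen_by B P (c * b + x).

Lemma gen_byD B P x y : gen_by B P x -> gen_by B P y -> gen_by B P (x + y).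
Proof.
elim=> [|c b z Bc Pb _ IH] gy; first by rewrite add0r.
by rewrite -addrA; apply: gen_by_add => //; exact: IH.
Qed.

Lemma gen_byM B P c x : (forall a b, B a -> B b -> B (a * b)) ->
  B c -> gen_by B P x -> gen_by B P (c * x).
Proof.
move=> BM Bc; elim=> [|d b z Bd Pb _ IH]; first by rewrite mulr0; exact: gen_by0.
by rewrite mulrDr mulrA; apply: gen_by_add => //; exact: BM.
Qed.

Lemma gen_by_mem B P x : B 1 -> P x -> gen_by B P x.
Proof.
by move=> B1 Px; rewrite -[x]mul1r -[_ * _]addr0; apply: gen_by_add => //; exact: gen_by0.
Qed.

Record subring_like B : Prop := {
  sub0 : B 0;
  sub1 : B 1;
  subD : forall a b, B a -> B b -> B (a + b);
  subM : forall a b, B a -> B b -> B (a * b)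
}.

Record prime_in B (q : R -> Prop) : Prop := {
  prime_sub : forall a, q a -> B a;
  prime0 : q 0;
  primeD : forall a b, q a -> q b -> q (a + b);
  primeM : forall a b, B a -> q b -> q (a * b);
  prime_neq1 : ~ q 1;
  primeP : forall a b, B a -> B b -> q (a * b) -> q a \/ q b
}.

(* [B] is a subring because the sections over an open set are only a subring
   of the ring of all families of germs. *)
Lemma exists_prime B P a : subring_like B -> (forall x, P x -> B x) -> B a ->
  (forall m, ~ gen_by B P (a ^+ m)) ->
  exists q, [/\ prime_in B q, forall x, P x -> q x & ~ q a].
Proof.
move=> sB PB Ba aP.
pose good (J : set R) := [/\ forall x, P x -> J x, forall x, J x -> B x & J 0] /\
  [/\ forall x y, J x -> J y -> J (x + y),
     forall x y, B x -> J y -> J (x * y) & forall m, ~ J (a ^+ m)].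
have good_gen : good (gen_by B P).
  split; split=> //.
  - by move=> x; apply: gen_by_mem; exact: sub1.
  - move=> x; elim=> [|c b z Bc Pb _ Bz]; first exact: sub0.
    by apply: subD => //; apply: subM => //; exact: PB.
  - exact: gen_by0.
  - by move=> x y; exact: gen_byD.
  - by move=> x y; apply: gen_byM; exact: subM.
have [|A [[->|gA] Amax]] := @Zorn_bigcup _ [set J : set R | J = set0 \/ good J].
- move=> F FP Ftot; have [[J0 [FJ0 gJ0]]|nogood] :=
    pselect (exists J, F J /\ good J); last first.
    left; rewrite predeqE => x; split=> // -[J FJ Jx].
    by case: (FP _ FJ) => [J0|gJ]; [rewrite J0 in Jx|case: nogood; exists J].
  right; split; split.
  + by move=> x Px; exists J0 => //; case: gJ0 => -[+ _ _] _; apply.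
  + move=> x [J FJ Jx]; case: (FP _ FJ) => [J0'|gJ]; first by rewrite J0' in Jx.
    by case: gJ => -[_ + _] _; apply.
  + by exists J0 => //; case: gJ0 => -[].
  + move=> x y [J FJ Jx] [K FK Ky].
    have [L [FL Lx Ly]] : exists L, [/\ F L, L x & L y].
      by case: (Ftot J K FJ FK) => [/(_ x Jx)|/(_ y Ky)]; [exists K|exists J].
    exists L => //; case: (FP _ FL) => [L0|gL]; first by rewrite L0 in Lx.
    by case: gL => _ [+ _ _]; apply.
  + move=> x y Bx [J FJ Jy]; exists J => //.
    case: (FP _ FJ) => [J0'|gJ]; first by rewrite J0' in Jy.
    by case: gJ => _ [_ + _]; apply.
  + move=> m [J FJ Jm]; case: (FP _ FJ) => [J0'|gJ]; first by rewrite J0' in Jm.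
    by case: gJ => _ [_ _ /(_ m)].
- case: (Amax (gen_by B P)); last by right.
  by rewrite properEneq; split=> //; apply/eqP => h; have := gen_by0 B P; rewrite -h.
have [[PA AB A0] [AD AM Aa]] := gA; exists A.
(* By maximality the ideal generated by [A] and [x] contains a power of [a]. Multiplying two such
   expressions, for [x] and [y] outside [A] with [x * y] in [A], puts a power of [a] in [A]. *)
have step x : B x -> ~ A x -> exists m j b, [/\ A j, B b & a ^+ m = j + b * x].
  move=> Bx nAx.
  pose K : set R := [set y | exists j b, [/\ A j, B b & y = j + b * x]].
  have KB y : K y -> B y.
    by move=> [j [b [Aj Bb ->]]]; apply: subD => //; [exact: AB|exact: subM].
  apply: contrapT => nK; apply: (Amax K).
    rewrite properEneq; split.
      apply/eqP => AK; apply: nAx; rewrite AK; exists 0, 1.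
      by split=> //; [exact: sub1|rewrite mul1r add0r].
    move=> y Ay; exists y, 0; split=> //; first exact: sub0.
    by rewrite mul0r addr0.
  right; split; split=> //.
  - move=> y Py; exists y, 0; split; [exact: PA|exact: sub0|by rewrite mul0r addr0].
  - by exists 0, 0; split; [by []|exact: sub0|rewrite mul0r addr0].
  - move=> y z [j [b [Aj Bb ->]]] [j' [b' [Aj' Bb' ->]]].
    by exists (j + j'), (b + b'); split; [exact: AD|exact: subD|ring].
  - move=> y z By [j [b [Aj Bb ->]]].
    by exists (y * j), (y * b); split; [exact: AM|exact: subM|ring].
  - by move=> m [j [b [Aj Bb e]]]; apply: nK; exists m, j, b.
split=> //.
- split=> //; first by move=> A1; apply: (Aa 0%N); rewrite expr0.
  move=> x y Bx By Axy; have [?|nx] := pselect (A x); first by left.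
  right; apply: contrapT => ny.
  have [m [j [b [Aj Bb e]]]] := step x Bx nx.
  have [n [j' [b' [Aj' Bb' e']]]] := step y By ny.
  apply: (Aa (m + n)%N); rewrite exprD e e'.
  have -> : (j + b * x) * (j' + b' * y) =
     (j' + b' * y) * j + (b * x) * j' + (b * b') * (x * y) by ring.
  apply: (AD); last by apply: (AM) => //; exact: subM.
  apply: (AD); apply: (AM) => //; last exact: subM.
  by apply: subD => //; [exact: AB|exact: subM].
- by move=> Aa'; apply: (Aa 1%N); rewrite expr1.
Qed.

End PrimeExistence.

(** * Homogeneous components and homogeneous primes of a graded algebra *)

Section HomogeneousComponents.
Variables (A : comNzRingType) (R : gralg A).
Implicit Types (a b : R).

Lemma deg0 n : deg n (0 : R).
Proof. by have [m [c [dc _]]] := deg_sum (0 : R); rewrite -(subrr (c n)); exact: degB. Qed.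

Lemma degN n a : deg n a -> deg n (- a).
Proof. by move=> da; rewrite -sub0r; apply: degB => //; exact: deg0. Qed.

Lemma degD n a b : deg n a -> deg n b -> deg n (a + b).
Proof. by move=> da db; rewrite -[b]opprK; apply: degB => //; exact: degN. Qed.

Lemma deg1 : deg 0 (1 : R).
Proof. by rewrite -(rmorph1 (gstr R)); exact: deg_str. Qed.

Lemma degX m n a : deg m a -> deg (m * n) (a ^+ n).
Proof.
move=> da; elim: n => [|n IH]; first by rewrite muln0 expr0; exact: deg1.
by rewrite mulnS exprS; exact: degM.
Qed.

Lemma deg_bigsum n (J : Type) (s : seq J) (P : pred J) (F : J -> R) :
  (forall j, P j -> deg n (F j)) -> deg n (\sum_(j <- s | P j) F j).
Proof. by move=> h; elim/big_ind: _ => //; [exact: deg0|exact: degD]. Qed.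

Lemma degEn m n a : m = n -> deg m a -> deg n a. Proof. by move=> ->. Qed.

Fact hc_key a : {nc : nat * (nat -> R) |
  (forall i, deg i (nc.2 i)) /\ a = \sum_(i < nc.1) nc.2 i}.
Proof. by apply: cid; have [n [c h]] := deg_sum a; exists (n, c). Qed.

(** The homogeneous component of degree [i], read off a chosen decomposition; [hc_uniq] removes the
    dependence on the choice. *)
Definition hc a (i : nat) : R :=
  let nc := sval (hc_key a) in if (i < nc.1)%N then nc.2 i else 0.

Lemma hc_deg a i : deg i (hc a i).
Proof.
by rewrite /hc; case: (hc_key a) => -[n c] /= [dc _]; case: ifP => // _; exact: deg0.
Qed.

Lemma hc_uniq a n (c : nat -> R) i : (forall i, deg i (c i)) ->
  a = \sum_(i < n) c i -> hc a i = if (i < n)%N then c i else 0.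
Proof.
move=> dc ea; rewrite /hc; case: (hc_key a) => -[n' c'] /= [dc' ea'].
pose d k := (if (k < n')%N then c' k else 0) - (if (k < n)%N then c k else 0).
have dd k : deg k (d k).
  by apply: degB; case: ifP => // _; exact: deg0.
(* The range contains both decompositions and the index [i], which may lie beyond them. *)
have d0 : \sum_(k < (n + n' + i).+1) d k = 0.
  rewrite sumrB -!big_mkcond /= !(big_ord_narrow_cond (P := predT)) /=; try lia.
  by rewrite -ea -ea' subrr.
have := deg_free dd d0 (i := i); rewrite /d => h; apply/eqP.
by rewrite -subr_eq0; apply/eqP; apply: h; lia.
Qed.

Lemma hc_sum a : exists n, forall m, (n <= m)%N ->
  hc a m = 0 /\ a = \sum_(i < m) hc a i.
Proof.
have [n [c [dc ea]]] := deg_sum a; exists n => m nm; split.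
  by rewrite (hc_uniq m dc ea) ltnNge nm.
rewrite (eq_bigr (fun i : 'I_m => if (i < n)%N then c i else 0)); last first.
  by move=> j _; rewrite (hc_uniq j dc ea).
by rewrite -big_mkcond /= (big_ord_narrow_cond (P := predT)).
Qed.

Lemma hc_homog n a i : deg n a -> hc a i = if i == n then a else 0.
Proof.
move=> da; pose c k := if k == n then a else 0.
rewrite (@hc_uniq a n.+1 c).
- by rewrite /c; case: eqP => [->|]; rewrite ?ltnSn //; case: ifP.
- by move=> k; rewrite /c; case: eqP => [->//|_]; exact: deg0.
- rewrite big_ord_recr /= /c eqxx big1 ?add0r// => j _.
  by rewrite ltn_eqF.
Qed.

Lemma hcD a b i : hc (a + b) i = hc a i + hc b i.
Proof.
have [n hn] := hc_sum a; have [m hm] := hc_sum b.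
have k1 : (n <= n + m + i.+1)%N by rewrite -addnA leq_addr.
have k2 : (m <= n + m + i.+1)%N by rewrite addnAC leq_addl.
rewrite (@hc_uniq (a + b) (n + m + i.+1) (fun k => hc a k + hc b k)).
- by rewrite ifT //; lia.
- by move=> k; apply: degD; exact: hc_deg.
- by rewrite big_split /= -(hn _ k1).2 -(hm _ k2).2.
Qed.

Lemma hc0 i : hc 0 i = 0.
Proof. by rewrite (hc_homog i (deg0 0)); case: ifP. Qed.

Lemma hc_bigsum (J : Type) (s : seq J) (P : pred J) (F : J -> R) i :
  hc (\sum_(j <- s | P j) F j) i = \sum_(j <- s | P j) hc (F j) i.
Proof. by apply: (big_morph (hc ^~ i)) => [x y|]; [exact: hcD|exact: hc0]. Qed.

Lemma hcMl m a b i : deg m a ->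
  hc (a * b) i = if (m <= i)%N then a * hc b (i - m) else 0.
Proof.
move=> da; have [n hn] := hc_sum b; have [_ eb] := hn _ (leqnn n).
pose c k := if (m <= k)%N then a * hc b (k - m) else 0.
rewrite (@hc_uniq (a * b) (m + n) c).
- case: ltnP => // ni; rewrite /c; case: ifP => // mi.
  by rewrite (hn _ _).1 ?mulr0// leq_subRL.
- move=> k; rewrite /c; case: ifP => [mk|_]; last exact: deg0.
  by apply: (@degEn (m + (k - m))); [rewrite subnKC|apply: degM => //; exact: hc_deg].
- rewrite big_split_ord /= big1 ?add0r; last first.
    by move=> j _; rewrite /c leqNgt ltn_ord.
  rewrite {1}eb mulr_sumr; apply: eq_bigr => j _.
  by rewrite /c leq_addr addKn.
Qed.

Lemma hcM a b k : hc (a * b) k = \sum_(j < k.+1) hc a j * hc b (k - j).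
Proof.
have [n hn] := hc_sum a.
have [_ ea] := hn (n + k.+1)%N (leq_addr _ _).
rewrite {1}ea mulr_suml hc_bigsum.
rewrite (eq_bigr (fun j : 'I_(n + k.+1) =>
   if (j < k.+1)%N then hc a j * hc b (k - j) else 0)); last first.
  by move=> j _; rewrite (hcMl _ _ (hc_deg _ _)) ltnS.
by rewrite -big_mkcond /= (big_ord_narrow_cond (P := predT)) // leq_addl.
Qed.

(** Membership is indexed by the degree because the main instance is the condition that [b / a ^+ n]
    lies in a prime of the chart of [a], which makes sense only for [b] of degree [n]. *)
Record homog_prime (q : nat -> R -> Prop) : Prop := {
  hp_0 : forall n, q n 0;
  hpD : forall n a b, deg n a -> deg n b -> q n a -> q n b -> q n (a + b);
  hpM : forall m n a b, deg m a -> deg n b -> q n b -> q (m + n)%N (a * b);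
  hp_1 : ~ q 0%N 1;
  hp_prime : forall m n a b, deg m a -> deg n b ->
    q (m + n)%N (a * b) -> q m a \/ q n b;
  hp_irr : exists n a, [/\ (0 < n)%N, deg n a & ~ q n a]
}.

(** For primality take the lowest components of [a] and [b] outside [q], of degrees [i] and [j]: in
    degree [i + j] of the product every other term has a factor in [q]. *)
Lemma homog_proj_prime q : homog_prime q ->
  proj_prime (fun a => forall i, q i (hc a i)).
Proof.
move=> hq.
have qsum k (J : Type) (s : seq J) (P : pred J) (F : J -> R) :
    (forall j, P j -> deg k (F j) /\ q k (F j)) -> q k (\sum_(j <- s | P j) F j).
  move=> h; suff [] : deg k (\sum_(j <- s | P j) F j) /\ q k (\sum_(j <- s | P j) F j) by [].
  elim/big_ind: _ => //; first by split; [exact: deg0|exact: hp_0].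
  by move=> x y [dx qx] [dy qy]; split; [exact: degD|exact: hpD].
have qMr m n a b : deg m a -> deg n b -> q m a -> q (m + n)%N (a * b).
  by move=> da db qa; rewrite mulrC addnC; exact: hpM.
have dM j k a b : (j < k.+1)%N -> deg k (hc a j * hc b (k - j)).
  move=> jk; apply: (@degEn (j + (k - j))); first by rewrite subnKC.
  by apply: degM; exact: hc_deg.
have nq a : ~ (forall i, q i (hc a i)) ->
    exists2 i, ~ q i (hc a i) & forall j, (j < i)%N -> q j (hc a j).
  move=> /existsNP [i0 qi0].
  have ex : exists i, ~~ `[< q i (hc a i) >] by exists i0; apply/asboolP.
  case: (ex_minnP ex) => i /asboolP qi imin; exists i => // j ji.
  apply: contrapT => qj; suff : (i <= j)%N by rewrite leqNgt ji.
  by apply: imin; apply/asboolP.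
split.
- by move=> i; rewrite hc0; exact: hp_0.
- by move=> a b qa qb i; rewrite hcD; apply: hpD; rewrite ?hc_deg //; exact: hc_deg.
- move=> a b qb k; rewrite hcM; apply: qsum => j _; split; first exact: dM.
  have := hpM hq (hc_deg a j) (hc_deg b (k - j)) (qb _).
  by rewrite subnKC // -ltnS.
- by move=> /(_ 0%N); rewrite (hc_homog _ deg1) eqxx; exact: hp_1.
- move=> a b qab.
  have [?|/nq [i qi ilt]] := pselect (forall i, q i (hc a i)); first by left.
  have [?|/nq [j qj jlt]] := pselect (forall i, q i (hc b i)); first by right.
  case: (hp_prime hq (hc_deg a i) (hc_deg b j)) => //.
  have := qab (i + j)%N; rewrite hcM.
  have ij : (i < (i + j).+1)%N by rewrite ltnS leq_addr.
  rewrite (bigD1 (Ordinal ij)) //= addKn.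
  set s := (X in _ + X) => qs.
  have -> : hc a i * hc b j = (hc a i * hc b j + s) + (- 1) * s by ring.
  have ds : deg (i + j) s by apply: deg_bigsum => k _; exact: dM.
  have dij : deg (i + j) (hc a i * hc b j) by apply: degM; exact: hc_deg.
  have dN1 : deg 0 (- 1 : R) by apply: degN; exact: deg1.
  apply: hpD => //; [exact: degD|exact: (degM dN1 ds)|].
  rewrite -[(i + j)%N]add0n; apply: hpM => //.
  apply: qsum => k ki; split; first exact: dM.
  have [lki|] := ltnP k i.
    have := qMr _ _ _ _ (hc_deg a k) (hc_deg b (i + j - k)) (ilt _ lki).
    by rewrite subnKC // -ltnS.
  rewrite leq_eqVlt => /orP[/eqP ik|ik].
    by case/eqP: ki; apply: val_inj.
  have kij : (k <= i + j)%N by rewrite -ltnS.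
  have lt : (i + j - k < j)%N by rewrite ltn_subLR // ltn_add2r.
  by have := hpM hq (hc_deg a k) (hc_deg b (i + j - k)) (jlt _ lt); rewrite subnKC.
- move=> a qa; have [n hn] := hc_sum a; exists n, (hc a); split.
    move=> i; split; [exact: hc_deg|move=> j].
    rewrite (hc_homog _ (hc_deg a i)); case: eqP => [->//|_]; exact: hp_0.
  by case: (hn n (leqnn n)).
- have [n [a [n0 da qa]]] := hp_irr hq; exists n, a; split=> // /(_ n).
  by rewrite (hc_homog _ da) eqxx.
Qed.

Lemma homog_primeE q n a : homog_prime q -> deg n a ->
  (forall i, q i (hc a i)) <-> q n a.
Proof.
move=> hq da; split=> [/(_ n)|qa i]; first by rewrite (hc_homog _ da) eqxx.
by rewrite (hc_homog _ da); case: eqP => [->//|_]; exact: hp_0.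
Qed.

Lemma prime_homog_prime (q : R -> Prop) : prime_in (fun=> True) q ->
  (exists n a, [/\ (0 < n)%N, deg n a & ~ q a]) -> homog_prime (fun=> q).
Proof.
move=> pq irr; split=> //.
- by move=> _; exact: (prime0 pq).
- by move=> _ a b _ _; exact: (primeD pq).
- by move=> _ _ a b _ _; exact: (primeM pq).
- exact: (prime_neq1 pq).
- by move=> _ _ a b _ _; exact: (primeP pq).
Qed.

(** The prime given by Zorn's lemma need not be homogeneous; the elements all of whose components
    lie in it form a homogeneous prime, which is only guaranteed to contain the homogeneous elements
    of [P]. *)
Lemma exists_proj_prime (P : R -> Prop) n a : (0 < n)%N -> deg n a ->
  (forall m, ~ gen_by (fun=> True) P (a ^+ m)) ->
  exists q, [/\ proj_prime q, ~ q a & forall k b, deg k b -> P b -> q b].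
Proof.
move=> n0 da Pa.
have sT : subring_like (fun _ : R => True) by split.
have [q [pq Pq qa]] := exists_prime sT (fun _ _ => I) I Pa.
have hq : homog_prime (fun=> q) by apply: prime_homog_prime => //; exists n, a.
exists (fun a => forall i, q (hc a i)); split; first exact: (homog_proj_prime hq).
  by move/(homog_primeE hq da).
by move=> k b db Pb; apply/(homog_primeE hq db); exact: Pq.
Qed.

End HomogeneousComponents.

(** * Quasi-compactness and sections over affine opens *)

(** If [Q U] fails, the sets whose complement in [U] satisfies [Q] form a proper filter, and a
    cluster point contradicts the local hypothesis. In this form compactness is an induction
    principle, with no finite subcover to choose. *)
Lemma compactE (T : topologicalType) (U : set T) : compact U <->
  (forall Q : set T -> Prop, Q set0 -> (forall V W, V `<=` W -> Q W -> Q V) ->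
    (forall V W, Q V -> Q W -> Q (V `|` W)) ->
    (forall x, U x -> exists2 V, nbhs x V & Q V) -> Q U).
Proof.
split=> [cU Q Q0 Qs QU Qn|ind F PF FU].
  apply: contrapT => nQ.
  pose F : set_system T := [set S | Q (U `\` S)].
  have FF : Filter F.
    split.
    - by rewrite /F /= setDT.
    - move=> V W QV QW; rewrite /F /= setDIr; exact: QU.
    - by move=> V W VW; apply: Qs => x [Ux nW]; split=> // /VW.
  have PF : ProperFilter F.
    by apply: Build_ProperFilter => //; rewrite /F /= setD0.
  have FU : F U by rewrite /F /= setDv.
  have [x [Ux clx]] := cU F PF FU.
  have [V Vx QV] := Qn x Ux.
  have [|y [nVy Vy]] := clx (~` V) V _ Vx; last exact: nVy Vy.
  by apply: Qs QV => y [_ /contrapT].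
(* Without a cluster point, the sets whose complement is in [F] satisfy the hypotheses on [Q], so
   the complement of [U] is in [F] together with [U]. *)
apply: contrapT => ncl; have := filter_not_empty F; apply.
have : F (~` U).
  apply: (ind (fun V => F (~` V))).
  - by rewrite setC0; exact: filterT.
  - by move=> V W VW; apply: filterS => x nW /VW.
  - by move=> V W FV FW; rewrite setCU; exact: filterI.
  - move=> x Ux; apply: contrapT => nV; apply: ncl; exists x; split=> // B V FB Vx.
    apply: contrapT => BV; apply: nV; exists V => //.
    by apply: filterS FB => y By Vy; apply: BV; exists y.
by move/(filterI FU); apply: filterS => x [].
Qed.

Section Sheaves.
Variables (X : topologicalType) (F : X -> zmodType).
Variables (reg : X -> (forall x, F x) -> Prop) (hF : is_sheaf reg).

Lemma reg0 x : reg x (fun y => 0).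
Proof.
have [f [fx _]] := reg_germ hF (0 : F x).
apply: (reg_ext hF (regB hF fx fx)); apply: nearW => y; exact: subrr.
Qed.

Lemma regN x f : reg x f -> reg x (fun y => - f y).
Proof.
move=> fx; apply: (reg_ext hF (regB hF (reg0 x) fx)); apply: nearW => y; exact: sub0r.
Qed.

Lemma regD x f g : reg x f -> reg x g -> reg x (fun y => f y + g y).
Proof.
move=> fx gx; apply: (reg_ext hF (regB hF fx (regN gx))).
by apply: nearW => y; rewrite opprK.
Qed.

Lemma reg_sum x (J : Type) (s : seq J) (P : pred J) (f : J -> forall x, F x) :
  (forall j, P j -> reg x (f j)) -> reg x (fun y => \sum_(j <- s | P j) f j y).
Proof.
move=> h; elim: s => [|j s IH].
  by apply: (reg_ext hF (reg0 x)); apply: nearW => y; rewrite big_nil.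
have [Pj|nPj] := boolP (P j).
  apply: (reg_ext hF (regD (h _ Pj) IH)).
  by apply: nearW => y; rewrite big_cons Pj.
by apply: (reg_ext hF IH); apply: nearW => y; rewrite big_cons (negbTE nPj).
Qed.

Lemma reg_eq x f g : reg x f -> reg x g -> f x = g x -> \forall y \near x, f y = g y.
Proof.
move=> fx gx e; have /(reg_eq0 hF) := regB hF fx gx.
by rewrite e subrr => /(_ erefl); apply: filterS => y /eqP; rewrite subr_eq0 => /eqP.
Qed.

End Sheaves.

(** A name for the product of all stalks, so that it can carry the ring structure of which the
    sections over any open set form a subring. *)
Definition dsec (X : lrs) := forall x : X, Ost x.

Section DsecRing.
Variable X : lrs.
HB.instance Definition _ := gen_eqMixin (dsec X).
HB.instance Definition _ := gen_choiceMixin (dsec X).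
Implicit Types f g h : dsec X.

Let addA : associative (fun f g : dsec X => (fun x => f x + g x) : dsec X).
Proof. by move=> f g h; apply: functional_extensionality_dep => x; rewrite addrA. Qed.
Let addC : commutative (fun f g : dsec X => (fun x => f x + g x) : dsec X).
Proof. by move=> f g; apply: functional_extensionality_dep => x; rewrite addrC. Qed.
Let add0 : left_id ((fun x => 0) : dsec X) (fun f g : dsec X => (fun x => f x + g x) : dsec X).
Proof. by move=> f; apply: functional_extensionality_dep => x; rewrite add0r. Qed.
Let addN : left_inverse ((fun x => 0) : dsec X) (fun f : dsec X => (fun x => - f x) : dsec X)
  (fun f g : dsec X => (fun x => f x + g x) : dsec X).
Proof. by move=> f; apply: functional_extensionality_dep => x; rewrite addNr. Qed.
HB.instance Definition _ := GRing.isZmodule.Build (dsec X) addA addC add0 addN.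
Let mulA : associative (fun f g : dsec X => (fun x => f x * g x) : dsec X).
Proof. by move=> f g h; apply: functional_extensionality_dep => x; rewrite mulrA. Qed.
Let mulC : commutative (fun f g : dsec X => (fun x => f x * g x) : dsec X).
Proof. by move=> f g; apply: functional_extensionality_dep => x; rewrite mulrC. Qed.
Let mul1 : left_id ((fun x => 1) : dsec X) (fun f g : dsec X => (fun x => f x * g x) : dsec X).
Proof. by move=> f; apply: functional_extensionality_dep => x; rewrite mul1r. Qed.
Let mulD : left_distributive (fun f g : dsec X => (fun x => f x * g x) : dsec X)
  (fun f g : dsec X => (fun x => f x + g x) : dsec X).
Proof. by move=> f g h; apply: functional_extensionality_dep => x; rewrite mulrDl. Qed.
HB.instance Definition _ := GRing.Zmodule_isComPzRing.Build (dsec X) mulA mulC mul1 mulD.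

Lemma dsecX f n x : (f ^+ n) x = f x ^+ n.
Proof. by elim: n => [|n IH]; rewrite ?expr0 // !exprS -IH. Qed.

End DsecRing.

Section Lrs.
Variable X : lrs.
Implicit Types (x y : X) (f g h : forall x : X, Ost x) (U V : set X).

Lemma Oreg_ext x f g : Oreg x f -> (\forall y \near x, f y = g y) -> Oreg x g.
Proof. exact: (reg_ext (Osheaf X)). Qed.

Lemma Oreg0 x : Oreg x (fun y => 0). Proof. exact: (reg0 (Osheaf X)). Qed.

Lemma OregD x f g : Oreg x f -> Oreg x g -> Oreg x (fun y => f y + g y).
Proof. exact: (regD (Osheaf X)). Qed.

Lemma OregB x f g : Oreg x f -> Oreg x g -> Oreg x (fun y => f y - g y).
Proof. exact: (regB (Osheaf X)). Qed.

Lemma Oreg_eq x f g : Oreg x f -> Oreg x g -> f x = g x -> \forall y \near x, f y = g y.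
Proof. exact: (reg_eq (Osheaf X)). Qed.

Lemma Oreg_near x f : Oreg x f -> \forall y \near x, Oreg y f.
Proof. exact: (reg_near (Osheaf X)). Qed.

Lemma OregX x f n : Oreg x f -> Oreg x (fun y => f y ^+ n).
Proof.
move=> fx; elim: n => [|n IH].
  by apply: (Oreg_ext (Oreg1 x)); apply: nearW => y; rewrite expr0.
by apply: (Oreg_ext (OregM fx IH)); apply: nearW => y; rewrite exprS.
Qed.

Lemma local_unitD x (a b : Ost x) : a + b \is a GRing.unit ->
  a \is a GRing.unit \/ b \is a GRing.unit.
Proof.
move=> u; case/orP: (Olocal (a / (a + b))).
  by rewrite unitrM => /andP[ua _]; left.
have -> : 1 - a / (a + b) = b / (a + b).
  by apply: (mulIr u); rewrite mulrBl !divrK // mul1r addrC addKr.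
by rewrite unitrM => /andP[ub _]; right.
Qed.

Lemma nonunitD x (a b : Ost x) : a \isn't a GRing.unit -> b \isn't a GRing.unit ->
  a + b \isn't a GRing.unit.
Proof. by move=> na nb; apply/negP => /local_unitD [/(negP na)|/(negP nb)]. Qed.

Lemma stalk_neq0 x (a b : Ost x) : a \is a GRing.unit -> a * b = 0 -> b = 0.
Proof. by move=> ua ab; apply: (mulrI ua); rewrite mulr0. Qed.

Lemma Oreg_germ x (a : Ost x) : exists f, Oreg x f /\ f x = a.
Proof. exact: (reg_germ (Osheaf X)). Qed.

Lemma unit_near x f : Oreg x f -> f x \is a GRing.unit ->
  \forall y \near x, f y \is a GRing.unit.
Proof.
move=> fx u; have [g [gx ge]] := Oreg_germ (f x)^-1.
have := Oreg_eq (OregM fx gx) (Oreg1 x) _; rewrite ge divrr // => /(_ erefl).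
by apply: filterS => y fg; apply/unitrPr; exists (g y).
Qed.

Lemma OregV x f : Oreg x f -> f x \is a GRing.unit -> Oreg x (fun y => (f y)^-1).
Proof.
move=> fx u; have [g [gx ge]] := Oreg_germ (f x)^-1.
apply: (Oreg_ext gx).
have := Oreg_eq (OregM fx gx) (Oreg1 x) _; rewrite ge divrr // => /(_ erefl).
move: (unit_near fx u); apply: filterS2 => y fy fg.
by apply: (mulrI fy); rewrite fg divrr.
Qed.

Lemma secO_subring U : subring_like (secO U : dsec X -> Prop).
Proof.
split.
- by move=> x _; exact: Oreg0.
- by move=> x _; exact: Oreg1.
- by move=> f g fU gU x Ux; exact: OregD (fU x Ux) (gU x Ux).
- by move=> f g fU gU x Ux; exact: OregM (fU x Ux) (gU x Ux).
Qed.

Lemma secO_ext U f g : open U -> secO U f -> (forall x, U x -> f x = g x) -> secO U g.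
Proof.
move=> oU fU fg x Ux; apply: (Oreg_ext (fU x Ux)).
by have := open_nbhs_nbhs (conj oU Ux); apply: filterS => y Uy; exact: fg.
Qed.

Lemma prime_of_sections_in U (q : dsec X -> Prop) : open U ->
  prime_in (secO U : dsec X -> Prop) q ->
  (forall f : dsec X, (forall x, U x -> f x = 0) -> q f) -> prime_of_sections U q.
Proof.
move=> oU pq q0; split.
- exact: (prime_sub pq).
- move=> f g qf fg; have -> : g = (f : dsec X) + ((fun x => g x - f x) : dsec X).
    by apply: functional_extensionality_dep => x; rewrite [RHS]addrC /= subrK.
  by apply: (primeD pq) => //; apply: q0 => x Ux; rewrite fg ?subrr.
- exact: (prime0 pq).
- exact: (primeD pq).
- by move=> f g fU qg; exact: (primeM pq).
- exact: (prime_neq1 pq).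
- by move=> f g fU gU; exact: (primeP pq).
Qed.

(* Sections over [U] are represented by families on all of [X], so the prime
   ideals in play contain the families that vanish on [U]. *)
Lemma affine_nullstellensatz U (P : dsec X -> Prop) (a : dsec X) : affine_open U ->
  (forall g, P g -> secO U g) -> secO U a ->
  (forall y, U y -> a y \is a GRing.unit -> exists2 g, P g & g y \is a GRing.unit) ->
  exists m g, gen_by (secO U : dsec X -> Prop) P g /\ forall y, U y -> a y ^+ m = g y.
Proof.
move=> aU PU asec cov; have oU := aff_open aU.
pose P' (g : dsec X) := P g \/ forall y, U y -> g y = 0.
have strip g : gen_by (secO U : dsec X -> Prop) P' g ->
    exists2 g', gen_by (secO U : dsec X -> Prop) P g' & forall y, U y -> g y = g' y.
  elim=> [|c b z cU Pb _ [g' gg' e]]; first by exists 0 => //; exact: gen_by0.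
  case: Pb => [Pb|b0].
    exists (c * b + g'); first exact: gen_by_add.
    by move=> y Uy; congr (_ + _); exact: e.
  exists g' => // y Uy; have E : (c * b + z) y = c y * b y + z y by [].
  by rewrite E b0 // mulr0 add0r; exact: e.
have [[m /strip[g gg e]]|nm] := pselect (exists m, gen_by (secO U : dsec X -> Prop) P' (a ^+ m)).
  by exists m, g; split=> // y Uy; rewrite -e // dsecX.
have P'U (g : dsec X) : P' g -> secO U g.
  case=> [/PU//|g0]; apply: (secO_ext (f := fun y => 0) oU).
    by move=> x _; exact: Oreg0.
  by move=> x Ux; rewrite g0.
have [|q [pq Pq qa]] := exists_prime (secO_subring U) P'U asec.
  by move=> m h; apply: nm; exists m.
have [|x Ux qx] := aff_surj aU (q := q).
  by apply: prime_of_sections_in => // f f0; apply: Pq; right.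
have [|g Pg gx] := cov x Ux.
  by apply/negPn/negP => /(qx _ asec).
have /(qx _ (PU _ Pg)) := Pq g (or_introl Pg).
by rewrite gx.
Qed.

(** Where [h] is invertible the germ of [f] is zero, so by [aff_ker] some annihilator of [f] is
    invertible there. The Nullstellensatz then expresses a power of [h] through annihilators of
    [f]. *)
Lemma affine_kill U f h : affine_open U -> secO U h -> secO U f ->
  (forall y, U y -> h y \is a GRing.unit -> f y = 0) ->
  exists m, forall y, U y -> h y ^+ m * f y = 0.
Proof.
move=> aU hU fU hf.
pose P (g : dsec X) := secO U g /\ forall y, U y -> g y * f y = 0.
have [|//||m [g [gg e]]] := @affine_nullstellensatz U P h aU; first by move=> g [].
  move=> y Uy uy; have [g [gU gu gf]] := aff_ker aU Uy fU (hf _ Uy uy).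
  by exists g.
exists m => y Uy; rewrite e //.
elim: gg {e} => [|c b z _ [_ bf] _ IH]; first exact: mul0r.
by rewrite [LHS]mulrDl -mulrA bf // mulr0 add0r; exact: IH.
Qed.

(** A sum is invertible only where one of its terms is, so the functions whose locus of
    invertibility satisfies [Q] are stable under combinations; the Nullstellensatz writes 1 as such
    a combination. *)
Lemma affine_compact U : affine_open U -> compact U.
Proof.
move=> aU; apply/compactE => Q Q0 Qs QU Qn.
pose P (g : dsec X) := secO U g /\ Q [set y | U y /\ g y \is a GRing.unit].
have [|||m [g [gg e]]] := @affine_nullstellensatz U P (1 : dsec X) aU.
- by move=> g [].
- exact: sub1 (secO_subring U).
- move=> y Uy _; have [V Vy QV] := Qn y Uy.
  move: Vy; rewrite nbhsE => -[W [oW Wy] WV].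
  have [g gU [gy gW]] := aff_basis aU Uy oW Wy.
  exists g => //; split=> //; apply: Qs QV => z [Uz uz]; exact/WV/gW.
suff : Q [set y | U y /\ g y \is a GRing.unit].
  by apply: Qs => y Uy; split=> //; rewrite -e // expr1n unitr1.
elim: gg {e} => [|c b z _ [_ Qb] _ IH].
  by apply: Qs Q0 => y [_]; rewrite /= unitr0.
apply: (Qs) (QU _ _ Qb IH) => y [Uy] /local_unitD [|u]; last by right.
by rewrite unitrM => /andP[_ u]; left.
Qed.

End Lrs.

Section Schemes.
Variables (A : comNzRingType).
Implicit Types (X Y : ascheme A).

(** Near [x] both functions are fractions of sections over an affine neighbourhood [U], and
    [affine_kill] is applied to the numerators. The factor [e] confines the comparison to the locus
    [V] where the fractions are valid. *)
Lemma kill_local X (x : X) (h f : forall x : X, Ost x) : Oreg x h -> Oreg x f ->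
  (\forall y \near x, h y \is a GRing.unit -> f y = 0) ->
  exists m, \forall y \near x, h y ^+ m * f y = 0.
Proof.
move=> hx fx hf; have [U aU Ux] := sch_affine x.
have [h1 [g1 [h1U g1U g1x eh]]] := aff_frac aU (h x) Ux.
have [f2 [g2 [f2U g2U g2x ef]]] := aff_frac aU (f x) Ux.
have nh : \forall y \near x, h y * g1 y = h1 y.
  by apply: Oreg_eq => //; [apply: OregM => //; exact: g1U|exact: h1U].
have nf : \forall y \near x, f y * g2 y = f2 y.
  by apply: Oreg_eq => //; [apply: OregM => //; exact: g2U|exact: f2U].
pose V := [set y | [/\ h y * g1 y = h1 y, f y * g2 y = f2 y &
  (h y \is a GRing.unit -> f y = 0)] /\
  (g1 y \is a GRing.unit /\ g2 y \is a GRing.unit)].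
have : nbhs x V.
  have n1 := unit_near (g1U x Ux) g1x; have n2 := unit_near (g2U x Ux) g2x.
  by near=> y; split; split; near: y.
rewrite nbhsE => -[W [oW Wx] WV].
have [e eU [ex eW]] := aff_basis aU Ux oW Wx.
have eV y : U y -> e y \is a GRing.unit -> V y by move=> Uy ey; exact/WV/eW.
have [|||m km] := @affine_kill _ U f2 (fun y => e y * h1 y) aU.
- by move=> y Uy; apply: OregM; [exact: eU|exact: h1U].
- exact: f2U.
- move=> y Uy; rewrite unitrM => /andP[uy]; have [[eh1 ef1 hf1] [_ _]] := eV y Uy uy.
  by rewrite -eh1 unitrM -ef1 => /andP[/hf1 -> _]; rewrite mul0r.
exists m; have nU := open_nbhs_nbhs (conj (aff_open aU) Ux).
have ne := unit_near (eU x Ux) ex.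
near=> y.
have Uy : U y by near: y.
have uy : e y \is a GRing.unit by near: y.
have [[eh1 ef1 hf1] [u1 u2]] := eV y Uy uy.
have := km y Uy; rewrite -eh1 -ef1 => k.
have u : e y ^+ m * g1 y ^+ m * g2 y \is a GRing.unit.
  by rewrite !unitrM !unitrX.
by apply: (stalk_neq0 u); rewrite -k !exprMn; ring.
Unshelve. all: by end_near. Qed.

Lemma mst_unit X Y (f : mor X Y) (x : X) (a : Ost (f x)) :
  (mst f x a \is a GRing.unit) = (a \is a GRing.unit).
Proof. by apply/idP/idP => [/m_local//|]; exact: rmorph_unit. Qed.

Lemma near_mor X Y (f : mor X Y) (x : X) (P : Y -> Prop) :
  (\forall y \near f x, P y) -> \forall z \near x, P (f z).
Proof. by move=> h; have /(_ P h) := @m_cont _ _ _ f x. Qed.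

End Schemes.

(** * Fractions on Proj and closed immersions into Proj *)

Lemma kill_compact (A : comNzRingType) (X : ascheme A) (U : set X)
    (h f : forall x : X, Ost x) : compact U -> secO U h -> secO U f ->
  (forall x, U x -> \forall y \near x, h y \is a GRing.unit -> f y = 0) ->
  exists m, forall y, U y -> h y ^+ m * f y = 0.
Proof.
move=> /compactE cU hU fU hf.
apply: (cU (fun V => exists m, forall y, V y -> h y ^+ m * f y = 0)).
- by exists 0%N.
- by move=> V W VW [m k]; exists m => y /VW; exact: k.
- move=> V W [m k] [n l]; exists (m + n)%N => y [/k|/l] e.
    by rewrite exprD mulrAC e mul0r.
  by rewrite exprD -mulrA e mulr0.
- move=> x Ux; have [m k] := kill_local (hU x Ux) (fU x Ux) (hf x Ux).
  by exists [set y | h y ^+ m * f y = 0] => //; exists m.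
Qed.

Section ProjBasics.
Variables (A : comNzRingType) (R : gralg A) (P : ascheme A) (HP : is_proj R P).
Implicit Types (x y : P) (a b c d e : R).
Local Notation q := (pt_prime HP).

Lemma frac0 x k a b : deg k a -> deg k b -> ~ q x b -> frac_at (q x) 0 a b.
Proof. by move=> da db qb; exists k; rewrite addn0. Qed.

Lemma pr_notM x a b : ~ q x a -> ~ q x b -> ~ q x (a * b).
Proof. by move=> qa qb /(pr_prime (pt_primeP HP x)) []. Qed.

Lemma pr_notM_l x a b : ~ q x (a * b) -> ~ q x a.
Proof. by move=> h qa; apply: h; rewrite mulrC; exact: (prM (pt_primeP HP x)). Qed.

Lemma pr_notM_r x a b : ~ q x (a * b) -> ~ q x b.
Proof. by move=> h qb; apply: h; exact: (prM (pt_primeP HP x)). Qed.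

Lemma pr_notX x a n : ~ q x a -> ~ q x (a ^+ n).
Proof.
move=> qa; elim: n => [|n IH]; first by rewrite expr0; exact: (pr_1 (pt_primeP HP x)).
by rewrite exprS; exact: pr_notM.
Qed.

Lemma pr_not1 x : ~ q x 1. Proof. exact: (pr_1 (pt_primeP HP x)). Qed.

Lemma pr_notD x a b : ~ q x (a + b) -> ~ q x a \/ ~ q x b.
Proof.
move=> h; apply: contrapT => /not_orP [/contrapT qa /contrapT qb].
by apply: h; exact: (prD (pt_primeP HP x)).
Qed.

Lemma fr_eqP x a b c d k l : deg k a -> deg k b -> ~ q x b ->
  deg l c -> deg l d -> ~ q x d ->
  (fr HP x a b = fr HP x c d <->
   exists n e, [/\ deg n e, ~ q x e & e * (a * d - c * b) = 0]).
Proof. by move=> da db qb dc dd qd; apply: fr_eq; apply: frac0; eassumption. Qed.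

Lemma fr_eqM x a b c d k l : deg k a -> deg k b -> ~ q x b ->
  deg l c -> deg l d -> ~ q x d -> a * d = c * b -> fr HP x a b = fr HP x c d.
Proof.
move=> da db qb dc dd qd e; apply/(fr_eqP da db qb dc dd qd).
by exists 0%N, 1; split; [exact: deg1|exact: pr_not1|rewrite e subrr mulr0].
Qed.

Lemma fr11 x : fr HP x 1 1 = 1.
Proof. by rewrite -{1}(rmorph1 (gstr R)) fr_str rmorph1. Qed.

Lemma frvv x a k : deg k a -> ~ q x a -> fr HP x a a = 1.
Proof.
move=> da qa; rewrite -(fr11 x); apply: (fr_eqM da da qa (deg1 R) (deg1 R)).
  exact: pr_not1.
by rewrite mulrC.
Qed.

Lemma fr01 x : fr HP x 0 1 = 0.
Proof. by rewrite -{1}(rmorph0 (gstr R)) fr_str rmorph0. Qed.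

Lemma fr0 x b k : deg k b -> ~ q x b -> fr HP x 0 b = 0.
Proof.
move=> db qb; rewrite -(fr01 x).
apply: (fr_eqM (deg0 R k) db qb (deg0 R 0) (deg1 R)); first exact: pr_not1.
by rewrite !mul0r.
Qed.

Lemma fr_eq0 x a b k : deg k a -> deg k b -> ~ q x b ->
  (fr HP x a b = 0 <-> exists n e, [/\ deg n e, ~ q x e & e * a = 0]).
Proof.
move=> da db qb; rewrite -(fr01 x).
rewrite (fr_eqP da db qb (deg0 R 0) (deg1 R) (@pr_not1 x)).
by split=> -[n [e [de qe h]]]; exists n, e; split=> //; move: h;
  rewrite mulr1 mul0r subr0.
Qed.

Lemma frM_ x a b c d k l : deg k a -> deg k b -> ~ q x b ->
  deg l c -> deg l d -> ~ q x d ->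
  fr HP x a b * fr HP x c d = fr HP x (a * c) (b * d).
Proof. by move=> da db qb dc dd qd; apply: frM; apply: frac0; eassumption. Qed.

Lemma frD_ x a b c k : deg k a -> deg k c -> deg k b -> ~ q x b ->
  fr HP x a b + fr HP x c b = fr HP x (a + c) b.
Proof.
move=> da dc db qb; rewrite frD; [|by apply: frac0; eassumption..].
apply: (@fr_eqM _ _ _ _ _ (k + k) k) => //.
- by apply: degD; apply: degM.
- exact: degM.
- exact: pr_notM.
- exact: degD.
- by ring.
Qed.

Lemma frMcancel x a b c k l : deg k a -> deg k b -> ~ q x b -> deg l c -> ~ q x c ->
  fr HP x (a * c) (b * c) = fr HP x a b.
Proof.
move=> da db qb dc qc; apply: (@fr_eqM _ _ _ _ _ (k + l) k) => //.
- exact: degM.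
- exact: degM.
- exact: pr_notM.
- by ring.
Qed.

Lemma frX x a b k n : deg k a -> deg k b -> ~ q x b ->
  fr HP x a b ^+ n = fr HP x (a ^+ n) (b ^+ n).
Proof.
move=> da db qb; elim: n => [|n IH]; first by rewrite !expr0 fr11.
by rewrite !exprS IH (frM_ da db qb (degX n da) (degX n db)) //; exact: pr_notX.
Qed.

Lemma fr_unit x a b k : deg k a -> deg k b -> ~ q x b ->
  (fr HP x a b \is a GRing.unit) <-> ~ q x a.
Proof.
move=> da db qb; split; last first.
  move=> qa; apply/unitrPr; exists (fr HP x b a).
  rewrite (frM_ da db qb db da qa) mulrC; apply: (@frvv _ _ (k + k)).
    exact: degM.
  exact: pr_notM.
move=> /unitrPr [r]; have [c [d [fcd ->]]] := fr_surj HP r.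
have fab : frac_at (q x) 0 a b by exact: frac0 da db qb.
have [l [dc dd qd]] := fcd; rewrite addn0 in dc.
rewrite frM // -(fr11 x) => /(fr_eqP (degM da dc) (degM db dd) (pr_notM qb qd)
  (deg1 R) (deg1 R) (@pr_not1 x)) [n [e [de qe]]].
rewrite mulr1 mul1r => E qa.
have [] := pr_notM qe (pr_notM qb qd).
have -> : e * (b * d) = (e * c) * a by apply/esym/eqP; rewrite -subr_eq0 -E; apply/eqP; ring.
exact: (prM (pt_primeP HP x)).
Qed.

Lemma fr_nonunit x a b k : deg k a -> deg k b -> ~ q x b ->
  (fr HP x a b \isn't a GRing.unit) <-> q x a.
Proof.
move=> da db qb; have h := fr_unit da db qb.
split; first by move=> /negP u; apply: contrapT => /h.
by move=> qa; apply/negP => /h.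
Qed.

Lemma pr_near x a n : deg n a -> ~ q x a -> \forall y \near x, ~ q y a.
Proof.
(* Open sets of Proj are tested with elements of positive degree, so [a], whose degree may be 0, is
   multiplied by such an element outside the prime. *)
move=> da qa; have [m [e [m0 de qe]]] := pr_irr (pt_primeP HP x).
have : open_nbhs x [set y | ~ q y (a * e)].
  split; last exact: pr_notM.
  apply: (Defs.proj_open HP _).2 => y qae; exists (n + m)%N, (a * e).
  by split=> //; [rewrite addn_gt0 m0 orbT|exact: degM].
by move/open_nbhs_nbhs; apply: filterS => y /pr_notM_l.
Qed.

Lemma fr_Oreg x a b k : deg k a -> deg k b -> ~ q x b ->
  Oreg x (fun y => fr HP y a b).
Proof.
move=> da db qb; apply/(fr_reg HP); exists a, b.
by apply: filterS (pr_near db qb) => y qyb; split=> //; exact: frac0 da db qyb.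
Qed.

Lemma pr_basis x (V : set P) : nbhs x V ->
  exists n a, [/\ (0 < n)%N, deg n a, ~ q x a & forall y, ~ q y a -> V y].
Proof.
rewrite nbhsE => -[W [oW Wx] WV].
have [n [a [n0 da qa aW]]] := (Defs.proj_open HP W).1 oW x Wx.
by exists n, a; split=> // y /aW /WV.
Qed.

Lemma fr_surj_ x (r : Ost x) : exists k a b,
  [/\ deg k a, deg k b, ~ q x b & r = fr HP x a b].
Proof.
have [a [b [[k [da db qb]] ->]]] := fr_surj HP r.
by exists k, a, b; split=> //; rewrite -[k]addn0.
Qed.

End ProjBasics.

(** * Affine charts of closed subschemes of Proj *)

Section ClosedImmersionProj.
Variables (A : comNzRingType) (R : gralg A) (P Z : ascheme A) (HP : is_proj R P).
Variables (f : mor Z P) (hf : closed_immersion f).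
Implicit Types (x y : P) (z : Z) (b c d e : R).
Local Notation q := (pt_prime HP).

(** The image of the closed complement of a neighbourhood is closed and misses [f z] by injectivity,
    so a basic open set of Proj around [f z] avoids it. *)
Lemma ci_nbhs z (V : set Z) : nbhs z V -> exists n b,
  [/\ (0 < n)%N, deg n b, ~ q (f z) b & forall z', ~ q (f z') b -> V z'].
Proof.
case: hf => finj fcl _; rewrite nbhsE => -[W [oW Wz] WV].
have cl : closed (f @` ~` W) by apply: fcl; exact: open_closedC.
have oC : open (~` (f @` ~` W)) by exact: closed_openC.
have [|n [b [n0 db qb bW]]] := pr_basis HP (x := f z) (V := ~` (f @` ~` W)).
  apply: open_nbhs_nbhs; split=> // -[z' nWz' /finj ez]; by rewrite ez in nWz'.
exists n, b; split=> // z' /bW h; apply/WV; apply: contrapT => nW; apply: h.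
by exists z'.
Qed.

Lemma ci_outside y : ~ (exists z, f z = y) -> exists n b,
  [/\ (0 < n)%N, deg n b, ~ q y b & forall z, q (f z) b].
Proof.
move=> ny; case: hf => _ fcl _.
have oC : open (~` (f @` [set: Z])) by apply: closed_openC; apply: fcl; exact: closedT.
have [|n [b [n0 db qb bW]]] := pr_basis HP (x := y) (V := ~` (f @` setT)).
  by apply: open_nbhs_nbhs; split=> // -[z _ ez]; apply: ny; exists z.
exists n, b; split=> // z; apply: contrapT => /bW; apply; by exists z.
Qed.

Variables (a : R) (da : deg 1 a).
Let U : set Z := [set z | ~ q (f z) a].

Let dX k : deg k (a ^+ k).
Proof. by have := degX k da; rewrite mul1n. Qed.

Let qX z k : U z -> ~ q (f z) (a ^+ k).
Proof. by move=> Uz; exact: pr_notX. Qed.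

Lemma ci_open : open U.
Proof. by rewrite openE => z Uz; exact: (near_mor (pr_near da Uz)). Qed.

(** If no power of [a] is generated by the [b] whose locus in [U] satisfies [Q], a homogeneous prime
    avoids [a] and contains every homogeneous such [b]. Its point is not on [Z], by the local
    hypothesis, nor off [Z], where some [b] outside the prime vanishes at all points of [Z] and so
    has an empty locus. *)
Lemma ci_compact : compact U.
Proof.
apply/compactE => Q Q0 Qs QU Qn.
pose P0 b := Q [set z | U z /\ ~ q (f z) b].
have [[m am]|nm] := pselect (exists m, gen_by (fun=> True) P0 (a ^+ m)).
  have : P0 (a ^+ m).
    elim: am => [|c b x _ Pb _ Px]; rewrite /P0.
      by apply: Qs Q0 => z [_] /=; case; exact: (pr_0 (pt_primeP HP _)).
    apply: (Qs) (QU _ _ Pb Px) => z /= [Uz /pr_notD []]; last by right.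
    by move=> /pr_notM_r; left.
  by apply: Qs => z Uz; split=> //; exact: qX.
exfalso; have [|p [pp pa Pp]] := @exists_proj_prime A R P0 1 a isT da.
  by move=> m am; apply: nm; exists m.
have [y hy] := pt_surj HP pp.
have [[z ez]|ny] := pselect (exists z, f z = y).
  have Uz : U z by rewrite /U /= ez => /hy.
  have [V Vz QV] := Qn z Uz.
  have [n [b [n0 db qb bV]]] := ci_nbhs Vz.
  apply: qb; rewrite ez; apply/hy; apply: (Pp _ _ db).
  by apply: Qs QV => z' [_ /bV].
have [n [b [n0 db qb bz]]] := ci_outside ny.
apply: (qb); apply/hy; apply: (Pp _ _ db).
by apply: Qs Q0 => z' [_] /=; case.
Qed.

Local Notation psi k b := (fun z => mst f z (fr HP (f z) b (a ^+ k))).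

Lemma ci_psi_sec k b : deg k b -> secO U (psi k b).
Proof. by move=> db z Uz; exact: (m_reg (m := f) (fr_Oreg db (dX k) (@qX _ k Uz))). Qed.

Let psiM k l b c z : deg k b -> deg l c -> U z ->
  mst f z (fr HP (f z) (b * c) (a ^+ (k + l))) =
  mst f z (fr HP (f z) b (a ^+ k)) * mst f z (fr HP (f z) c (a ^+ l)).
Proof.
by move=> db dc Uz; rewrite -rmorphM (frM_ db (dX k) (@qX _ k Uz) dc (dX l) (@qX _ l Uz)) exprD.
Qed.

Let psiD k b c z : deg k b -> deg k c -> U z ->
  mst f z (fr HP (f z) (b + c) (a ^+ k)) =
  mst f z (fr HP (f z) b (a ^+ k)) + mst f z (fr HP (f z) c (a ^+ k)).
Proof. by move=> db dc Uz; rewrite -rmorphD (frD_ db dc (dX k) (@qX _ k Uz)). Qed.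

Let psi0 k z : U z -> mst f z (fr HP (f z) 0 (a ^+ k)) = 0.
Proof. by move=> Uz; rewrite (fr0 (dX k) (@qX _ k Uz)) rmorph0. Qed.

Let psiX k n b z : deg k b -> U z ->
  mst f z (fr HP (f z) (b ^+ n) (a ^+ (k * n))) =
  mst f z (fr HP (f z) b (a ^+ k)) ^+ n.
Proof.
by move=> db Uz; rewrite exprM -rmorphXn (frX n db (dX k) (@qX _ k Uz)).
Qed.

Let psi_unit k b z : deg k b -> U z ->
  (mst f z (fr HP (f z) b (a ^+ k)) \is a GRing.unit) <-> ~ q (f z) b.
Proof. by move=> db Uz; rewrite mst_unit; exact: (fr_unit db (dX k) (@qX _ k Uz)). Qed.

Lemma ci_kill k e (F : forall z : Z, Ost z) : deg k e -> secO U F ->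
  (forall z, U z -> ~ q (f z) e -> F z = 0) ->
  exists m, forall z, U z -> mst f z (fr HP (f z) e (a ^+ k)) ^+ m * F z = 0.
Proof.
move=> de FU eF; apply: (kill_compact ci_compact (ci_psi_sec de) FU) => x Ux.
have := open_nbhs_nbhs (conj ci_open Ux); apply: filterS => z Uz.
by move=> /(psi_unit de Uz); exact: eF.
Qed.

(** [P0 k b] says that [b] is a denominator for [F]: its product with [F] is again a fraction. If
    the denominators did not generate a power of [a], the point of a prime containing them would be
    on [Z], where surjectivity on stalks supplies a denominator outside the prime, or off [Z], where
    some element vanishing at all points of [Z] has a power that is a denominator. *)
Lemma ci_surj (F : forall z : Z, Ost z) : secO U F ->
  exists k b, deg k b /\ forall z, U z -> F z = mst f z (fr HP (f z) b (a ^+ k)).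
Proof.
move=> FU.
pose P0 k b := deg k b /\ exists e, deg k e /\ forall z, U z ->
  mst f z (fr HP (f z) b (a ^+ k)) * F z = mst f z (fr HP (f z) e (a ^+ k)).
have [[m am]|nm] := pselect (exists m, gen_by (fun=> True) (fun b => exists k, P0 k b) (a ^+ m)).
  have : P0 m (a ^+ m).
    (* The coefficients of the combination are not homogeneous, so the induction is on its component
       of an arbitrary degree. *)
    have -> : a ^+ m = hc (a ^+ m) m by rewrite (hc_homog _ (dX m)) eqxx.
    move: {1 3}m => k; elim: am => [|c b x _ [l [db [e [de be]]]] _ [dx [e' [de' xe]]]].
      rewrite hc0; split; first exact: deg0.
      by exists 0; split; [exact: deg0|move=> z Uz; rewrite psi0 // mul0r].
    split; first exact: hc_deg.
    rewrite hcD mulrC (hcMl _ _ db); case: ifP => lk; last first.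
      by exists e'; split=> // z Uz; rewrite add0r; exact: xe.
    have dd := hc_deg c (k - l); set d := hc c (k - l) in dd *.
    have dbd : deg k (b * d) by rewrite -(subnKC lk); exact: degM.
    have ded : deg k (e * d) by rewrite -(subnKC lk); exact: degM.
    exists (e * d + e'); split; first exact: degD.
    move=> z Uz; rewrite !psiD // mulrDl xe //; congr (_ + _).
    by rewrite -(subnKC lk) !psiM // mulrAC be.
  move=> [_ [e [de h]]]; exists m, e; split=> // z Uz; rewrite -h //.
  by rewrite (frvv (dX m) (@qX _ m Uz)) rmorph1 mul1r.
exfalso; have [|p [pp pa Pp]] := @exists_proj_prime A R (fun b => exists k, P0 k b) 1 a isT da.
  by move=> m am; apply: nm; exists m.
have [y hy] := pt_surj HP pp.
have [[z ez]|ny] := pselect (exists z, f z = y).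
  have Uz : U z by rewrite /U /= ez => /hy.
  have [_ _ /(_ z (F z)) [r rF]] := hf.
  have [k [b [c [db dc qc er]]]] := fr_surj_ HP r.
  have ne : \forall z' \near z, F z' = mst f z' (fr HP (f z') b c).
    apply: Oreg_eq; [exact: FU|exact: (m_reg (m := f) (fr_Oreg db dc qc))|].
    by rewrite -rF er.
  have nc : \forall z' \near z, ~ q (f z') c.
    by exact: (near_mor (pr_near dc qc)).
  have [n [e [n0 de qe eV]]] := ci_nbhs (filterI ne nc).
  (* [G] is the defect of the equation [F = b / c]. It vanishes where [e] does not, so a power of
     [e] kills it and this power times [c] is a denominator. *)
  pose G z' := mst f z' (fr HP (f z') c (a ^+ k)) * F z' - mst f z' (fr HP (f z') b (a ^+ k)).
  have [||m km] := @ci_kill n e G de.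
  - move=> z' Uz'; apply: OregB; last exact: ci_psi_sec.
    by apply: OregM; [exact: ci_psi_sec|exact: FU].
  - move=> z' Uz' /eV [E qc']; rewrite /G E -rmorphM.
    rewrite (frM_ dc (dX k) (@qX _ k Uz') db dc qc') [c * b]mulrC.
    by rewrite (frMcancel db (dX k) (@qX _ k Uz') dc qc') subrr.
  have : ~ q (f z) (e ^+ m * c) by apply: pr_notM => //; exact: pr_notX.
  case; rewrite ez; apply/hy; apply: (Pp (n * m + k)%N).
    by apply: degM => //; exact: degX.
  exists (n * m + k)%N; split; first by apply: degM => //; exact: degX.
  exists (e ^+ m * b); split; first by apply: degM => //; exact: degX.
  move=> z' Uz'; rewrite !psiM ?psiX //; try exact: degX.
  apply/eqP; rewrite -subr_eq0 -mulrA -mulrBr; apply/eqP; exact: km.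
have [n [e [n0 de qe ez]]] := ci_outside ny.
have [||m km] := @ci_kill n e (fun z => 1) de.
- by move=> z' Uz'; exact: Oreg1.
- by move=> z' Uz' []; exact: ez.
have : ~ q y (e ^+ m) by exact: pr_notX.
case; apply/hy; apply: (Pp (n * m)%N); first exact: degX.
exists (n * m)%N; split; first exact: degX.
exists 0; split; first exact: deg0.
by move=> z' Uz'; rewrite psi0 // psiX // -[_ ^+ m]mulr1 km // mul0r.
Qed.

(** A prime [p] of sections over [U] gives the homogeneous prime of the [b] with [b / a ^+ k] in
    [p]. Its point lies on [Z], since an element vanishing at all points of [Z] has a power with
    zero image, hence in [p]. By [ci_surj] all sections are such fractions, so the point determines
    [p]. *)
Lemma ci_affine : affine_open U.
Proof.
have oU := ci_open.
split=> //.
- move=> p pp.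
  have pext (g h : forall z : Z, Ost z) : (forall z, U z -> g z = h z) -> p g <-> p h.
    by move=> e; split=> ph; apply: (ps_ext pp ph) => z Uz; rewrite e.
  have pcl (g h : forall z : Z, Ost z) : p g -> (forall z, U z -> g z = h z) -> p h.
    by move=> pg e; exact: (ps_ext pp pg e).
  pose q0 k b := p (psi k b).
  have hq0 : homog_prime q0.
    split.
    - move=> k; apply/(pext _ (fun z => 0)); last exact: ps_0 pp.
      by move=> z Uz; rewrite psi0.
    - move=> k b c db dc pb pc.
      apply/(pext _ (fun z => psi k b z + psi k c z)); last exact: (psD pp).
      by move=> z Uz; rewrite psiD.
    - move=> k l b c db dc pc.
      apply/(pext _ (fun z => psi k b z * psi l c z)).
        by move=> z Uz; rewrite psiM.
      by apply: (psM pp) => //; exact: ci_psi_sec.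
    - move=> h; apply: (ps_1 pp); apply: (pcl _ _ h) => z Uz.
      by rewrite expr0 fr11 rmorph1.
    - move=> k l b c db dc h; apply: (ps_prime pp); try exact: ci_psi_sec.
      by apply: (pcl _ _ h) => z Uz; rewrite psiM.
    - exists 1%N, a; split=> // h; apply: (ps_1 pp); apply: (pcl _ _ h) => z Uz.
      by rewrite expr1 (frvv da Uz) rmorph1.
  have [y hy] := pt_surj HP (homog_proj_prime hq0).
  have hyE k b : deg k b -> q y b <-> q0 k b.
    by move=> db; rewrite hy; exact: homog_primeE.
  have qa : ~ q y a.
    move/(hyE _ _ da); rewrite /q0 => h; apply: (ps_1 pp); apply: (pcl _ _ h) => z Uz.
    by rewrite expr1 (frvv da Uz) rmorph1.
  have [[z ez]|ny] := pselect (exists z, f z = y); last first.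
    have [n [e [n0 de qe ez]]] := ci_outside ny.
    have [||m km] := @ci_kill n e (fun z => 1) de.
    - by move=> z' Uz'; exact: Oreg1.
    - by move=> z' Uz' []; exact: ez.
    have [] : ~ q y (e ^+ m) by exact: pr_notX.
    apply/(hyE (n * m)%N); first exact: degX.
    apply/(pext _ (fun z => 0)); last exact: ps_0 pp.
    by move=> z Uz; rewrite psiX // -[LHS]mulr1 km.
  exists z; first by rewrite /U /= ez.
  have Uz : U z by rewrite /U /= ez.
  move=> F FU; have [k [b [db Fb]]] := ci_surj FU.
  rewrite Fb // (pext _ _ Fb) -[p _]/(q0 k b) -(hyE k b db) -ez mst_unit.
  by rewrite (fr_nonunit db (dX k) (@qX _ k Uz)).
- move=> z z' Uz Uz' h; case: hf => finj _ _; apply: finj; apply: (@Defs.pt_inj _ _ _ HP (f z) (f z')).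
  have key k b : deg k b -> q (f z) b <-> q (f z') b.
    move=> db; have := h _ (ci_psi_sec db).
    rewrite !mst_unit => e.
    by rewrite -(fr_nonunit db (dX k) (@qX _ k Uz)) e (fr_nonunit db (dX k) (@qX _ k Uz')).
  move=> b; split=> qb.
    have [n [c [hc0 ->]]] := pr_hom (pt_primeP HP (f z)) qb.
    elim/big_ind: _ => [||j _]; [exact: (pr_0 (pt_primeP HP _))|exact: (prD (pt_primeP HP _))|].
    by apply/(key j); case: (hc0 j).
  have [n [c [hc0 ->]]] := pr_hom (pt_primeP HP (f z')) qb.
  elim/big_ind: _ => [||j _]; [exact: (pr_0 (pt_primeP HP _))|exact: (prD (pt_primeP HP _))|].
  by apply/(key j); case: (hc0 j).
- move=> z V Uz oV Vz; have [n [b [n0 db qb bV]]] := ci_nbhs (open_nbhs_nbhs (conj oV Vz)).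
  exists (psi n b); first exact: ci_psi_sec.
  by split; [apply/(psi_unit db Uz)|move=> y Uy /(psi_unit db Uy) /bV].
- move=> z r Uz; have [_ _ /(_ z r) [r' <-]] := hf.
  have [k [b [c [db dc qc ->]]]] := fr_surj_ HP r'.
  exists (psi k b), (psi k c); split; try exact: ci_psi_sec.
    by apply/(psi_unit dc Uz).
  rewrite -rmorphM (frM_ db dc qc dc (dX k) (@qX _ k Uz)) [c * _]mulrC.
  by rewrite (frMcancel db (dX k) (@qX _ k Uz) dc qc).
- move=> z F Uz FU F0.
  have ne : \forall z' \near z, F z' = 0 by exact: (reg_eq0 (Osheaf Z) (FU z Uz) F0).
  have [n [e [n0 de qe eV]]] := ci_nbhs ne.
  have [|m km] := ci_kill de FU; first by move=> z' Uz' /eV.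
  exists (fun z' => psi n e z' ^+ m); split=> //.
    by move=> z' Uz'; apply: OregX; exact: ci_psi_sec.
  by rewrite unitrX //; apply/(psi_unit de Uz).
Qed.

End ClosedImmersionProj.

Lemma idmor_closed (A : comNzRingType) (X : ascheme A) : closed_immersion (idmor X).
Proof.
split=> //; first by move=> C; rewrite (_ : _ @` C = C) // image_id.
by move=> x b; exists b.
Qed.

(** The standard charts of Proj are the case of the identity immersion. *)
Lemma proj_affine (A : comNzRingType) (R : gralg A) (P : ascheme A)
  (HP : is_proj R P) (a : R) : deg 1 a -> affine_open [set x | ~ pt_prime HP x a].
Proof. by move=> da; exact: (ci_affine HP (idmor_closed P) da). Qed.

(** * Transport of sections and affine opens along open immersions *)

Section OpenImmersion.
Variables (A : comNzRingType) (Z D : ascheme A) (j : mor Z D).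
Hypothesis oj : open_immersion j.
Implicit Types (z : Z) (d : D) (U : set Z).

Let jinj : injective j. Proof. by case: oj. Qed.
Let jopen U : open U -> open (j @` U). Proof. by case: oj => _ + _; apply. Qed.
Let jst z : injective (mst j z). Proof. by case: oj => _ _ /(_ z) /bij_inj. Qed.

Lemma open_pull U f : secO (j @` U) f -> secO U (fun z => mst j z (f (j z))).
Proof. by move=> fU z Uz; apply: (@m_reg _ _ _ j z f); apply: fU; exists z. Qed.

(** The value at [d] is the germ there of any section that pulls back to [g], and 0 off the image.
    Quantifying over all [z] with [j z = d] avoids a transport of germs; injectivity of [j] and of
    its stalk maps makes the value well defined. *)
Lemma open_lift U g : open U -> secO U g -> exists2 f, secO (j @` U) f &
  forall z, U z -> mst j z (f (j z)) = g z.
Proof.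
move=> oU gU.
have ex d : exists v : Ost d, forall z (s : forall d : D, Ost d), U z -> j z = d ->
    mst j z (s (j z)) = g z -> v = s d.
  have [[z [Uz ezd]]|nz] := pselect (exists z, U z /\ j z = d); last first.
    by exists 0 => z s Uz ez; case: nz; exists z.
  have [r rP] : exists r, mst j z r = g z.
    by have [_ _ /(_ z) [h _ hK]] := oj; exists (h (g z)).
  have [s [_ sr]] := Oreg_germ r.
  exists (s d) => z' s' Uz' ezd' es'.
  have zz' : z' = z by apply: jinj; rewrite ezd' ezd.
  by move: es'; rewrite zz' -rP -sr -ezd => /jst.
pose f d := sval (cid (ex d)); have fP d := svalP (cid (ex d)).
have fj z (s : forall d : D, Ost d) : U z -> mst j z (s (j z)) = g z -> f (j z) = s (j z).
  by move=> Uz; exact: fP.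
have main z : U z -> exists s : (forall d : D, Ost d), [/\ Oreg (j z) s, f (j z) = s (j z),
    \forall z' \near z, f (j z') = s (j z') & mst j z (s (j z)) = g z].
  move=> Uz; have [r rP] : exists r, mst j z r = g z.
    by have [_ _ /(_ z) [h _ hK]] := oj; exists (h (g z)).
  have [s [sreg sr]] := Oreg_germ r; exists s; split=> //.
  - by apply: fj => //; rewrite sr.
  - have := Oreg_eq (m_reg (m := j) sreg) (gU z Uz).
    rewrite sr => /(_ rP); have := open_nbhs_nbhs (conj oU Uz).
    by apply: filterS2 => z' Uz'; exact: fj.
  - by rewrite sr.
exists f; last by move=> z Uz; have [s [_ -> _ ->]] := main z Uz.
move=> d [z Uz <-]; have [s [sreg _ fs _]] := main z Uz.
apply: (Oreg_ext sreg).
have [W [oW Wz] Ws] : exists2 W, open_nbhs z W & forall z', W z' -> f (j z') = s (j z').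
  by move: fs; rewrite /prop_near1 /= nbhsE.
have := open_nbhs_nbhs (conj (jopen oW) (imageP j Wz)); apply: filterS.
by move=> _ [z' Wz' <-]; rewrite (Ws z' Wz').
Qed.

Lemma open_affine U : affine_open U -> affine_open (j @` U).
Proof.
move=> aU; have oU := aff_open aU.
have lift := open_lift oU.
have eqj (f g : forall d : D, Ost d) :
    (forall z, U z -> mst j z (f (j z)) = mst j z (g (j z))) ->
    forall d, (j @` U) d -> f d = g d.
  by move=> h d [z Uz <-]; apply: jst; exact: h.
split.
- exact: jopen.
- move=> q pq.
  pose q' g := exists2 f, q f & forall z, U z -> mst j z (f (j z)) = g z.
  have q'E f : secO (j @` U) f -> q' (fun z => mst j z (f (j z))) <-> q f.
    move=> fU; split=> [[f' qf' e]|qf]; last by exists f.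
    by apply: (ps_ext pq qf') => d; apply: eqj.
  have pq' : prime_of_sections U q'.
    split.
    - move=> g [f qf e]; apply: (secO_ext oU (open_pull (ps_sec pq qf))) => z Uz.
      exact: e.
    - by move=> g g' [f qf e] eg; exists f => // z Uz; rewrite e // eg.
    - by exists (fun=> 0); [exact: ps_0 pq|move=> z _; rewrite rmorph0].
    - move=> g g' [f qf e] [f' qf' e']; exists (fun d => f d + f' d).
        exact: (psD pq).
      by move=> z Uz; rewrite rmorphD e // e'.
    - move=> g g' gU [f' qf' e']; have [f fU e] := lift g gU.
      exists (fun d => f d * f' d); first exact: (psM pq).
      by move=> z Uz; rewrite rmorphM e // e'.
    - move=> [f qf e]; apply: (ps_1 pq); apply: (ps_ext pq qf).
      by apply: eqj => z Uz; rewrite e // rmorph1.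
    - move=> g g' gU gU' [h qh e]; have [f fU ef] := lift g gU.
      have [f' fU' ef'] := lift g' gU'.
      have : q (fun d => f d * f' d).
        apply: (ps_ext pq qh); apply: eqj => z Uz.
        by rewrite e // rmorphM ef // ef'.
      by case/(ps_prime pq fU fU') => qf; [left; exists f|right; exists f'].
  have [z Uz qz] := aff_surj aU pq'.
  exists (j z); first by exists z.
  by move=> f fU; rewrite -(q'E f fU) qz ?mst_unit //; exact: open_pull.
- move=> d d' [z Uz <-] [z' Uz' <-] h; congr (j _); apply: (aff_inj aU) => // g gU.
  have [f fU e] := lift g gU.
  by rewrite -!e // !mst_unit h.
- move=> d V [z Uz <-] oV Vz.
  have oW : open (j @^-1` V) by apply: open_comp => // x _; exact: m_cont.
  have [g gU [gz gV]] := aff_basis aU Uz oW Vz.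
  have [f fU e] := lift g gU; exists f => //; split.
    by rewrite -(mst_unit (f := j)) e.
  move=> _ [y Uy <-]; rewrite -(mst_unit (f := j)) e //; exact: gV.
- move=> d a [z Uz ez]; subst d.
  have [f [g [fU gU gz e]]] := aff_frac aU (mst j z a) Uz.
  have [f' fU' ef'] := lift f fU; have [g' gU' eg'] := lift g gU.
  exists f', g'; split=> //; first by rewrite -(mst_unit (f := j)) eg'.
  by apply: jst; rewrite rmorphM eg' // ef'.
- move=> d f [z Uz <-] fU f0.
  have [|g [gU gz gf]] := aff_ker aU Uz (open_pull fU); first by rewrite f0 rmorph0.
  have [g' gU' eg'] := lift g gU; exists g'; split=> //.
    by rewrite -(mst_unit (f := j)) eg'.
  by apply: (eqj _ (fun=> 0)) => y Uy; rewrite rmorphM eg' // gf // rmorph0.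
Qed.

End OpenImmersion.

(** * Generators of invertible sheaves *)

Section LinearOf.
Variables (R : pzRingType) (U V : lmodType R).
Definition linear_of (f : U -> V) of linear f := f.
Variables (f : U -> V) (lf : linear f).
HB.instance Definition _ := GRing.isLinear.Build R U V *:%R (linear_of lf) lf.
Lemma exists_linear : exists g : {linear U -> V}, g =1 f.
Proof. by exists (linear_of lf : {linear U -> V}). Qed.
End LinearOf.

Definition isgen (R : comUnitRingType) (V : lmodType R) (e : V) :=
  forall m, exists! r, m = r *: e.

Section Generators.
Variables (R : comUnitRingType) (V : lmodType R).
Implicit Types (e m : V) (r : R).

Lemma isgen_inj e r r' : isgen e -> r *: e = r' *: e -> r = r'.
Proof. by move=> ge h; have [s [_ su]] := ge (r *: e); rewrite -(su r) // -(su r'). Qed.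

Lemma isgen_eq0 e r : isgen e -> r *: e = 0 -> r = 0.
Proof. by move=> ge h; apply: (isgen_inj ge); rewrite h scale0r. Qed.

Lemma isgenI e : (forall m, exists r, m = r *: e) ->
  (forall r, r *: e = 0 -> r = 0) -> isgen e.
Proof.
move=> ex inj m; have [r mr] := ex m; exists r; split=> // r' mr'.
by apply/eqP; rewrite -subr_eq0; apply/eqP/inj; rewrite scalerBl -mr -mr' subrr.
Qed.

Lemma isgen_coord e : isgen e -> exists2 co : {linear V -> R^o},
  (forall m, m = co m *: e) & forall r, co (r *: e) = r.
Proof.
move=> ge.
pose co m := sval (cid (ge m)); have coP m : m = co m *: e.
  by have [] := svalP (cid (ge m)).
have [|g gE] := @exists_linear R V R^o co.
  move=> r m m'; apply: (isgen_inj ge).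
  by rewrite -coP scalerDl -coP -[(r *: (co m : R^o)) *: e]scalerA -coP.
exists g => [m|r]; rewrite gE; first exact: coP.
by apply: (isgen_inj ge); rewrite -coP.
Qed.

Lemma isgenZ e r : isgen e -> (isgen (r *: e) <-> r \is a GRing.unit).
Proof.
move=> ge; split=> [gr|u].
  have [s [es _]] := gr e; apply/unitrPr; exists s; apply: (isgen_inj ge).
  by rewrite mulrC -scalerA -es scale1r.
apply: isgenI => [m|s].
  by have [s [-> _]] := ge m; exists (s / r); rewrite scalerA divrK.
by rewrite scalerA => /(isgen_eq0 ge) sr; apply: (mulIr u); rewrite mul0r.
Qed.

End Generators.

Section Modsheaf.
Variables (X : lrs) (M : modsheaf X).
Implicit Types (x y : X).

Lemma Mreg_ext x (f g : forall y, M y) : Mreg x f -> (\forall y \near x, f y = g y) -> Mreg x g.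
Proof. exact: (reg_ext (Msheaf M)). Qed.

Lemma Mreg_coord x (e m : forall y, M y) (r : Ost x) : Mreg x e -> Mreg x m ->
  m x = r *: e x -> exists a, [/\ Oreg x a, a x = r & \forall y \near x, m y = a y *: e y].
Proof.
move=> ex mx er; have [a [ax ar]] := Oreg_germ r; exists a; split=> //.
by apply: (reg_eq (Msheaf M) mx (MregZ ax ex)); rewrite ar.
Qed.

End Modsheaf.

Section Pullback.
Variables (A : comNzRingType) (X Y : ascheme A) (f : mor X Y).
Variables (M : modsheaf Y) (N : modsheaf X).

Lemma pb_scale h (pb : @is_pullback A X Y f M N h) x r m :
  h x (r *: m) = mst f x r *: h x m.
Proof. by have [_ ->] := pb_lin pb x. Qed.

(** By the universal property the coordinate along [e] induces a linear form [psi] on the stalk of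
    [N]. The map [n |-> psi n *: h x e] agrees with the identity on the image of [h], hence
    everywhere by uniqueness. *)
Lemma pullback_gen h (pb : @is_pullback A X Y f M N h) x (e : M (f x)) :
  isgen e -> isgen (h x e).
Proof.
move=> ge; have [co coE coK] := isgen_coord ge.
have [|psi psiE _] := @pb_univ _ _ _ _ _ _ _ pb x (Ost x)^o (fun m => mst f x (co m)).
  split=> [m m'|r m]; first by rewrite raddfD rmorphD.
  by rewrite linearZ /= rmorphM.
have psie : psi (h x e) = 1 by rewrite psiE -[e]scale1r coK rmorph1.
have [|g gE] := @exists_linear (Ost x) (N x) (N x) (fun n => psi n *: h x e).
  by move=> r n n'; rewrite linearP scalerDl scalerA.
have [idl idlE] := @exists_linear (Ost x) (N x) (N x) id (fun r n n' => erefl).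
have [k _ kE] := pb_univ pb (pb_lin pb x).
have E n : n = psi n *: h x e.
  rewrite -[LHS]idlE -gE (kE idl) ?(kE g) // => m; rewrite ?gE ?idlE //.
  by rewrite [in RHS](coE m) (pb_scale pb) psiE.
apply: isgenI => [n|r r0]; first by exists (psi n).
have := congr1 psi r0; rewrite linearZ linear0 psie => h1.
by rewrite -[r]mulr1; exact: h1.
Qed.

Lemma pullback_genP h (pb : @is_pullback A X Y f M N h) x (e0 e : M (f x)) :
  isgen e0 -> (isgen (h x e) <-> isgen e).
Proof.
move=> g0; split; last exact: pullback_gen.
have [r [-> _]] := g0 e; rewrite (pb_scale pb).
by rewrite (isgenZ _ (pullback_gen pb g0)) mst_unit (isgenZ _ g0).
Qed.

(** At each point [h] is defined with a chosen index; [compat] makes it independent of the choice,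
    so a single index can be used near a point to check regularity. Both restrictions of the bundle
    are identified in this way, from the transition functions of generators. *)
Lemma pullback_of_gens (K : Type) (e : K -> forall y, M y) (s : K -> forall x, N x)
    (G : K -> X -> Prop) :
  (forall x, exists k, G k x) ->
  (forall k x, G k x -> \forall y \near x, G k y) ->
  (forall k x, G k x -> Mreg (f x) (e k) /\ Mreg x (s k)) ->
  (forall k x, G k x -> isgen (e k (f x)) /\ isgen (s k x)) ->
  (forall k k' x r, G k x -> G k' x ->
     e k' (f x) = r *: e k (f x) -> s k' x = mst f x r *: s k x) ->
  exists h, @is_pullback A X Y f M N h.
Proof.
move=> cov Gnear Greg Ggen compat.
have [kk kkP] := choice cov.
have co x : {co : {linear M (f x) -> (Ost (f x))^o} |
    forall m, m = co m *: e (kk x) (f x)}.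
  by apply: cid; have [c cE _] := isgen_coord (Ggen _ _ (kkP x)).1; exists c.
pose h x m := mst f x (sval (co x) m) *: s (kk x) x.
have hE x m r k : G k x -> m = r *: e k (f x) -> h x m = mst f x r *: s k x.
  move=> Gk ->; rewrite /h linearZ /= rmorphM -scalerA; congr (_ *: _).
  by rewrite -(compat _ _ _ _ (kkP x) Gk (svalP (co x) _)).
exists h; split.
- move=> x; split=> [m m'|r m]; first by rewrite /h raddfD rmorphD scalerDl.
  by rewrite /h linearZ /= rmorphM scalerA.
- move=> x m mx; have Gk := kkP x; set k := kk x in Gk.
  have [ex sx] := Greg _ _ Gk; have [r [mr _]] := (Ggen _ _ Gk).1 (m (f x)).
  have [a [ax ar am]] := Mreg_coord ex mx mr.
  apply: (Mreg_ext (MregZ (m_reg (m := f) ax) sx)).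
  have nG := Gnear _ _ Gk; have nm := near_mor am.
  by near=> y; rewrite (@hE y _ (a (f y)) k) //; near: y.
- move=> x Q phi [phiD phiZ].
  have [ge gs] := Ggen _ _ (kkP x).
  have [cs csE csK] := isgen_coord gs.
  have [|psi psiE] := @exists_linear (Ost x) (N x) Q
      (fun n => cs n *: phi (e (kk x) (f x))); last first.
    exists psi => [m|psi' psi'E n].
      by rewrite psiE /h csK -phiZ -(svalP (co x)).
    rewrite psiE {1}(csE n) linearZ /= -psi'E; congr (_ *: psi' _).
    by rewrite (@hE x _ 1 (kk x)) ?scale1r ?rmorph1 ?scale1r.
  by move=> r n n'; rewrite linearP scalerDl scalerA.
Unshelve. all: by end_near. Qed.

End Pullback.

Section Tensor.
Variables (X : lrs) (L M N : modsheaf X) (b : forall x, L x -> M x -> N x).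
Hypothesis tb : is_tensor b.

Lemma tensorZ x r s (l : L x) (m : M x) : b (r *: l) (s *: m) = (r * s) *: b l m.
Proof.
have [bl br] := ts_lin tb x.
have h1 := bl (s *: m) r l 0.
have z1 : b (0 : L x) (s *: m) = 0.
  by have := bl (s *: m) (- 1) 0 0; rewrite scaler0 add0r scaleN1r addNr.
have z2 : b l (0 : M x) = 0.
  by have := br l (- 1) 0 0; rewrite scaler0 add0r scaleN1r addNr.
have h2 := br l s m 0.
by move: h1 h2; rewrite z1 z2 !addr0 => -> ->; rewrite scalerA.
Qed.

Lemma tensor_gen x (l : L x) (m : M x) : isgen l -> isgen m -> isgen (b l m).
Proof.
move=> gl gm.
have [cl clE clK] := isgen_coord gl; have [cm cmE cmK] := isgen_coord gm.
have [|psi psiE _] := @ts_univ _ _ _ _ _ tb x (Ost x)^o (fun l m => cl l * cm m).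
  split=> [m'|l'] r u v; first by rewrite linearP mulrDl -scalerAl.
  by rewrite linearP mulrDr -scalerAr.
have psi1 : psi (b l m) = 1.
  by rewrite psiE -[l]scale1r -[m]scale1r clK cmK mulr1.
have [|g gE] := @exists_linear (Ost x) (N x) (N x) (fun n => psi n *: b l m).
  by move=> r n n'; rewrite linearP scalerDl scalerA.
have [idl idlE] := @exists_linear (Ost x) (N x) (N x) id (fun r n n' => erefl).
have [k _ kE] := ts_univ tb (ts_lin tb x).
have E n : n = psi n *: b l m.
  rewrite -[LHS]idlE -gE (kE idl) ?(kE g) // => l' m'; rewrite ?gE ?idlE //.
  by rewrite [in RHS](clE l') [in RHS](cmE m') tensorZ psiE.
apply: isgenI => [n|r r0]; first by exists (psi n).
have := congr1 psi r0; rewrite linearZ linear0 psi1 => h1.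
by rewrite -[r]mulr1; exact: h1.
Qed.

Lemma tensor_genP x (l0 l : L x) (m0 m : M x) : isgen l0 -> isgen m0 ->
  (isgen (b l m) <-> isgen l /\ isgen m).
Proof.
move=> gl gm; split; last by case; exact: tensor_gen.
have [r [-> _]] := gl l; have [s [-> _]] := gm m.
rewrite tensorZ (isgenZ _ (tensor_gen gl gm)) unitrM => /andP[ur us].
by rewrite (isgenZ _ gl) (isgenZ _ gm).
Qed.

End Tensor.

Section EvalAlg.
Variables (R : comNzRingType) (B : algType R) (a : B).
Definition eval_alg (p : {poly R}) : B := horner_alg a p.
Lemma eval_alg_scalable : scalable eval_alg.
Proof. by move=> c p; rewrite /eval_alg -mul_polyC rmorphM /= horner_algC mulr_algl. Qed.
HB.instance Definition _ := GRing.RMorphism.copy eval_alg (horner_alg a).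
HB.instance Definition _ := GRing.isScalable.Build R {poly R} B *:%R eval_alg eval_alg_scalable.
Lemma eval_algX : eval_alg 'X = a. Proof. exact: horner_algX. Qed.
End EvalAlg.

Section TensorAlgebra.
Variables (X : lrs) (L : modsheaf X) (T : tensor_algebra L).
Implicit Types (x y : X).

(** Over a generator [l] the tensor algebra is the polynomial algebra on [l]: evaluation at [l] is a
    left inverse of [lam], because their composite and the identity both extend the inclusion of
    [L]. Questions about the tensor algebra become questions about coefficients. *)
Lemma tensor_poly x (l : L x) : isgen l ->
  exists2 lam : {lrmorphism T x -> {poly (Ost x)}}, lam (Tin T x l) = 'X & injective lam.
Proof.
move=> gl; have [co coE coK] := isgen_coord gl.
have [|phi phiE] := @exists_linear (Ost x) (L x) {poly (Ost x)} (fun m => (co m : Ost x) *: 'X).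
  by move=> r m m'; rewrite linearP scalerDl scalerA.
have [lam lamE _] := T_univ T phi.
pose mu : {lrmorphism {poly (Ost x)} -> T x} := eval_alg (Tin T x l).
exists lam; first by rewrite lamE phiE -[X in co X]scale1r coK scale1r.
have [psi _ psiU] := T_univ T (Tin T x).
apply: (can_inj (g := mu)) => w.
have -> : mu (lam w) = (mu \o lam : {lrmorphism T x -> T x}) w by [].
rewrite (psiU (mu \o lam)) -?(psiU idfun) //= => m.
by rewrite lamE phiE [in RHS](coE m) !linearZ /= eval_algX.
Qed.

Lemma tensor_free n x (l : L x) (r : Ost x) : isgen l -> r *: Tin T x l ^+ n = 0 -> r = 0.
Proof.
move=> gl; have [lam lamX _] := tensor_poly gl.
move=> /(congr1 lam); rewrite linearZ /= rmorphXn /= lamX linear0.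
by move=> /(congr1 (coefp n)); rewrite /= coefZ coefXn eqxx mulr1 coef0.
Qed.

Lemma tensor_inj n x (l : L x) (r s : Ost x) : isgen l ->
  r *: Tin T x l ^+ n = s *: Tin T x l ^+ n -> r = s.
Proof.
move=> gl h; apply/eqP; rewrite -subr_eq0; apply/eqP/(@tensor_free n _ _ _ gl).
by rewrite scalerBl h subrr.
Qed.

Lemma tensor_reg x (l : L x) n (w : T x) : isgen l -> Tin T x l ^+ n * w = 0 -> w = 0.
Proof.
move=> gl; have [lam lamX inj] := tensor_poly gl.
move=> /(congr1 lam); rewrite rmorphM /= rmorphXn /= lamX linear0 mulrC.
move=> h; apply: inj; rewrite linear0; apply/polyP => k; rewrite coef0.
by have /(congr1 (coefp (k + n)%N)) := h; rewrite /= coefMXn coef0 ltnNge leq_addl /= addnK.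
Qed.

Lemma tdegP n x (l : L x) (w : T x) : isgen l ->
  tdeg n w <-> exists r, w = r *: Tin T x l ^+ n.
Proof.
move=> gl; elim: n w => [|n IH] w /=.
  by split=> -[r ->]; exists r; rewrite ?expr0.
split=> [[m [ls [v [dv ->]]]]|[r ->]].
  elim/big_ind: _ => [|a b [r ->] [s ->]|j _]; first by exists 0; rewrite scale0r.
    by exists (r + s); rewrite scalerDl.
  have /IH[s ->] := dv j; have [r [-> _]] := gl (ls j).
  by exists (r * s); rewrite linearZ /= -scalerAl -scalerAr scalerA exprS.
exists 1%N, (fun=> r *: l), (fun=> Tin T x l ^+ n); split.
  by move=> _; apply/IH; exists 1; rewrite scale1r.
by rewrite big_ord1 linearZ /= -scalerAl exprS.
Qed.

Lemma tgenP n x (l : L x) (r : Ost x) : isgen l ->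
  tgen n (r *: Tin T x l ^+ n) <-> r \is a GRing.unit.
Proof.
move=> gl; split=> [[_ /(_ (Tin T x l ^+ n))] []|u].
  by apply/(tdegP _ _ gl); exists 1; rewrite scale1r.
  move=> s; rewrite scalerA -[LHS]scale1r => /(tensor_inj gl) h.
  by apply/unitrPr; exists s; rewrite h mulrC.
split; first by apply/(tdegP _ _ gl); exists r.
move=> w /(tdegP _ _ gl) [s ->]; exists (s / r).
by rewrite scalerA divrK.
Qed.

Lemma tgen1P x (l0 l : L x) : isgen l0 -> (tgen 1 (Tin T x l) <-> isgen l).
Proof.
move=> g0; have [r [-> _]] := g0 l.
by rewrite linearZ /= -[X in _ *: X]expr1 (tgenP _ _ g0) (isgenZ _ g0).
Qed.

Lemma treg_ext n x (f g : forall y, T y) : treg n x f ->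
  (\forall y \near x, f y = g y) -> treg n x g.
Proof.
case: n => [|n] /=.
  move=> [r rx e] fg; exists r => //.
  by move: e fg; apply: filterS2 => y -> ->.
move=> [m [l [v [h e]]]] fg; exists m, l, v; split=> //.
by move: e fg; apply: filterS2 => y -> ->.
Qed.

Lemma treg_pow n x (l : forall y, L y) r : Mreg x l -> Oreg x r ->
  treg n x (fun y => r y *: Tin T y (l y) ^+ n).
Proof.
move=> lx rx; elim: n => [|n IH] /=.
  by exists r => //; apply: nearW => y; rewrite expr0.
exists 1%N, (fun=> l), (fun=> fun y => r y *: Tin T y (l y) ^+ n); split=> //.
by apply: nearW => y; rewrite big_ord1 -scalerAr exprS.
Qed.

Lemma treg_coord n x (l : forall y, L y) f : Mreg x l ->
  isgen (l x) -> treg n x f ->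
  exists2 r, Oreg x r & \forall y \near x, f y = r y *: Tin T y (l y) ^+ n.
Proof.
move=> lx gx; elim: n f => [|n IH] f /=.
  by move=> [r rx e]; exists r => //; move: e; apply: filterS => y ->; rewrite expr0.
move=> [m [ls [v [h e]]]].
have ex j : exists a, Oreg x a /\
    \forall y \near x, Tin T y (ls j y) * v j y = a y *: Tin T y (l y) ^+ n.+1.
  have [lj /IH [s sx se]] := h j.
  have [c [ce _]] := gx (ls j x); have [a [ax _ ae]] := Mreg_coord lx lj ce.
  exists (fun y => a y * s y); split; first exact: OregM.
  move: se ae; apply: filterS2 => y -> ->.
  by rewrite linearZ /= -scalerAl -scalerAr scalerA exprS.
have [a aP] := choice ex.
exists (fun y => \sum_(j < m) a j y).
  by apply: (reg_sum (Osheaf X)) => j _; case: (aP j).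
have na : \forall y \near x, forall j, Tin T y (ls j y) * v j y = a j y *: Tin T y (l y) ^+ n.+1.
  by apply: filter_forall => j; case: (aP j).
move: e na; apply: filterS2 => y -> na.
by rewrite scaler_suml; apply: eq_bigr => j _.
Qed.

End TensorAlgebra.

(** * Projective space and its twisting sheaf *)

Lemma compact_union (T : topologicalType) (K : finType) (U : K -> set T) :
  (forall k, compact (U k)) -> (forall x, exists k, U k x) -> compact [set: T].
Proof.
move=> cU cov; apply/compactE => Q Q0 Qs QU Qn.
have QK k : Q (U k) by apply: ((compactE (U k)).1 (cU k)) => // x _; exact: Qn.
have Qseq (s : seq K) : Q [set x | exists2 k, k \in s & U k x].
  elim: s => [|k s IH]; first by apply: Qs Q0 => x [].
  apply: (Qs) (QU _ _ (QK k) IH) => x [k']; rewrite inE => /orP[/eqP ->|ks] Ux.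
    by left.
  by right; exists k'.
by apply: Qs (Qseq (enum K)) => x _; have [k Ux] := cov x; exists k => //; rewrite mem_enum.
Qed.

(** * Integrality over an ideal by elimination of generators *)

Section DetTrick.
Variables (R : comPzRingType) (I : R -> Prop).
Hypotheses (I0 : I 0) (ID : forall a b, I a -> I b -> I (a + b)).
Hypothesis IM : forall a b, I b -> I (a * b).

(** The coefficient of the head is split off, so that generators can be eliminated one at a time. *)
Fixpoint lin_span (g : seq R) (x : R) : Prop :=
  if g is y :: g' then exists2 a, I a & lin_span g' (x - a * y) else x = 0.

Lemma lin_spanD g x y : lin_span g x -> lin_span g y -> lin_span g (x + y).
Proof.
elim: g x y => [|z g IH] x y /=; first by move=> -> ->; rewrite addr0.
move=> [a Ia ha] [b Ib hb]; exists (a + b); first exact: ID.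
by have := IH _ _ ha hb; congr lin_span; ring.
Qed.

Lemma lin_spanM g c x : lin_span g x -> lin_span g (c * x).
Proof.
elim: g x => [|z g IH] x /=; first by move=> ->; rewrite mulr0.
move=> [a Ia /IH ha]; exists (c * a); first exact: IM.
by move: ha; congr lin_span; ring.
Qed.

Lemma lin_span0 g : lin_span g 0.
Proof.
by elim: g => [//|z g IH] /=; exists 0 => //; rewrite mul0r subrr.
Qed.

Lemma lin_span_mem g a x : I a -> x \in g -> lin_span g (a * x).
Proof.
move=> Ia; elim: g => [//|z g IH]; rewrite inE => /orP[/eqP ->|/IH h] /=.
  by exists a => //; rewrite subrr; exact: lin_span0.
by exists 0 => //; rewrite mul0r subr0.
Qed.

Lemma lin_span_kill g p x : (forall y, y \in g -> p * y = 0) -> lin_span g x -> p * x = 0.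
Proof.
elim: g x => [|z g IH] x pg /=; first by move=> ->; rewrite mulr0.
move=> [a _ /IH h].
have := h (fun y yg => pg y (mem_behead (s := z :: g) yg)).
have pz : p * z = 0 by apply: pg; rewrite inE eqxx.
by rewrite mulrBr [p * (a * z)]mulrCA pz mulr0 subr0.
Qed.

(* Cayley-Hamilton by elimination: the first generator [y] is removed by
   multiplying the other equations by [c - b], where [c * y = b * y + z] and
   [z] does not involve [y]. *)
Lemma det_trick g c : (forall x, x \in g -> lin_span g (c * x)) ->
  exists n e, I e /\ forall x, x \in g -> (c ^+ n + e) * x = 0.
Proof.
have powI d e n : I e -> exists2 e', I e' & (d + e) ^+ n = d ^+ n + e'.
  move=> Ie; elim: n => [|n [e' Ie' IH]]; first by exists 0 => //; rewrite !expr0 addr0.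
  exists (d * e' + (d ^+ n + e') * e); first by apply: ID; apply: IM.
  by rewrite !exprS IH; ring.
elim: g c => [|y g IH] c h; first by exists 0%N, 0.
have /= [b Ib hb] := h y (mem_head y g).
set z := c * y - b * y in hb.
(* Since [(c - b) * y = z] lies in the span of [g], multiplication by [(c - b) * c] sends each
   element of [g] into the span of [g] alone. *)
have [|n [e [Ie ke]]] := IH ((c - b) * c).
  move=> x xg; have /= [a Ia ha] := h x (mem_behead (s := y :: g) xg).
  have -> : (c - b) * c * x = a * z + (c - b) * (c * x - a * y) by rewrite /z; ring.
  by apply: lin_spanD; exact: lin_spanM.
have [|e1 Ie1 E1] := powI (c ^+ 2) (c * (- b)) n.
  by apply: IM; rewrite -mulN1r; exact: IM.
(* The element is the expansion of [(c - b) * (((c - b) * c) ^+ n + e)]. The second factor kills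
   [g], hence also [z = (c - b) * y]. The leading term is [c ^+ (2 * n).+1], and the rest is in [I]
   because [b] and [e] are. *)
exists (2 * n).+1, ((c - b) * (e + e1) + (- 1 * c ^+ (2 * n)) * b); split.
  by apply: ID; [apply: IM; exact: ID|exact: IM].
have -> : c ^+ (2 * n).+1 + ((c - b) * (e + e1) + - 1 * c ^+ (2 * n) * b) =
    (c - b) * (((c - b) * c) ^+ n + e).
  have -> : (c - b) * c = c ^+ 2 + c * - b by ring.
  by rewrite E1 -exprM exprS; ring.
move=> x; rewrite inE => /orP[/eqP ->|xg]; last by rewrite -mulrA ke // mulr0.
have := lin_span_kill ke hb; rewrite /z => <-; by ring.
Qed.

End DetTrick.

Section Twist.
Variables (A : comNzRingType) (R : gralg A) (P : ascheme A) (HP : is_proj R P).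
Variables (M : modsheaf P) (HM : is_twist1 HP M).
Implicit Types (x : P) (a b c d : R).
Local Notation q := (pt_prime HP).

Lemma frac1 x k a b : deg k.+1 a -> deg k b -> ~ q x b -> frac_at (q x) 1 a b.
Proof. by move=> da db qb; exists k; rewrite addn1. Qed.

Lemma frac11 x a : deg 1 a -> frac_at (q x) 1 a 1.
Proof. by move=> da; apply: (@frac1 _ 0) => //; [exact: deg1|exact: pr_not1]. Qed.

Lemma fr1_0 x : fr1 HM x 0 1 = 0.
Proof.
have f0 : frac_at (q x) 1 0 1 by apply: frac11; exact: deg0.
have := fr1D HM f0 f0; rewrite !mul0r addr0 mulr1 => h.
by apply: (addrI (fr1 HM x 0 1)); rewrite h addr0.
Qed.

Lemma fr1_ratio x a b : deg 1 a -> deg 1 b -> ~ q x b ->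
  fr1 HM x a 1 = fr HP x a b *: fr1 HM x b 1.
Proof.
move=> da db qb.
have f1 : frac_at (q x) 0 a b by exact: frac0 da db qb.
rewrite fr1Z //; last exact: frac11.
apply/fr1_eq; first exact: frac11.
  apply: (@frac1 _ 1); [exact: (degM da db)|by rewrite mulr1|by rewrite mulr1].
exists 0%N, 1; split; [exact: deg1|exact: pr_not1|].
by ring.
Qed.

Lemma fr1_gen x a : deg 1 a -> ~ q x a -> isgen (fr1 HM x a 1).
Proof.
move=> da qa; apply: isgenI => [m|r].
  have [c [d [[k [dc dd qd]] ->]]] := fr1_surj HM m; rewrite addn1 in dc.
  exists (fr HP x c (d * a)).
  have dda : deg k.+1 (d * a) by rewrite -addn1; exact: degM.
  have qda : ~ q x (d * a) by exact: pr_notM.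
  rewrite fr1Z; [|exact: frac0 dc dda qda|exact: frac11].
  apply/fr1_eq; first exact: (frac1 dc dd qd).
    apply: (@frac1 _ k.+1); [|by rewrite mulr1|by rewrite mulr1].
    by rewrite -[k.+2]addn1; exact: degM.
  exists 0%N, 1; split; [exact: deg1|exact: pr_not1|].
  by ring.
have [k [c [d [dc dd qd ->]]]] := fr_surj_ HP r.
rewrite fr1Z; [|exact: frac0 dc dd qd|exact: frac11].
rewrite mulr1 -(fr1_0 x) => /fr1_eq [].
- by apply: (@frac1 _ k) => //; rewrite -addn1; exact: degM.
- by apply: frac11; exact: deg0.
- move=> n [e [de qe]]; rewrite mulr1 mul0r subr0 => h.
  apply/(fr_eq0 dc dd qd); exists (n + 1)%N, (e * a); split; first exact: degM.
    exact: pr_notM.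
  by rewrite -h; ring.
Qed.

Lemma fr1_genP x a b : deg 1 a -> deg 1 b -> ~ q x b ->
  isgen (fr1 HM x a 1) <-> ~ q x a.
Proof.
move=> da db qb; rewrite (fr1_ratio da db qb) (isgenZ _ (fr1_gen db qb)).
exact: fr_unit da db qb.
Qed.

Lemma fr1_Mreg x a : deg 1 a -> Mreg x (fun y => fr1 HM y a 1).
Proof.
move=> da; apply/(fr1_reg HM); exists a, 1.
by apply: nearW => y; split=> //; exact: frac11.
Qed.

End Twist.

Section ProjSpace.
Variable A : comNzRingType.

Lemma deg_xvar n (k : 'I_n) : deg 1 (xvar A k).
Proof. by rewrite /= /xvar dhomogX /= mdeg1. Qed.

Lemma mpoly_gen n d (p : mpoly_gralg A n) : deg d.+1 p ->
  exists c : 'I_n -> mpoly_gralg A n, (forall k, deg d (c k)) /\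
    p = \sum_(k < n) xvar A k * c k.
Proof.
move=> dp.
pose Q (p : mpoly_gralg A n) := exists c : 'I_n -> mpoly_gralg A n,
  (forall k, deg d (c k)) /\ p = \sum_(k < n) xvar A k * c k.
suff : Q p by [].
have Qsum (u v : mpoly_gralg A n) : Q u -> Q v -> Q (u + v).
  move=> [c [dc ->]] [c' [dc' ->]]; exists (fun k => c k + c' k); split.
    by move=> k; exact: degD.
  by rewrite -big_split /=; apply: eq_bigr => k _; rewrite mulrDr.
have Q0 : Q 0.
  exists (fun=> 0); split; first by move=> k; exact: deg0.
  by rewrite big1 // => k _; rewrite mulr0.
rewrite [p]mpolyE big_seq; elim/big_ind: _ => // m mp.
have /(dhomogP _ _ _) /(_ m mp) /= md := dp.
have [k mk] : exists k, (0 < m k)%N.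
  apply/existsP; rewrite -[X in is_true X]negbK negb_exists; apply/negP => /forallP m0.
  have : mdeg m == 0%N by rewrite mdegE big1 // => k _; apply/eqP; rewrite -leqn0 leqNgt.
  by rewrite md.
have le1 : lem (mnm1 k) m.
  by apply/mnm_lepP => l; rewrite mnm1E; case: eqP => [<-|].
pose u : mpoly n A := mcoeff m p *: mpolyX A (mnm_sub m (mnm1 k)).
exists (fun j => if j == k then u else 0); split.
  move=> j; case: ifP => _; last exact: deg0.
  apply: dhomogZ; rewrite dhomogX /=.
  have := mdegD (mnm_sub m (mnm1 k)) (mnm1 k).
  by rewrite submK // md mdeg1 addn1 => -[->].
rewrite (bigD1 k) //= eqxx big1 ?addr0; last by move=> j /negbTE ->; rewrite mulr0.
have eX : mpolyX A m = mpolyX A (mnm_sub m (mnm1 k)) * mpolyX A (mnm1 k).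
  by rewrite -mpolyXD submK.
by rewrite eX /u /xvar [RHS]mulrC; exact: scalerAl.
Qed.

Lemma xvar_cover n (q : mpoly_gralg A n -> Prop) : proj_prime q ->
  exists k, ~ q (xvar A k).
Proof.
move=> pq; apply: contrapT => /forallNP h.
have [[|d] [a [// _ da qa]]] := pr_irr pq.
have [c [_ ac]] := mpoly_gen da; apply: qa; rewrite ac; elim/big_ind: _ => [||k _]; [exact: (pr_0 pq)|exact: (prD pq)|].
by rewrite mulrC; apply: (prM pq); apply: contrapT; exact: h.
Qed.

End ProjSpace.

(** * Sections of positive degree are in the radical of the coordinates *)

Lemma fr_sum (A : comNzRingType) (R : gralg A) (P : ascheme A) (HP : is_proj R P)
    (x : P) k (J : finType) (F : J -> R) (b : R) :
  (forall j, deg k (F j)) -> deg k b -> ~ pt_prime HP x b ->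
  fr HP x (\sum_j F j) b = \sum_j fr HP x (F j) b.
Proof.
move=> dF db qb.
suff [] : deg k (\sum_j F j) /\ fr HP x (\sum_j F j) b = \sum_j fr HP x (F j) b by [].
elim: (index_enum J) => [|j s [IH1 IH2]].
  by rewrite !big_nil; split; [exact: deg0|exact: fr0 db qb].
by rewrite !big_cons; split; [exact: degD|rewrite -IH2 (frD_ (dF j) IH1 db qb)].
Qed.

Section Induced.
Variables (A : comNzRingType) (X : ascheme A) (L : modsheaf X) (n : nat).
Variables (P : projspace A n) (f : mor X P) (s : 'I_n.+1 -> forall x, L x).
Hypothesis hs : induced_by f s.
Implicit Types (x : X) (k l : 'I_n.+1).
Local Notation q := (pt_prime (pspaceP P)).
Local Notation X_ k := (xvar A k).

Lemma ind_coord x : exists k, ~ q (f x) (X_ k).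
Proof. exact: xvar_cover (pt_primeP (pspaceP P) (f x)). Qed.

Lemma ind_gen x k : isgen (s k x) <-> ~ q (f x) (X_ k).
Proof.
have [h pb hE] := hs; have [l ql] := ind_coord x.
rewrite -hE (pullback_genP pb _ (fr1_gen (pO1P P) (deg_xvar A l) ql)).
exact: fr1_genP (deg_xvar A k) (deg_xvar A l) ql.
Qed.

Lemma ind_ratio x k l : ~ q (f x) (X_ k) ->
  s l x = mst f x (fr (pspaceP P) (f x) (X_ l) (X_ k)) *: s k x.
Proof.
have [h pb hE] := hs => qk.
rewrite -!hE -(pb_scale pb) -fr1_ratio //; exact: deg_xvar.
Qed.

Lemma ind_cover x : exists k, isgen (s k x).
Proof. by have [k qk] := ind_coord x; exists k; apply/ind_gen. Qed.

Lemma ind_Mreg x k : Mreg x (s k).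
Proof.
have [h pb hE] := hs.
have /(pb_reg pb) := fr1_Mreg (pO1P P) (f x) (deg_xvar A k).
by congr Mreg; apply: functional_extensionality_dep => y; rewrite hE.
Qed.

Lemma ind_near x k : isgen (s k x) -> \forall y \near x, isgen (s k y).
Proof.
move=> /ind_gen qk; have := near_mor (pr_near (deg_xvar A k) qk).
by apply: filterS => y /ind_gen.
Qed.

End Induced.

Section BaseLocus.
Variables (A : comNzRingType) (X : ascheme A) (L : modsheaf X).
Variables (T : tensor_algebra L) (S : section_ring T) (n : nat).
Variables (P : projspace A n) (f : mor X P) (s : 'I_n.+1 -> forall x, L x).
Hypotheses (hf : closed_immersion f) (hs : induced_by f s).
Variable sg : 'I_n.+1 -> S.
Hypothesis sgE : forall k x, ev S x (sg k) = Tin T x (s k x).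
Implicit Types (x : X) (k l : 'I_n.+1) (a b c : S).
Local Notation q := (pt_prime (pspaceP P)).
Local Notation X_ k := (xvar A k).
Local Notation U k := [set x | ~ q (f x) (X_ k)].

Lemma sec_deg1 (t : forall x, L x) a : (forall x, Mreg x t) ->
  (forall x, ev S x a = Tin T x (t x)) -> deg 1 a.
Proof.
move=> tr aE; apply/ev_deg => x; apply: (treg_ext (treg_pow T 1 (tr x) (Oreg1 x))).
by apply: nearW => y; rewrite scale1r expr1 aE.
Qed.

Lemma sg_deg k : deg 1 (sg k).
Proof. by apply: (sec_deg1 _ (sgE k)) => x; exact: (ind_Mreg hs). Qed.

Lemma base_compact : compact [set: X].
Proof.
apply: (@compact_union _ _ (fun k => U k)) => [k|x]; last exact: ind_coord.
exact: ci_compact hf _ (deg_xvar A k).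
Qed.

Lemma ev_local d c x l : deg d c -> isgen (s l x) ->
  exists2 r, Oreg x r & \forall y \near x, ev S y c = r y *: Tin T y (s l y) ^+ d.
Proof.
by move=> /ev_deg dc gl; exact: treg_coord (ind_Mreg hs x l) gl (dc x).
Qed.

(* [c / s_k^d] is a function on a closed subscheme of the affine chart of P^n. *)
Lemma sec_fraction d c k : deg d c -> exists m (e : mpoly_gralg A n.+1), deg m e /\
  forall x, U k x -> ev S x c =
    mst f x (fr (pspaceP P) (f x) e (X_ k ^+ m)) *: Tin T x (s k x) ^+ d.
Proof.
move=> dc.
have ex x : exists r, U k x -> ev S x c = r *: Tin T x (s k x) ^+ d.
  have [Ux|nU] := pselect (U k x); last by exists 0 => Ux; case: nU.
  have [r _ e] := ev_local dc ((ind_gen hs x k).2 Ux).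
  by exists (r x) => _; exact: nbhs_singleton e.
pose F x := sval (cid (ex x)); have FP x : U k x -> ev S x c = F x *: Tin T x (s k x) ^+ d.
  exact: svalP (cid (ex x)).
have [|m [e [de eE]]] := @ci_surj _ _ _ _ (pspaceP P) _ hf _ (deg_xvar A k) F.
  move=> x Ux; have gx := (ind_gen hs x k).2 Ux.
  have [r rx rE] := ev_local dc gx.
  apply: (Oreg_ext rx); have := ind_near hs gx; move: rE.
  apply: filterS2 => y rE gy; apply: (tensor_inj (T := T) gy (n := d)).
  by rewrite -rE -FP //; apply/(ind_gen hs).
by exists m, e; split=> // x Ux; rewrite -eE // -FP.
Qed.

Definition word_prod (m : nat) b := exists2 w : seq 'I_n.+1, size w = m & b = \prod_(k <- w) sg k.
(** The power with exponent [m] of the ideal of [S] generated by the [s_k]; the exponent counts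
    factors and is independent of the grading of [S]. *)
Definition spow (m : nat) a := gen_by (fun=> True) (word_prod m) a.

Lemma spowM m a b : spow m b -> spow m (a * b).
Proof. by move=> h; exact: gen_byM. Qed.

Lemma spowS m k a : spow m a -> spow m.+1 (sg k * a).
Proof.
elim=> [|c b x _ [w sw ->] _ IH]; first by rewrite mulr0; exact: gen_by0.
rewrite mulrDr mulrCA; apply: gen_by_add => //.
by exists (k :: w); rewrite /= ?sw // big_cons.
Qed.

Lemma spow_prod m w a : spow m a -> spow (size w + m) (\prod_(k <- w) sg k * a).
Proof.
move=> h; elim: w => [|k w IH]; first by rewrite big_nil mul1r.
by rewrite big_cons -mulrA; exact: spowS.
Qed.

Lemma spow_X m k r a : spow m a -> spow (r + m) (sg k ^+ r * a).
Proof.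
move=> h; elim: r => [|r IH]; first by rewrite mul1r.
by rewrite exprS -mulrA; exact: spowS.
Qed.

Lemma spow0 a : spow 0 a.
Proof.
rewrite -[a]mulr1; apply: spowM; apply: gen_by_mem => //; exists [::] => //.
by rewrite big_nil.
Qed.

Lemma spow_le m r a : (r <= m)%N -> spow m a -> spow r a.
Proof.
move=> rm; elim=> [|c b x _ [w sw ->] _ IH]; first exact: gen_by0.
apply: gen_byD => //; apply: spowM.
rewrite -[w](cat_take_drop (m - r)) big_cat /=; apply: spowM.
apply: gen_by_mem => //; exists (drop (m - r) w) => //.
by rewrite size_drop sw subKn.
Qed.

(** This is the value of the form [e] at the sections [s_k]. It is built by splitting off one
    variable at a time, and each variable contributes one factor [s_k]. *)
Lemma poly_section m (e : mpoly_gralg A n.+1) : deg m e ->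
  exists2 a, spow m a & forall x k, U k x -> ev S x a =
    mst f x (fr (pspaceP P) (f x) e (X_ k ^+ m)) *: Tin T x (s k x) ^+ m.
Proof.
elim: m e => [|m IH] e de.
  have [|a aE] := @ev_surj _ _ _ _ S 0 (fun x => (mst f x (fr (pspaceP P) (f x) e 1))%:A).
    move=> x; exists (fun x => mst f x (fr (pspaceP P) (f x) e 1)).
      exact: (m_reg (m := f) (fr_Oreg de (deg1 _) (@pr_not1 _ _ _ _ _))).
    exact: nearW.
  by exists a => [|x k _]; [exact: spow0|rewrite aE !expr0].
have [c [dc ->]] := mpoly_gen de.
have ex k : exists a, spow m a /\ forall x l, U l x -> ev S x a =
    mst f x (fr (pspaceP P) (f x) (c k) (X_ l ^+ m)) *: Tin T x (s l x) ^+ m.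
  by have [a aP aE] := IH (c k) (dc k); exists a.
have [a aP] := choice ex.
exists (\sum_j sg j * a j).
  elim/big_ind: _ => [||j _]; [exact: gen_by0|by move=> ? ?; exact: gen_byD|].
  by apply: spowS; case: (aP j).
move=> x k Ux.
have dXk r : deg r (X_ k ^+ r) by have := degX r (deg_xvar A k); rewrite mul1n.
have qXk r : ~ q (f x) (X_ k ^+ r) by exact: pr_notX.
rewrite (fr_sum (k := m.+1)) //; last by move=> j; exact: (degM (deg_xvar A j) (dc j)).
rewrite !rmorph_sum scaler_suml; apply: eq_bigr => j _.
rewrite rmorphM /= sgE (ind_ratio hs j Ux) ((aP j).2 x k Ux) linearZ /=.
rewrite -scalerAl -scalerAr scalerA -exprS -rmorphM; congr (mst f x _ *: _).
by rewrite (frM_ (deg_xvar A j) (deg_xvar A k) Ux (dc j) (dXk m) (qXk m)) -exprS.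
Qed.

(** Where [s_l] generates [L], both [g] and [s_k] are functions times powers of [s_l], and
    [kill_local] applies to these functions; compactness of [X] makes the exponent uniform. *)
Lemma sec_kill k e (g : S) : deg e g -> (forall x, U k x -> ev S x g = 0) ->
  exists m, sg k ^+ m * g = 0.
Proof.
move=> dg g0.
suff [m mP] : exists m, forall x, [set: X] x -> ev S x (sg k ^+ m * g) = 0.
  by exists m; apply: (@ev_inj _ _ _ _ S) => x; rewrite mP // rmorph0.
have /compactE cX := base_compact.
apply: (cX (fun V => exists m, forall x, V x -> ev S x (sg k ^+ m * g) = 0)).
- by exists 0%N.
- by move=> V W VW [m h]; exists m => x /VW; exact: h.
- move=> V W [m h] [m' h']; exists (m + m')%N => x; rewrite exprD => -[/h|/h'] E.
    by rewrite mulrAC rmorphM E mul0r.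
  by rewrite -mulrA rmorphM E mulr0.
move=> x _; have [l gl] := ind_cover hs x.
have [r rx rE] := ev_local dg gl.
have [b [be _]] := gl (s k x).
have [a [ax _ aE]] := Mreg_coord (ind_Mreg hs x l) (ind_Mreg hs x k) be.
have ngl := ind_near hs gl.
have [|m km] := kill_local ax rx.
  move: aE rE ngl => aE rE ngl; near=> y.
  have gy : isgen (s l y) by near: y.
  have aEy : s k y = a y *: s l y by near: y.
  have rEy : ev S y g = r y *: Tin T y (s l y) ^+ e by near: y.
  move=> /(isgenZ _ gy); rewrite -aEy => /(ind_gen hs) /g0.
  by rewrite rEy => /(tensor_free gy).
exists [set y | ev S y (sg k ^+ m * g) = 0]; last by exists m.
near=> y.
have aEy : s k y = a y *: s l y by near: y.
have rEy : ev S y g = r y *: Tin T y (s l y) ^+ e by near: y.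
have kmy : a y ^+ m * r y = 0 by near: y.
rewrite /= rmorphM rmorphXn /= sgE aEy rEy linearZ /= exprZn.
by rewrite -scalerAl -scalerAr scalerA kmy scale0r.
Unshelve. all: by end_near. Qed.

(** On the chart of [s_k] the quotient of [c] by [s_k ^+ d.+1] is [e / X_k ^+ m], so [s_k ^+ m * c]
    and [s_k ^+ d.+1 * a] agree there, and everywhere after multiplication by [s_k ^+ M]. The second
    product then has [M + d.+1 + m] factors, at least one more than [M + m]: this is where the
    positive degree of [c] enters. *)
Lemma sec_mul_pow d c k : deg d.+1 c -> exists m, spow m.+1 (sg k ^+ m * c).
Proof.
move=> dc; have [m [e [de eE]]] := sec_fraction k dc.
have [a [aP aE]] : exists a, spow m a /\ forall x k, U k x -> ev S x a =
    mst f x (fr (pspaceP P) (f x) e (X_ k ^+ m)) *: Tin T x (s k x) ^+ m.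
  by have [a ? ?] := poly_section de; exists a.
have dXk r : deg r (sg k ^+ r) by have := degX r (sg_deg k); rewrite mul1n.
have da : deg m a.
  apply/ev_deg => x; have [l ql] := ind_coord f x.
  have dl : deg m (X_ l ^+ m) by have := degX m (deg_xvar A l); rewrite mul1n.
  apply: (treg_ext (treg_pow T m (ind_Mreg hs x l)
    (m_reg (m := f) (fr_Oreg de dl (pr_notX (n := m) ql))))).
  by apply: filterS (near_mor (pr_near (deg_xvar A l) ql)) => y qy; rewrite (aE y l qy).
have [||M kM] := @sec_kill k (m + d.+1)%N (sg k ^+ m * c - sg k ^+ d.+1 * a).
- apply: degB; first exact: degM.
  by rewrite addnC; exact: degM.
- move=> x Ux; rewrite rmorphB !rmorphM !rmorphXn /= sgE (aE x k Ux) (eE x Ux).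
  by rewrite -!scalerAr -!exprD addnC subrr.
exists (M + m)%N.
have -> : sg k ^+ (M + m) * c = sg k ^+ (M + d.+1) * a.
  by apply/eqP; rewrite -subr_eq0 !exprD -!mulrA -mulrBr; apply/eqP.
apply: spow_le (spow_X k (M + d.+1) aP); lia.
Qed.

Lemma spow_mul_mono m r k c : (m <= r)%N -> spow m.+1 (sg k ^+ m * c) -> spow r.+1 (sg k ^+ r * c).
Proof.
move=> mr h; rewrite -(subnK mr) exprD -mulrA -addnS; exact: spow_X.
Qed.

Theorem sec_radical d c : (0 < d)%N -> deg d c ->
  exists m, gen_by (fun=> True) (fun b => exists k, b = sg k) (c ^+ m).
Proof.
case: d => // d _ dc.
have /choice [mm mmP] : forall k, exists m, spow m.+1 (sg k ^+ m * c).
  by move=> k; exact: sec_mul_pow dc.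
pose m := (\sum_k mm k)%N.
have mP k : spow m.+1 (sg k ^+ m * c).
  by apply: spow_mul_mono (mmP k); rewrite /m (bigD1 k) //= leq_addr.
(* By the pigeonhole principle a monomial of degree [n.+1 * m] in the [n.+1] sections contains some
   [s_k] at least [m] times, and multiplying that power by [c] gains one factor. *)
pose n0 := (n.+1 * m)%N.
have key (w : seq 'I_n.+1) : size w = n0 -> spow n0.+1 (\prod_(k <- w) sg k * c).
  move=> sw; have [k mk] : exists k, (m <= count_mem k w)%N.
    apply: contrapT => /forallNP nk.
    have lt k : (count_mem k w < m)%N by rewrite ltnNge; apply/negP; exact: nk.
    have m0 : (0 < m)%N := leq_ltn_trans (leq0n _) (lt ord0).
    have : (size w <= \sum_(k < n.+1) m.-1)%N.
      have <- : \sum_k count_mem k w = size w.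
        elim: (w) => [|k v IH]; first by rewrite big1.
        rewrite /= big_split /= IH (bigD1 k) //= eqxx big1 ?addn0 // => l.
        by rewrite eq_sym => /negbTE ->.
      by apply: leq_sum => k _; rewrite -ltnS prednK.
    rewrite sum_nat_const card_ord sw /n0 leq_pmul2l // leqNgt.
    by rewrite prednK // leqnn.
  have perm : perm_eq w (nseq (count_mem k w) k ++ seq.filter (predC (pred1 k)) w).
    have <- : seq.filter (pred1 k) w = nseq (count_mem k w) k.
      by rewrite -size_filter; apply/all_pred1P/seq.filter_all.
    by rewrite perm_sym perm_filterC.
  have sz := perm_size perm; rewrite size_cat size_nseq sw in sz.
  rewrite (perm_big _ perm) big_cat /= big_nseq iter_mulr_1 mulrAC mulrC.
  have := spow_prod (seq.filter (predC (pred1 k)) w) (spow_mul_mono mk (mP k)).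
  by rewrite addnS addnC -sz.
pose I (x : S) := gen_by (fun=> True) (fun b => exists k, b = sg k) x.
pose g := [seq \prod_(k <- tval t) sg k | t : n0.-tuple 'I_n.+1].
have I0 : I 0 by exact: gen_by0.
have ID a b : I a -> I b -> I (a + b) by exact: gen_byD.
have IM a b : I b -> I (a * b) by move=> h; exact: gen_byM.
have [|M [e [Ie ke]]] := det_trick (g := g) (c := c) I0 ID IM.
  move=> x /mapP [t _ ->]; rewrite mulrC.
  have := key t (size_tuple t); elim=> [|b y z _ [w sw ->] _ IH]; first exact: lin_span0.
  apply: lin_spanD => //; case: w sw => // k w [sw].
  rewrite big_cons mulrA; apply: lin_span_mem => //.
    by apply: IM; apply: gen_by_mem => //; exists k.
  by have /eqP sw' := sw; apply/mapP; exists (Tuple sw') => //; rewrite mem_enum.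
(* This element kills every [s_k ^+ n0]. At each point some [s_k] generates [L] and is a
   nonzerodivisor in the tensor algebra, so all germs of the element vanish. *)
have E : c ^+ M + e = 0.
  apply: (@ev_inj _ _ _ _ S) => x; rewrite rmorph0.
  have [k gk] := ind_cover hs x.
  have : sg k ^+ n0 \in g.
    apply/mapP; exists [tuple of nseq n0 k]; first by rewrite mem_enum.
    by rewrite /= big_nseq iter_mulr_1.
  move=> /ke /(congr1 (ev S x)); rewrite rmorph0 mulrC rmorphM rmorphXn /= sgE.
  exact: tensor_reg.
exists M; have -> : c ^+ M = - 1 * e by rewrite mulN1r; apply/eqP; rewrite -addr_eq0 E.
exact: IM.
Qed.

End BaseLocus.

(** * The extended Rees algebra and the associated graded algebra *)

Section IdealPowers.
Variables (A : comNzRingType) (S : gralg A) (I : S -> Prop) (M : nat).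
Variables (tg : 'I_M -> S).
Hypothesis tg_deg : forall k, deg 1 (tg k).
Hypothesis IE : forall a, I a <-> exists c : 'I_M -> S, a = \sum_k c k * tg k.
Implicit Types (a b c : S) (l m n : nat) (z : int).

Lemma ideal_tg k : I (tg k).
Proof.
apply/IE; exists (fun j => if j == k then 1 else 0).
by rewrite (bigD1 k) //= eqxx mul1r big1 ?addr0 // => j /negbTE ->; rewrite mul0r.
Qed.

(** The ideal properties of the power [l] are hypotheses here because [idpow_ideal] proves them by
    an induction that uses this description; [idpowSP] is the unconditional form. *)
Lemma idpowSP_of l : idpow I l 0 ->
  (forall a b, idpow I l a -> idpow I l b -> idpow I l (a + b)) ->
  (forall a b, idpow I l b -> idpow I l (a * b)) ->
  forall a, idpow I l.+1 a <->
    exists c : 'I_M -> S, (forall k, idpow I l (c k)) /\ a = \sum_k c k * tg k.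
Proof.
move=> H0 HD HM a; split=> [[m [b [c [h ->]]]]|[c [ic ->]]]; last first.
  exists M, tg, c; split; first by move=> k; split; [exact: ideal_tg|].
  by apply: eq_bigr => k _; rewrite mulrC.
have /choice [d dE] : forall j, exists d : 'I_M -> S, b j = \sum_k d k * tg k.
  by move=> j; apply/IE; case: (h j).
exists (fun k => \sum_j d j k * c j); split.
  by move=> k; elim/big_ind: _ => // j _; apply: HM; case: (h j).
rewrite (eq_bigr (fun j => \sum_k d j k * c j * tg k)); last first.
  by move=> j _; rewrite dE mulr_suml; apply: eq_bigr => k _; rewrite mulrAC.
by rewrite exchange_big /=; apply: eq_bigr => k _; rewrite mulr_suml.
Qed.

Lemma idpow_ideal l : (idpow I l 0 /\ (forall a b, idpow I l a -> idpow I l b -> idpow I l (a + b)))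
  /\ forall a b, idpow I l b -> idpow I l (a * b).
Proof.
elim: l => [//|l [[H0 HD] HM]]; have NF := idpowSP_of H0 HD HM.
split; [split|].
- apply/NF; exists (fun=> 0); split=> //.
  by rewrite big1 // => k _; rewrite mul0r.
- move=> a b /NF [c [ic ->]] /NF [d [id ->]]; apply/NF.
  exists (fun k => c k + d k); split; first by move=> k; exact: HD.
  by rewrite -big_split /=; apply: eq_bigr => k _; rewrite mulrDl.
- move=> a b /NF [c [ic ->]]; apply/NF; exists (fun k => a * c k).
  split; first by move=> k; exact: HM.
  by rewrite mulr_sumr; apply: eq_bigr => k _; rewrite mulrA.
Qed.

Lemma idpow0 l : idpow I l 0. Proof. by case: (idpow_ideal l) => -[]. Qed.
Lemma idpowD l a b : idpow I l a -> idpow I l b -> idpow I l (a + b).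
Proof. by case: (idpow_ideal l) => -[_ h] _; exact: h. Qed.
Lemma idpowM l a b : idpow I l b -> idpow I l (a * b).
Proof. by case: (idpow_ideal l) => _; apply. Qed.
Lemma idpowMr l a b : idpow I l a -> idpow I l (a * b).
Proof. by rewrite mulrC; exact: idpowM. Qed.
Lemma idpowN l a : idpow I l a -> idpow I l (- a).
Proof. by rewrite -mulN1r; exact: idpowM. Qed.

Lemma idpow_sum l (J : finType) (F : J -> S) :
  (forall j, idpow I l (F j)) -> idpow I l (\sum_j F j).
Proof.
move=> h; elim/big_ind: _ => // [|x y]; [exact: idpow0|exact: idpowD].
Qed.

Lemma idpowSP l a : idpow I l.+1 a <->
  exists c : 'I_M -> S, (forall k, idpow I l (c k)) /\ a = \sum_k c k * tg k.
Proof. by have [[H0 HD] HM] := idpow_ideal l; exact: idpowSP_of. Qed.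

Lemma idpow_dec l m a : (m <= l)%N -> idpow I l a -> idpow I m a.
Proof.
move=> /subnK <-; elim: (l - m)%N => [//|r IH] h; apply: IH.
have {h} : idpow I (r + m).+1 a by [].
by move=> /idpowSP [c [ic ->]]; apply: idpow_sum => k; exact: idpowMr.
Qed.

(** The generators [tg k] are homogeneous of degree one, so the component of degree [n] of a
    combination is the combination of the components of degree [n - 1] of the coefficients. *)
Lemma idpow_hc l a n : idpow I l a -> idpow I l (hc a n).
Proof.
elim: l a n => [//|l IH] a n /idpowSP [c [ic ->]]; apply/idpowSP.
exists (fun k => if (1 <= n)%N then hc (c k) (n - 1) else 0); split.
  by move=> k; case: ifP => _; [exact: IH|exact: idpow0].
rewrite hc_bigsum; apply: eq_bigr => k _; rewrite mulrC (hcMl _ _ (tg_deg k)).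
by case: ifP => _; rewrite ?mul0r // mulrC.
Qed.

Lemma idpowS_deg l n a : idpow I l.+1 a -> deg n.+1 a -> exists c : 'I_M -> S,
  (forall k, idpow I l (c k) /\ deg n (c k)) /\ a = \sum_k c k * tg k.
Proof.
move=> /idpowSP [c [ic e]] da; exists (fun k => hc (c k) n); split.
  by move=> k; split; [exact: idpow_hc|exact: hc_deg].
have -> : a = hc a n.+1 by rewrite (hc_homog _ da) eqxx.
rewrite e hc_bigsum; apply: eq_bigr => k _.
by rewrite mulrC (hcMl _ _ (tg_deg k)) subn1 mulrC.
Qed.

Lemma idpow_mul l m a b : idpow I l a -> idpow I m b -> idpow I (l + m) (a * b).
Proof.
move=> + ib; elim: l a => [|l IH] a; first by move=> _; exact: idpowM.
move=> /idpowSP [c [ic ->]]; rewrite mulr_suml addSn; apply/idpowSP.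
exists (fun k => c k * b); split; first by move=> k; exact: IH.
by apply: eq_bigr => k _; rewrite mulrAC.
Qed.

Lemma idpow1_tg k : idpow I 1 (tg k).
Proof.
exists 1%N, (fun=> tg k), (fun=> 1); split; first by move=> _; split=> //; exact: ideal_tg.
by rewrite big_ord1 mulr1.
Qed.

Lemma idpowz0 z : idpowz I z 0. Proof. by case: z => // n; exact: idpow0. Qed.
Lemma idpowzD z a b : idpowz I z a -> idpowz I z b -> idpowz I z (a + b).
Proof. by case: z => // n; exact: idpowD. Qed.
Lemma idpowzN z a : idpowz I z a -> idpowz I z (- a).
Proof. by case: z => // n; exact: idpowN. Qed.

Lemma idpowz_dec z z' a : (z' <= z)%R -> idpowz I z a -> idpowz I z' a.
Proof.
case: z' => // m; case: z => [l|l]; last by [].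
by rewrite lez_nat; exact: idpow_dec.
Qed.

End IdealPowers.

(** The interval from [-m] to [m], indexed as in [re_gen] and [re_free]. *)
Definition zsum (V : nmodType) (m : nat) (F : int -> V) : V :=
  \sum_(k < m.*2.+1) F (k%:Z - m%:Z).

Lemma zsumS (V : nmodType) m (F : int -> V) :
  zsum m.+1 F = F (- m.+1%:Z) + zsum m F + F m.+1%:Z.
Proof.
rewrite /zsum doubleS big_ord_recr big_ord_recl /=; congr (F _ + _ + F _); try lia.
by apply: eq_bigr => k _; congr (F _); rewrite /bump /=; lia.
Qed.

Lemma eq_zsum (V : nmodType) m (F G : int -> V) : F =1 G -> zsum m F = zsum m G.
Proof. by move=> e; apply: eq_bigr => k _; rewrite e. Qed.

Lemma zsum_widen (V : nmodType) m m' (F : int -> V) : (m <= m')%N ->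
  (forall z, (m < absz z)%N -> F z = 0) -> zsum m' F = zsum m F.
Proof.
move=> /subnK <- F0; elim: (m' - m)%N => [//|r IH].
by rewrite addSn zsumS IH !F0 ?addr0 ?add0r //; lia.
Qed.

Lemma zsum_single (V : nmodType) z (F : int -> V) :
  (forall z', z' != z -> F z' = 0) -> zsum (absz z) F = F z.
Proof.
move=> F0; have lt : (absz (z + (absz z)%:Z)%R < (absz z).*2.+1)%N by lia.
rewrite /zsum (bigD1 (Ordinal lt)) //= big1 ?addr0; first by congr F; lia.
move=> k kne; apply: F0; apply/negP => /eqP e; case/eqP: kne.
by apply: val_inj => /=; lia.
Qed.

Lemma zsumM (V : comPzRingType) m (x : V) (F : int -> V) :
  x * zsum m F = zsum m (fun z => x * F z).
Proof. by rewrite /zsum mulr_sumr. Qed.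

Lemma zsum_pos (V : nmodType) m (F : int -> V) :
  (forall l, F (Negz l) = 0) -> zsum m F = \sum_(l < m.+1) F l.
Proof.
move=> F0; rewrite /zsum; have -> : m.*2.+1 = (m + m.+1)%N by lia.
rewrite big_split_ord /= big1 ?add0r.
  by apply: eq_bigr => k _; congr F; lia.
move=> k _; have := ltn_ord k => km.
by have -> : k%:Z - m%:Z = Negz (m - k).-1 by lia.
Qed.

Section Rees.
Variables (A : comNzRingType) (S : gralg A) (I : S -> Prop) (M : nat).
Variables (tg : 'I_M -> S).
Hypothesis tg_deg : forall k, deg 1 (tg k).
Hypothesis IE : forall a, I a <-> exists c : 'I_M -> S, a = \sum_k c k * tg k.
Variable R : rees I.
Implicit Types (a b : S) (l m n : nat) (z : int) (f g : R) (c : int -> S).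

Let iz0 := idpowz0 IE.
Let izD := idpowzD IE.
Let izN := idpowzN IE.
Let izdec := idpowz_dec IE.

Lemma re0 z : re R z 0 = 0.
Proof. by rewrite -(subrr (0 : S)) reB ?subrr //; exact: iz0. Qed.

Lemma reN z a : idpowz I z a -> re R z (- a) = - re R z a.
Proof. by move=> ia; rewrite -sub0r reB ?re0 ?sub0r //; exact: iz0. Qed.

Lemma reD z a b : idpowz I z a -> idpowz I z b -> re R z (a + b) = re R z a + re R z b.
Proof. by move=> ia ib; rewrite -[b]opprK reB ?reN ?opprK //; exact: izN. Qed.

Lemma re_sum z (J : finType) (F : J -> S) : (forall j, idpowz I z (F j)) ->
  re R z (\sum_j F j) = \sum_j re R z (F j).
Proof.
move=> h; suff [] : idpowz I z (\sum_j F j) /\ re R z (\sum_j F j) = \sum_j re R z (F j) by [].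
elim: (index_enum J) => [|j s [h1 h2]].
  by rewrite !big_nil re0; split=> //; exact: iz0.
by rewrite !big_cons; split; [exact: izD|rewrite reD // h2].
Qed.

Lemma re1 : re R 0 1 = 1.
Proof. by rewrite -[in LHS](rmorph1 (gstr S)) -re_str rmorph1. Qed.

Lemma tau_re z a : idpowz I z a -> tau R * re R z a = re R (z - 1) a.
Proof. by move=> ia; rewrite /tau reM // mul1r addrC. Qed.

Lemma reX n a : re R 0 a ^+ n = re R 0 (a ^+ n).
Proof.
elim: n => [|n IH]; first by rewrite !expr0 re1.
by rewrite !exprS IH reM.
Qed.

(* A bound on the support makes the representation of an element stable
   under widening of the range of summation. *)
Definition rees_rep f m c := [/\ forall z, idpowz I z (c z),
  forall z, (m < absz z)%N -> c z = 0 & f = zsum m (fun z => re R z (c z))].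

Lemma rees_rep_widen f m m' c : (m <= m')%N -> rees_rep f m c -> rees_rep f m' c.
Proof.
move=> mm [ic c0 e]; split=> //; first by move=> z h; apply: c0; lia.
by rewrite e; apply/esym/zsum_widen => // z h; rewrite c0 // re0.
Qed.

(** [re_gen] leaves the coefficients outside the range arbitrary; they are replaced by 0. *)
Let trunc m c z : S := if (absz z <= m)%N then c z else 0.

Let truncE m c : zsum m (fun z => re R z (trunc m c z)) = zsum m (fun z => re R z (c z)).
Proof.
by apply: eq_bigr => k _; rewrite /trunc ifT //; have := ltn_ord k; lia.
Qed.

Lemma rees_rep_ex f : exists m c, rees_rep f m c.
Proof.
have [m [c [ic e]]] := re_gen f; exists m, (trunc m c); split.
- by move=> z; rewrite /trunc; case: ifP => // _; exact: iz0.
- by move=> z h; rewrite /trunc leqNgt h.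
- by rewrite truncE.
Qed.

Lemma rees_rep_deg n f : deg n f ->
  exists m c, rees_rep f m c /\ forall z, deg n (c z).
Proof.
move=> /re_deg [m [c [ic e]]]; exists m, (trunc m c); split; first split.
- by move=> z; rewrite /trunc; case: ifP => _; [case: (ic z)|exact: iz0].
- by move=> z h; rewrite /trunc leqNgt h.
- by rewrite truncE.
- by move=> z; rewrite /trunc; case: ifP => _; [case: (ic z)|exact: deg0].
Qed.

Lemma rees_rep_single z a : idpowz I z a ->
  rees_rep (re R z a) (absz z) (fun z' => if z' == z then a else 0).
Proof.
move=> ia; split.
- by move=> z'; case: eqP => [->//|_]; exact: iz0.
- by move=> z' h; rewrite ifF //; apply/negP => /eqP e; rewrite e ltnn in h.
- rewrite zsum_single ?eqxx // => z' /negbTE ->; exact: re0.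
Qed.

Lemma rees_repB f g m c d : rees_rep f m c -> rees_rep g m d ->
  rees_rep (f - g) m (fun z => c z - d z).
Proof.
move=> [ic c0 ->] [id d0 ->]; split.
- by move=> z; apply: izD => //; exact: izN.
- by move=> z h; rewrite c0 ?d0 ?subrr.
- by rewrite /zsum -sumrB; apply: eq_bigr => k _; rewrite reB.
Qed.

Lemma rees_rep0 m c : rees_rep 0 m c -> forall z, c z = 0.
Proof.
move=> [ic c0 e] z; case: (ltnP m (absz z)) => [/c0//|zm].
have := @re_free _ _ _ R m c ic (esym e) (absz (z + m%:Z)%R).
have -> : (absz (z + m%:Z)%R)%:Z - m%:Z = z by lia.
by apply; lia.
Qed.

Lemma re_ind (Q : R -> Prop) : (forall f g, Q f -> Q g -> Q (f + g)) ->
  (forall z a, idpowz I z a -> Q (re R z a)) -> forall f, Q f.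
Proof.
move=> QD Qre f; have [m [c [ic _ ->]]] := rees_rep_ex f.
rewrite /zsum; elim/big_ind: _ => [||k _]; [|exact: QD|exact: Qre].
by rewrite -(re0 0); apply: Qre; exact: iz0.
Qed.

Lemma re_degP z n a : idpowz I z a -> deg n a -> deg n (re R z a).
Proof.
move=> ia da; apply/re_deg; have [ic _ e] := rees_rep_single ia.
exists (absz z), (fun z' => if z' == z then a else 0); split; last exact: e.
by move=> z'; split; [exact: ic|case: eqP => // _; exact: deg0].
Qed.

Lemma tau_deg : deg 0 (tau R).
Proof. by apply: re_degP => //; exact: deg1. Qed.

(** Multiplication by [tau] lowers the index and leaves the coefficients in [S] unchanged, so the
    freeness of the representation applies to the shifted coefficients. *)
Lemma tau_reg f : tau R * f = 0 -> f = 0.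
Proof.
have [m [c rep]] := rees_rep_ex f; have [ic c0 e] := rep => h.
(* The range is enlarged by one to contain the shifted indices; the two extra terms at the top are
   zero. *)
have rep' : rees_rep 0 m.+1 (fun z => c (z + 1)).
  split.
  - by move=> z; apply: izdec (ic _); lia.
  - by move=> z zm; apply: c0; lia.
  - rewrite -h e /zsum mulr_sumr [RHS](_ : _ = \sum_(k < m.*2.+1) re R (k%:Z - m%:Z - 1) (c (k%:Z - m%:Z))).
      by apply: eq_bigr => k _; rewrite tau_re.
    rewrite doubleS big_ord_recr big_ord_recr /= ![c (_ - m.+1%:Z + 1)]c0 ?re0 ?addr0; try lia.
    by apply: eq_bigr => k _; congr (re R _ (c _)); lia.
rewrite e; apply: big1 => k _; have := rees_rep0 rep' (k%:Z - m%:Z - 1).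
by rewrite subrK => ->; rewrite re0.
Qed.

Section Cover.
Variables (N : nat) (sg : 'I_N -> S).
Hypothesis rad : forall d a, (0 < d)%N -> deg d a ->
  exists m, gen_by (fun=> True) (fun b => exists k, b = sg k) (a ^+ m).

Definition xi (k : 'I_(N + M)) : R :=
  match fintype.split k with inl k1 => re R 0 (sg k1) | inr k2 => re R 1 (tg k2) end.

(** In index [l <= 0] an element is a multiple of [re 0 b] with [b] of positive degree, and [rad]
    applies. In index [l > 0] it is a combination of the [tg j] with coefficients in the power
    [l - 1] of [I], hence a multiple of the coordinates [re 1 (tg j)]. *)
Lemma rees_cover (q : R -> Prop) : proj_prime q -> exists k, ~ q (xi k).
Proof.
move=> pq; apply: contrapT => /forallNP h0.
have h k : q (xi k) by exact: contrapT (h0 k).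
have qsg k : q (re R 0 (sg k)) by have := h (lshift M k); rewrite /xi (unsplitK (inl k)).
have qtg k : q (re R 1 (tg k)) by have := h (rshift N k); rewrite /xi (unsplitK (inr k)).
have [n [f [n0 df qf]]] := pr_irr pq; apply: qf.
have [m [c [[ic _ ->] dc]]] := rees_rep_deg df.
rewrite /zsum; elim/big_ind: _ => [||k _]; [exact: (pr_0 pq)|exact: (prD pq)|].
set z := (_ - _); move: (ic z) (dc z); move: (c z) => a.
have low (z' : int) b : idpowz I z' 1 -> deg n b -> q (re R z' b).
  move=> i1 db; have -> : re R z' b = re R z' 1 * re R 0 b by rewrite reM // addr0 mul1r.
  apply: (prM pq); have [r gr] := rad n0 db.
  have : q (re R 0 b ^+ r).
    rewrite reX; elim: gr => [|u v w _ [k' ->] _ IH]; first by rewrite re0; exact: (pr_0 pq).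
    rewrite reD //; apply: (prD pq) => //.
    have -> : re R 0 (u * sg k') = re R 0 u * re R 0 (sg k') by rewrite reM.
    exact: (prM pq).
  elim: r {gr} => [|r IH]; first by rewrite expr0 => /(pr_1 pq).
  by rewrite exprS => /(pr_prime pq) [].
case: z => [[|l]|l] ia da; [exact: low|idtac|exact: low].
have /(idpowSP IE) [d [id ->]] := ia.
have id1 j : idpow I l.+1 (d j * tg j).
  by rewrite -addn1; apply: (idpow_mul IE) => //; exact: (idpow1_tg IE).
rewrite re_sum //; elim/big_ind: _ => [||j _]; [exact: (pr_0 pq)|exact: (prD pq)|].
have -> : re R l.+1 (d j * tg j) = re R l (d j) * re R 1 (tg j).
  by rewrite reM //; [congr re; lia|exact: (idpow1_tg IE)].
exact: (prM pq).
Qed.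

End Cover.

(** * The associated graded algebra as the quotient of the extended Rees algebra by tau *)

Section AssocGraded.
Variable G : assoc_graded I.

Let ip0 := idpow0 IE.
Let ipD := idpowD IE.
Let ipN := idpowN IE.

Lemma gc0 l : gc G l 0 = 0.
Proof. by apply/(gc_eq0 G); exact: ip0. Qed.

Lemma gcD l a b : idpow I l a -> idpow I l b -> gc G l (a + b) = gc G l a + gc G l b.
Proof.
move=> ia ib; have gcN d : idpow I l d -> gc G l (- d) = - gc G l d.
  by move=> id; rewrite -sub0r gcB ?gc0 ?sub0r.
by rewrite -[b]opprK gcB ?gcN ?opprK //; exact: ipN.
Qed.

Lemma gc_sum l (J : finType) (F : J -> S) : (forall j, idpow I l (F j)) ->
  gc G l (\sum_j F j) = \sum_j gc G l (F j).
Proof.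
move=> h; suff [] : idpow I l (\sum_j F j) /\ gc G l (\sum_j F j) = \sum_j gc G l (F j) by [].
elim: (index_enum J) => [|j s [h1 h2]].
  by rewrite !big_nil gc0; split=> //; exact: ip0.
by rewrite !big_cons; split; [exact: ipD|rewrite gcD // h2].
Qed.

Lemma gc1 : gc G 0 1 = 1.
Proof. by rewrite -[in LHS](rmorph1 (gstr S)) -gc_str rmorph1. Qed.

Lemma gc_degP l n a : idpow I l a -> deg n a -> deg n (gc G l a).
Proof.
move=> ia da; apply/gc_deg; exists l.+1, (fun l' => if l' == l then a else 0); split.
  by move=> l'; case: eqP => [->//|_]; split; [exact: ip0|exact: deg0].
rewrite big_ord_recr /= eqxx big1 ?add0r // => k _.
by rewrite ltn_eqF ?gc0.
Qed.

(** For negative [z] the element [re z a] is [tau] times [re (z + 1) a], so its image must be 0. *)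
Definition gval (z : int) a : G := if z is Posz l then gc G l a else 0.

Definition gsum m c : G := zsum m (fun z => gval z (c z)).

Let gval0 z : gval z 0 = 0.
Proof. by case: z => // l; exact: gc0. Qed.

Let gvalB z a b : idpowz I z a -> idpowz I z b -> gval z (a - b) = gval z a - gval z b.
Proof. by case: z => [l|l] /= ia ib; [exact: gcB|rewrite subr0]. Qed.

Lemma gsum_widen f m m' c : (m <= m')%N -> rees_rep f m c -> gsum m' c = gsum m c.
Proof. by move=> mm [_ c0 _]; apply: zsum_widen => // z h; rewrite c0 ?gval0. Qed.

Lemma gsum_eq f m m' c c' : rees_rep f m c -> rees_rep f m' c' -> gsum m c = gsum m' c'.
Proof.
move=> r r'.
rewrite -(gsum_widen (leq_maxl m m') r) -(gsum_widen (leq_maxr m m') r').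
have w := rees_rep_widen (leq_maxl m m') r; have w' := rees_rep_widen (leq_maxr m m') r'.
have := rees_repB w w'; rewrite subrr => /rees_rep0 e.
by apply: eq_zsum => z; have /eqP := e z; rewrite subr_eq0 => /eqP ->.
Qed.

Fact rees_rep_key f : {mc : nat * (int -> S) | rees_rep f mc.1 mc.2}.
Proof. by apply: cid; have [m [c h]] := rees_rep_ex f; exists (m, c). Qed.

Definition rees_to_graded f : G := gsum (sval (rees_rep_key f)).1 (sval (rees_rep_key f)).2.
Local Notation q := rees_to_graded.

Lemma rees_to_gradedE f m c : rees_rep f m c -> q f = gsum m c.
Proof. by move=> r; apply: gsum_eq r; exact: svalP (rees_rep_key f). Qed.

Lemma rees_to_graded_re z a : idpowz I z a -> q (re R z a) = gval z a.
Proof.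
move=> ia; rewrite (rees_to_gradedE (rees_rep_single ia)) /gsum zsum_single ?eqxx //.
by move=> z' /negbTE ->; exact: gval0.
Qed.

Fact rees_to_graded_zmod : zmod_morphism q.
Proof.
move=> f g; have [m [c r]] := rees_rep_ex f; have [m' [c' r']] := rees_rep_ex g.
have w := rees_rep_widen (leq_maxl m m') r; have w' := rees_rep_widen (leq_maxr m m') r'.
rewrite (rees_to_gradedE w) (rees_to_gradedE w') (rees_to_gradedE (rees_repB w w')).
rewrite /gsum /zsum -sumrB; apply: eq_bigr => k _.
by case: w => ic _ _; case: w' => ic' _ _; rewrite gvalB.
Qed.
HB.instance Definition _ := GRing.isZmodMorphism.Build R G q rees_to_graded_zmod.

(** The case to check is that of one negative index, where the product of the images is 0. If
    [l >= 0] and [l' < 0], then [a * b] is in the power [l] of [I], hence in the power [l + l' + 1],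
    and its class in index [l + l'] is 0. *)
Fact rees_to_graded_monoid : monoid_morphism q.
Proof.
split; first by rewrite -re1 rees_to_graded_re //= gc1.
apply: re_ind => [f g hf hg h|z a ia].
  by rewrite mulrDl !raddfD /= hf hg mulrDl.
apply: re_ind => [f g hf hg|z' b ib].
  by rewrite mulrDr !raddfD /= hf hg mulrDr.
rewrite reM // !rees_to_graded_re //.
  case: z ia => [l|l] ia; case: z' ib => [l'|l'] ib.
  - exact/esym/gcM.
  - rewrite /= mulr0; case e: (Posz l + Negz l') => [k|k] //=.
    apply/gc_eq0; first by apply: (idpowMr IE); apply: (idpow_dec IE) ia; lia.
    by apply: (idpowMr IE); apply: (idpow_dec IE) ia; lia.
  - rewrite /= mul0r; case e: (Negz l + Posz l') => [k|k] //=.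
    apply/gc_eq0; first by apply: (idpowM IE); apply: (idpow_dec IE) ib; lia.
    by apply: (idpowM IE); apply: (idpow_dec IE) ib; lia.
  - by rewrite /= mul0r.
case: z ia => [l|l] ia; case: z' ib => [l'|l'] ib.
- exact: (idpow_mul IE).
- apply: (izdec (z := Posz l)); first by lia.
  exact: (idpowMr IE).
- apply: (izdec (z := Posz l')); first by lia.
  exact: (idpowM IE).
- by apply: (izdec (z := Posz 0)) => //; lia.
Qed.
HB.instance Definition _ := GRing.isMonoidMorphism.Build R G q rees_to_graded_monoid.

Lemma rees_to_graded_deg n f : deg n f -> deg n (q f).
Proof.
move=> /rees_rep_deg [m [c [r dc]]]; rewrite (rees_to_gradedE r).
apply: deg_bigsum => k _; case: r => ic _ _.
set z := (_ - _); move: (ic z) (dc z); case: z => [l|l] /= *; last exact: deg0.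
exact: gc_degP.
Qed.

Lemma rees_to_graded_surj n (g : G) : deg n g -> exists2 f, deg n f & q f = g.
Proof.
move=> /gc_deg [m [c [h ->]]]; exists (\sum_(l < m) re R l (c l)).
  by apply: deg_bigsum => k _; case: (h k) => ? ?; exact: re_degP.
rewrite raddf_sum; apply: eq_bigr => k _; rewrite /= rees_to_graded_re //.
by case: (h k).
Qed.

Lemma rees_to_graded_tau : q (tau R) = 0.
Proof. exact: rees_to_graded_re. Qed.

(** A sum of classes in distinct indices vanishes only if each class does, so a coefficient of index
    [l >= 0] lies in the power [l + 1] of [I] and a factor [tau] comes out; in negative index this
    is automatic. Since [tau] has degree 0, the cofactor may be replaced by its component of degree
    [n]. *)
Lemma rees_to_graded_ker n f : deg n f -> q f = 0 -> exists2 g, deg n g & f = tau R * g.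
Proof.
move=> df qf; suff [g e] : exists g, f = tau R * g.
  exists (hc g n); first exact: hc_deg.
  have -> : f = hc f n by rewrite (hc_homog _ df) eqxx.
  by rewrite e (hcMl _ _ tau_deg) leq0n subn0.
have [m [c [ic c0 e]]] := rees_rep_ex f.
have r : rees_rep f m c by [].
have ex z : exists g, re R z (c z) = tau R * g; last first.
  have /choice [g gE] := ex; exists (zsum m g).
  by rewrite e zsumM; exact: eq_zsum.
have i1 : idpowz I (z + 1) (c z); last first.
  by exists (re R (z + 1) (c z)); rewrite tau_re // addrK.
case: z => [l|l]; last by apply: (izdec (z := Posz 0)) => //; lia.
suff : idpow I l.+1 (c l) by move=> h; have -> : Posz l + 1 = Posz l.+1 by lia.
have [lm|ml] := leqP l m; last by rewrite c0 //; exact: ip0.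
apply/(gc_eq0 G); first exact: ic l.
have := @gc_free _ _ _ G m.+1 (fun l => c l) (fun l => ic l); apply=> //.
by rewrite -[RHS]qf (rees_to_gradedE r) /gsum zsum_pos.
Qed.

Lemma assoc_graded_gen0 : generated_in_degree1_over_index0 G.
Proof.
move=> Q Q0 Q1 QD QM f.
have [m [c [ic ->]]] := gc_gen f.
elim/big_ind: _ => [||k _]; [by rewrite -(gc0 0)|exact: QD|].
elim: {k}(k : nat) (c k) (ic k) => [|l IH] a //.
move=> /(idpowSP IE) [d [id ->]].
have id1 j : idpow I l.+1 (d j * tg j).
  by rewrite -addn1; apply: (idpow_mul IE) => //; exact: (idpow1_tg IE).
rewrite gc_sum //; elim/big_ind: _ => [||j _]; [by rewrite -(gc0 0)|exact: QD|].
have -> : gc G l.+1 (d j * tg j) = gc G l (d j) * gc G 1 (tg j).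
  by rewrite gcM ?addn1 //; exact: (idpow1_tg IE).
apply: QM; first exact: IH.
by apply: Q1; apply: gc_degP => //; exact: (idpow1_tg IE).
Qed.

(** In index 0 the decomposition comes from the hypothesis on [S]; in index [l + 1] the generators
    [tg j] of the ideal supply the factors of degree one. *)
Lemma assoc_graded_gen1 : generated_in_degree1 S -> generated_in_degree1 G.
Proof.
move=> gS n f.
pose Q (u : G) := exists m (b c : 'I_m -> G),
  (forall j, deg 1 (b j) /\ deg n (c j)) /\ u = \sum_(j < m) b j * c j.
have QD (f1 f2 : G) : Q f1 -> Q f2 -> Q (f1 + f2).
  move=> [m [b [c [h ->]]]] [m' [b' [c' [h' ->]]]].
  exists (m + m')%N, (fun j => match fintype.split j with inl k => b k | inr k => b' k end),
    (fun j => match fintype.split j with inl k => c k | inr k => c' k end); split.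
    by move=> j; case: (fintype.split j).
  rewrite big_split_ord /=; congr (_ + _); apply: eq_bigr => j _.
    by rewrite (unsplitK (inl j)).
  by rewrite (unsplitK (inr j)).
have Q0 : Q 0 by exists 0%N, (fun=> 0), (fun=> 0); split; [case|rewrite big_ord0].
have Q1 (u v : G) : deg 1 u -> deg n v -> Q (u * v).
  by move=> du dv; exists 1%N, (fun=> u), (fun=> v); rewrite big_ord1.
move=> /gc_deg [m [c [h ->]]]; change (Q (\sum_(l < m) gc G l (c l))).
elim/big_ind: _ => // k _; have [] := h k.
case: {k}(k : nat) (c k) => [|l] a ia da.
  have [r [b [d [bd ->]]]] := gS n a da.
  rewrite gc_sum //; elim/big_ind: _ => // j _; have [db dd] := bd j.
  have -> : gc G 0 (b j * d j) = gc G 0 (b j) * gc G 0 (d j) by rewrite gcM.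
  by apply: Q1; apply: gc_degP.
have [d [hd ->]] := idpowS_deg tg_deg IE ia da.
have id1 j : idpow I l.+1 (d j * tg j).
  by rewrite -addn1; apply: (idpow_mul IE); [case: (hd j)|exact: (idpow1_tg IE)].
rewrite gc_sum //; elim/big_ind: _ => // j _; have [id dd] := hd j.
have -> : gc G l.+1 (d j * tg j) = gc G 1 (tg j) * gc G l (d j).
  by rewrite gcM 1?mulrC // ?add1n //; exact: (idpow1_tg IE).
by apply: Q1; apply: gc_degP => //; exact: (idpow1_tg IE).
Qed.

End AssocGraded.

End Rees.

(** * The section of the affine line at 1 *)

Section RelationMorphism.
Variables (R R' : comPzRingType) (rel : R -> R' -> Prop).
Hypotheses (rel_total : forall a, exists r, rel a r).
Hypotheses (rel_fun : forall a r r', rel a r -> rel a r' -> r = r').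
Hypotheses (relB : forall a b r s, rel a r -> rel b s -> rel (a - b) (r - s)).
Hypotheses (relM : forall a b r s, rel a r -> rel b s -> rel (a * b) (r * s)).
Hypothesis rel1 : rel 1 1.

Definition fun_of_rel a := sval (cid (rel_total a)).
Lemma fun_of_relP a : rel a (fun_of_rel a). Proof. exact: svalP (cid (rel_total a)). Qed.

Fact fun_of_rel_zmod : zmod_morphism fun_of_rel.
Proof. by move=> a b; apply: rel_fun (fun_of_relP _) (relB (fun_of_relP a) (fun_of_relP b)). Qed.

Fact fun_of_rel_monoid : monoid_morphism fun_of_rel.
Proof.
split; first exact: rel_fun (fun_of_relP _) rel1.
by move=> a b; apply: rel_fun (fun_of_relP _) (relM (fun_of_relP a) (fun_of_relP b)).
Qed.

HB.instance Definition _ := GRing.isZmodMorphism.Build R R' fun_of_rel fun_of_rel_zmod.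
HB.instance Definition _ := GRing.isMonoidMorphism.Build R R' fun_of_rel fun_of_rel_monoid.

(** The stalk maps at the unit section and between Proj's are produced from relations by this lemma;
    the conclusion is a sigma type so that the morphism can be projected out as data. *)
Lemma rel_rmorphism : {f : {rmorphism R -> R'} | forall a, rel a (f a)}.
Proof. by exists (fun_of_rel : {rmorphism R -> R'}); exact: fun_of_relP. Qed.

End RelationMorphism.

(** The coefficients of [r - (v - 1) * d(v)] as a polynomial in [v], in the shape to which
    [acoord_free] applies. *)
Lemma telescope_shift (B : comPzRingType) (v r : B) n (d : nat -> B) : d n = 0 ->
  \sum_(k < n.+1) ((if val k == 0%N then r else 0) + d k -
     (if val k is j.+1 then d j else 0)) * v ^+ k =
  r - (v - 1) * \sum_(k < n) d k * v ^+ k.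
Proof.
move=> dn.
have E0 : \sum_(k < n.+1) (if val k == 0%N then r else 0) * v ^+ k = r.
  rewrite big_ord_recl /= expr0 mulr1 big1 ?addr0 // => k _; exact: mul0r.
have E1 : \sum_(k < n.+1) d k * v ^+ k = \sum_(k < n) d k * v ^+ k.
  by rewrite big_ord_recr /= dn mul0r addr0.
have E2 : \sum_(k < n.+1) (if val k is j.+1 then d j else 0) * v ^+ k =
    v * \sum_(k < n) d k * v ^+ k.
  rewrite big_ord_recl /= mul0r add0r mulr_sumr; apply: eq_bigr => k _.
  by rewrite /bump /= exprS mulrCA.
under eq_bigr do rewrite mulrBl mulrDl.
by rewrite sumrB big_split /= E0 E1 E2; ring.
Qed.

Section UnitSection.
Variables (A : comNzRingType) (X : ascheme A) (Z : affine_line X).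
Implicit Types (x y : X) (z : Z) (U : set X) (f r : forall x, Ost x).
Local Notation pr := (apr Z).
Local Notation v := (@acoord _ _ Z).

(* [r] is [g] with the coordinate specialised to 1; stated as a congruence
   modulo [v - 1] it is multiplicative without comparing coefficients. *)
Definition value_at1 U (g : forall z, Ost z) r := secO U r /\
  exists2 g', secO (pr @^-1` U) g' &
    forall z, U (pr z) -> g z - mst pr z (r (pr z)) = (v z - 1) * g' z.

Lemma pr_sec U r : secO U r -> secO (pr @^-1` U) (fun z => mst pr z (r (pr z))).
Proof. by move=> rU z Uz; exact: m_reg (rU _ Uz). Qed.

Lemma value_at1_ex U g : affine_open U -> secO (pr @^-1` U) g ->
  exists r, value_at1 U g r.
Proof.
move=> aU gU; have [n [c [cU gE]]] := acoord_gen aU gU.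
exists (fun x => \sum_(k < n) c k x); split.
  by move=> x Ux; apply: (reg_sum (Osheaf X)) => k _; exact: cU.
exists (fun z => \sum_(k < n) mst pr z (c k (pr z)) * \sum_(j < k) v z ^+ j).
  move=> z Uz; apply: (reg_sum (Osheaf Z)) => k _; apply: OregM.
    exact: pr_sec (cU k) _ Uz.
  by apply: (reg_sum (Osheaf Z)) => j _; apply: OregX; exact: acoord_reg.
move=> z Uz; rewrite gE // rmorph_sum -sumrB mulr_sumr; apply: eq_bigr => k _.
by rewrite mulrCA -subrX1 mulrBr mulr1.
Qed.

(** Comparing coefficients in [v], those of [g'] satisfy [d' k.+1 = d' k], and [r] is the opposite
    of the constant one. As [d'] is 0 from [n] on, descending from the top makes all of them vanish,
    and [r] with them. *)
Lemma value_at1_eq0 U r g' : affine_open U -> secO U r -> secO (pr @^-1` U) g' ->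
  (forall z, U (pr z) -> mst pr z (r (pr z)) = (v z - 1) * g' z) ->
  forall x, U x -> r x = 0.
Proof.
move=> aU rU gU h; have [n [d [dU gE]]] := acoord_gen aU gU.
pose d' (k : nat) x := if (k < n)%N then d k x else 0.
pose c (k : nat) x := (if k == 0%N then r x else 0) + d' k x - (if k is j.+1 then d' j x else 0).
have d'U k : secO U (d' k).
  by rewrite /d'; case: (k < n)%N; [exact: dU|move=> x _; exact: Oreg0].
have cU k : secO U (c k).
  move=> x Ux; apply: OregB.
    apply: OregD; last exact: d'U.
    by case: (k == 0%N); [exact: rU|exact: Oreg0].
  by case: k => [|j]; [exact: Oreg0|exact: d'U].
have sumE z : U (pr z) -> g' z = \sum_(k < n) mst pr z (d' k (pr z)) * v z ^+ k.
  by move=> Uz; rewrite gE //; apply: eq_bigr => k _; rewrite /d' ltn_ord.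
have c0 : forall k, (k < n.+1)%N -> forall x, U x -> c k x = 0.
  apply: (@acoord_free _ _ Z U n.+1 c aU cU) => z Uz.
  rewrite (eq_bigr (fun k : 'I_n.+1 => ((if val k == 0%N then mst pr z (r (pr z)) else 0) +
     mst pr z (d' k (pr z)) - (if val k is j.+1 then mst pr z (d' j (pr z)) else 0)) * v z ^+ k)); last first.
    move=> k _; rewrite /c rmorphB rmorphD; congr ((_ + _ - _) * _).
      by case: k => -[|j] ?; rewrite /= ?rmorph0.
    by case: k => -[|j] ?; rewrite /= ?rmorph0.
  rewrite (telescope_shift (v z) (mst pr z (r (pr z))) (d := fun k => mst pr z (d' k (pr z)))).
    by rewrite -sumE // -h // subrr.
  by rewrite /d' ltnn rmorph0.
have dn k : (k <= n)%N -> forall x, U x -> d' (n - k)%N x = 0.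
  elim: k => [|k IH] kn x Ux; first by rewrite subn0 /d' ltnn.
  have := c0 (n - k)%N _ x Ux; rewrite /c.
  have -> : (n - k)%N = (n - k.+1).+1 by lia.
  have := IH (ltnW kn) x Ux; have -> : (n - k)%N = (n - k.+1).+1 by lia.
  move=> -> /(_ _) /=; rewrite !add0r => e; apply/eqP; rewrite -oppr_eq0.
  by apply/eqP/e; lia.
move=> x Ux; have := c0 0%N isT x Ux; rewrite /c /= subr0.
by have := dn n (leqnn n) x Ux; rewrite subnn => ->; rewrite addr0.
Qed.

Lemma value_at1_uniq U g r r' : affine_open U -> value_at1 U g r -> value_at1 U g r' ->
  forall x, U x -> r x = r' x.
Proof.
move=> aU [rU [g1 g1U e1]] [r'U [g2 g2U e2]] x Ux; apply/eqP; rewrite -subr_eq0; apply/eqP.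
apply: (@value_at1_eq0 U (fun x => r x - r' x) (fun z => g2 z - g1 z) aU) => //.
- by move=> y Uy; apply: OregB; [exact: rU|exact: r'U].
- by move=> z Uz; apply: OregB; [exact: g2U|exact: g1U].
- by move=> z Uz; rewrite mulrBr -e1 // -e2 // rmorphB; ring.
Qed.

Lemma value_at1D U g g' r r' : value_at1 U g r -> value_at1 U g' r' ->
  value_at1 U (fun z => g z + g' z) (fun x => r x + r' x).
Proof.
move=> [rU [g1 g1U e1]] [r'U [g2 g2U e2]]; split.
  by move=> y Uy; apply: OregD; [exact: rU|exact: r'U].
exists (fun z => g1 z + g2 z); first by move=> z Uz; apply: OregD; [exact: g1U|exact: g2U].
by move=> z Uz; rewrite mulrDr -e1 // -e2 // rmorphD; ring.
Qed.

Lemma value_at1M U g g' r r' : secO (pr @^-1` U) g' ->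
  value_at1 U g r -> value_at1 U g' r' ->
  value_at1 U (fun z => g z * g' z) (fun x => r x * r' x).
Proof.
move=> g'U [rU [g1 g1U e1]] [r'U [g2 g2U e2]]; split.
  by move=> y Uy; apply: OregM; [exact: rU|exact: r'U].
exists (fun z => g1 z * g' z + mst pr z (r (pr z)) * g2 z).
  move=> z Uz; apply: OregD; apply: OregM; [exact: g1U|exact: g'U| |exact: g2U].
  exact: pr_sec rU _ Uz.
by move=> z Uz; rewrite mulrDr mulrA -e1 // mulrCA -e2 // rmorphM; ring.
Qed.

Lemma value_at1_pull U r : secO U r -> value_at1 U (fun z => mst pr z (r (pr z))) r.
Proof.
move=> rU; split=> //; exists (fun=> 0); first by move=> z _; exact: Oreg0.
by move=> z _; rewrite subrr mulr0.
Qed.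

Lemma value_at1_unit U g r z : value_at1 U g r -> U (pr z) ->
  v z - 1 \isn't a GRing.unit -> (g z \is a GRing.unit) = (r (pr z) \is a GRing.unit).
Proof.
move=> [_ [g' _ e]] Uz nv; rewrite -(mst_unit (f := pr)).
have nu : (v z - 1) * g' z \isn't a GRing.unit.
  by apply/negP; rewrite unitrM => /andP[]; rewrite (negbTE nv).
have -> : g z = mst pr z (r (pr z)) + (v z - 1) * g' z by rewrite -e // addrC subrK.
apply/idP/idP => [/local_unitD [//|h]|u]; first by rewrite h in nu.
have : mst pr z (r (pr z)) + (v z - 1) * g' z + - ((v z - 1) * g' z) \is a GRing.unit.
  by rewrite addrK.
by move=> /local_unitD [//|]; rewrite unitrN => h; rewrite h in nu.
Qed.

(** The functions over the chart whose value at [v = 1] is not invertible at [x] form a prime, and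
    its point is the required one: [v - 1] has value 0, and functions pulled back from [X] have
    themselves as values. *)
Lemma unit_section_point x : exists z, pr z = x /\ v z - 1 \isn't a GRing.unit.
Proof.
have [U aU Ux] := sch_affine x; have aU' := @apr_affine _ _ Z _ aU.
pose q g := secO (pr @^-1` U) g /\ exists r, value_at1 U g r /\ r x \isn't a GRing.unit.
have qE g r : secO (pr @^-1` U) g -> value_at1 U g r -> q g <-> r x \isn't a GRing.unit.
  move=> gU gr; split=> [[_ [r' [gr' nu]]]|nu]; last by split=> //; exists r.
  by rewrite (value_at1_uniq aU gr gr' Ux).
have pq : prime_of_sections (pr @^-1` U) q.
  split.
  - by move=> g [].
  - move=> g g' [gU [r [[rU [h hU e]] nu]]] gg'; split.
      exact: secO_ext (aff_open aU') gU gg'.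
    by exists r; split=> //; split=> //; exists h => // z Uz; rewrite -gg' // e.
  - have z0 : secO U (fun=> 0) by move=> y _; exact: Oreg0.
    have -> : (fun x : Z => 0 : Ost x) = (fun z : Z => mst pr z 0).
      by apply: functional_extensionality_dep => z; rewrite rmorph0.
    apply/(qE _ _ (pr_sec z0) (value_at1_pull z0)); by rewrite unitr0.
  - move=> g g' [gU [r [gr nu]]] [g'U [r' [gr' nu']]].
    apply/(qE _ _ _ (value_at1D gr gr')); last exact: nonunitD.
    by move=> z Uz; apply: OregD; [exact: gU|exact: g'U].
  - move=> g g' gU [g'U [r' [gr' nu']]]; have [r gr] := value_at1_ex aU gU.
    apply/(qE _ _ _ (value_at1M g'U gr gr')); last by rewrite unitrM negb_and nu' orbT.
    by move=> z Uz; apply: OregM; [exact: gU|exact: g'U].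
  - have z1 : secO U (fun=> 1) by move=> y _; exact: Oreg1.
    have -> : (fun x : Z => 1 : Ost x) = (fun z : Z => mst pr z 1).
      by apply: functional_extensionality_dep => z; rewrite rmorph1.
    move/(qE _ _ (pr_sec z1) (value_at1_pull z1)); by rewrite unitr1.
  - move=> g g' gU g'U; have [r gr] := value_at1_ex aU gU.
    have [r' gr'] := value_at1_ex aU g'U.
    have ggU : secO (pr @^-1` U) (fun z => g z * g' z).
      by move=> z Uz; apply: OregM; [exact: gU|exact: g'U].
    move/(qE _ _ ggU (value_at1M g'U gr gr')); rewrite unitrM negb_and => /orP[nu|nu].
      by left; apply/(qE _ _ gU gr).
    by right; apply/(qE _ _ g'U gr').
have [z Uz zq] := aff_surj aU' pq; exists z; split.
  apply: (aff_inj aU) => // f fU.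
  rewrite -(mst_unit (f := pr)); apply: negb_inj; apply/idP/idP.
    by move/(zq _ (pr_sec fU))/(qE _ _ (pr_sec fU) (value_at1_pull fU)).
  by move=> nu; apply/(zq _ (pr_sec fU))/(qE _ _ (pr_sec fU) (value_at1_pull fU)).
have vU : secO (pr @^-1` U) (fun z => v z - 1).
  by move=> y _; apply: OregB; [exact: acoord_reg|exact: Oreg1].
apply/(zq _ vU)/(qE _ (fun=> 0) vU); last by rewrite unitr0.
split; first by move=> y _; exact: Oreg0.
exists (fun=> 1); first by move=> y _; exact: Oreg1.
by move=> y _; rewrite rmorph0 subr0 mulr1.
Qed.

Definition sec1 x : Z := sval (cid (unit_section_point x)).

Lemma pr_sec1 x : pr (sec1 x) = x.
Proof. by case: (svalP (cid (unit_section_point x))). Qed.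

Lemma acoord_sec1 x : v (sec1 x) - 1 \isn't a GRing.unit.
Proof. by case: (svalP (cid (unit_section_point x))). Qed.

(** Where [v - 1] is not invertible, a function is invertible exactly when its value at 1 is
    invertible at the image in [X], so the image determines the point. *)
Lemma sec1_uniq z : v z - 1 \isn't a GRing.unit -> z = sec1 (pr z).
Proof.
move=> nv; have [U aU Uz] := sch_affine (pr z).
apply: (aff_inj (@apr_affine _ _ Z _ aU)) => //; first by rewrite /= pr_sec1.
move=> g gU; have [r gr] := value_at1_ex aU gU.
rewrite (value_at1_unit gr Uz nv) (value_at1_unit gr _ (acoord_sec1 _)) ?pr_sec1 //.
Qed.

Definition congr1 z (a : Ost z) f := exists b, a - mst pr z (f (pr z)) = (v z - 1) * b.

(** Clearing denominators turns the congruence of germs into [H' * (H * F + (v - 1) * (K * G)) = 0]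
    over the whole chart, with [F], [G] pulled back from [X]. Taking values at [v = 1] gives
    [h * F = 0] over [U], where the value [h] of [H' * H] is invertible at [x]. *)
Lemma congr1_eq0 x f : Oreg x f -> congr1 (0 : Ost (sec1 x)) f -> f x = 0.
Proof.
move=> fx [b eb]; set z := sec1 x in b eb.
have pz : pr z = x by exact: pr_sec1.
have nv : v z - 1 \isn't a GRing.unit by exact: acoord_sec1.
have [U aU Ux] := sch_affine x; have aU' := @apr_affine _ _ Z _ aU.
have Uz : U (pr z) by rewrite pz.
have [F [G [FU GU Gx e]]] := aff_frac aU (f x) Ux.
have [K [H [KU HU Hz eK]]] := aff_frac aU' b Uz.
have eF : mst pr z (f (pr z)) * mst pr z (G (pr z)) = mst pr z (F (pr z)).
  by rewrite -rmorphM; congr (mst pr z _); rewrite pz.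
have vU : secO (pr @^-1` U) (fun z => v z - 1).
  by move=> y _; apply: OregB; [exact: acoord_reg|exact: Oreg1].
pose Q z := H z * mst pr z (F (pr z)) + (v z - 1) * (K z * mst pr z (G (pr z))).
have QU : secO (pr @^-1` U) Q.
  move=> y Uy; apply: OregD; apply: OregM; first exact: HU.
  - exact: pr_sec FU _ Uy.
  - exact: vU.
  - by apply: OregM; [exact: KU|exact: pr_sec GU _ Uy].
have Q0 : Q z = 0.
  rewrite /Q -eF -eK.
  have -> : mst pr z (f (pr z)) = - ((v z - 1) * b) by rewrite -eb; ring.
  by ring.
have [H' [H'U H'z H'Q]] := aff_ker aU' Uz QU Q0.
have HHU : secO (pr @^-1` U) (fun z => H' z * H z).
  by move=> y Uy; apply: OregM; [exact: H'U|exact: HU].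
have [h [hU [h' h'U eh]]] := value_at1_ex aU HHU.
have hz : h (pr z) \is a GRing.unit.
  rewrite -(value_at1_unit (conj hU (ex_intro2 _ _ h' h'U eh)) Uz nv).
  by rewrite unitrM H'z.
have hx : h x \is a GRing.unit by rewrite pz in hz.
have key := @value_at1_eq0 U (fun x => h x * F x)
  (fun z => - (H' z * (K z * mst pr z (G (pr z)))) - h' z * mst pr z (F (pr z))) aU.
have hF0 : h x * F x = 0.
  apply: key => //.
  - by move=> y Uy; apply: OregM; [exact: hU|exact: FU].
  - move=> y Uy; apply: OregB.
      apply: (@regN _ _ _ (Osheaf Z) y (fun z => H' z * (K z * mst pr z (G (pr z))))).
      apply: OregM; first exact: H'U.
      by apply: OregM; [exact: KU|exact: pr_sec GU _ Uy].
    by apply: OregM; [exact: h'U|exact: pr_sec FU _ Uy].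
  - move=> y Uy; rewrite rmorphM.
    have -> : mst pr y (h (pr y)) = H' y * H y - (v y - 1) * h' y by rewrite -eh //; ring.
    have := H'Q y Uy; rewrite /Q mulrDr => /eqP; rewrite addr_eq0 => /eqP E.
    have -> : (H' y * H y - (v y - 1) * h' y) * mst pr y (F (pr y)) =
      H' y * (H y * mst pr y (F (pr y))) - (v y - 1) * h' y * mst pr y (F (pr y)) by ring.
    by rewrite E; ring.
apply: (mulIr Gx); rewrite mul0r e.
exact: stalk_neq0 hx hF0.
Qed.

Let vreg x : Oreg (sec1 x) (fun z => v z - 1).
Proof. by apply: OregB; [exact: acoord_reg|exact: Oreg1]. Qed.

Let pullreg x f : Oreg x f -> Oreg (sec1 x) (fun z => mst pr z (f (pr z))).
Proof. by move=> fx; apply: (@m_reg _ _ _ pr (sec1 x) f); rewrite pr_sec1. Qed.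

Lemma congr1B z (a b : Ost z) f g : congr1 a f -> congr1 b g ->
  congr1 (a - b) (fun x => f x - g x).
Proof.
by move=> [c ec] [d ed]; exists (c - d); rewrite mulrBr -ec -ed rmorphB; ring.
Qed.

Lemma congr1M z (a b : Ost z) f g : congr1 a f -> congr1 b g ->
  congr1 (a * b) (fun x => f x * g x).
Proof.
move=> [c ec] [d ed]; exists (c * b + mst pr z (f (pr z)) * d).
by rewrite mulrDr mulrA -ec mulrCA -ed rmorphM; ring.
Qed.

Lemma congr1_unit x (a : Ost (sec1 x)) f : congr1 a f ->
  (f x \is a GRing.unit) -> a \is a GRing.unit.
Proof.
move=> [b eb] fu.
have u : mst pr (sec1 x) (f (pr (sec1 x))) \is a GRing.unit.
  by rewrite mst_unit pr_sec1.
have : a + - ((v (sec1 x) - 1) * b) \is a GRing.unit by rewrite -eb opprB addrCA subrr addr0.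
case/local_unitD => //; rewrite unitrN unitrM => /andP[+ _].
by rewrite (negbTE (acoord_sec1 x)).
Qed.

Definition sec1_rel x (a : Ost (sec1 x)) (r : Ost x) :=
  exists f, [/\ Oreg x f, f x = r & congr1 a f].

Lemma sec1_rel_total x (a : Ost (sec1 x)) : exists r : Ost x, sec1_rel a r.
Proof.
have [U aU Ux] := sch_affine x; have aU' := @apr_affine _ _ Z _ aU.
have Uz : U (pr (sec1 x)) by rewrite pr_sec1.
have [F [G [FU GU Gz e]]] := aff_frac aU' a Uz.
have [f Ff] := value_at1_ex aU FU; have [g Gg] := value_at1_ex aU GU.
have nv := acoord_sec1 x.
have gz : g (pr (sec1 x)) \is a GRing.unit by rewrite -(value_at1_unit Gg Uz nv).
have gx : g x \is a GRing.unit by rewrite pr_sec1 in gz.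
have [fU [F' _ eF]] := Ff; have [gU [G' _ eG]] := Gg.
exists (f x / g x), (fun y => f y / g y); split=> //.
  by apply: OregM; [exact: fU|apply: OregV => //; exact: gU].
have {}eF := eF _ Uz; have {}eG := eG _ Uz; move: eF eG e Gz gz.
set z := sec1 x; set F0 := mst pr z (f (pr z)).
move=> eF eG e Gz gz.
pose g0 := mst pr z (g (pr z)).
have ug0 : g0 \is a GRing.unit by rewrite mst_unit.
(* This is the difference of the fractions [F / G] and [F0 / g0] with a factor [v - 1] removed. *)
exists ((F' z * g0 - F0 * G' z) / (G z * g0)).
rewrite rmorphM rmorphV // -/F0 -/g0.
have u : G z * g0 \is a GRing.unit by rewrite unitrM Gz.
apply: (mulIr u); rewrite mulrA divrK // mulrBl.
have -> : F0 / g0 * (G z * g0) = F0 * G z by rewrite [G z * g0]mulrC mulrA divrK.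
have -> : a * (G z * g0) = (F z) * g0 by rewrite mulrA e.
have EF : F z = F0 + (v z - 1) * F' z by rewrite -eF addrC subrK.
have EG : G z = g0 + (v z - 1) * G' z by rewrite -eG addrC subrK.
by rewrite EF EG; ring.
Qed.

Lemma sec1_rel_fun x (a : Ost (sec1 x)) (r r' : Ost x) : sec1_rel a r -> sec1_rel a r' -> r = r'.
Proof.
move=> [f [fx <- cf]] [g [gx <- cg]]; apply/eqP; rewrite -subr_eq0; apply/eqP.
apply: (@congr1_eq0 x (fun x => f x - g x)); first exact: OregB.
by have := congr1B cf cg; rewrite subrr.
Qed.

Lemma sec1_relB x (a b : Ost (sec1 x)) (r s : Ost x) : sec1_rel a r -> sec1_rel b s ->
  sec1_rel (a - b) (r - s).
Proof.
move=> [f [fx <- cf]] [g [gx <- cg]]; exists (fun x => f x - g x); split=> //.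
  exact: OregB.
exact: congr1B.
Qed.

Lemma sec1_relM x (a b : Ost (sec1 x)) (r s : Ost x) : sec1_rel a r -> sec1_rel b s ->
  sec1_rel (a * b) (r * s).
Proof.
move=> [f [fx <- cf]] [g [gx <- cg]]; exists (fun x => f x * g x); split=> //.
  exact: OregM.
exact: congr1M.
Qed.

Lemma sec1_rel_pull x f : Oreg x f -> sec1_rel (mst pr (sec1 x) (f (pr (sec1 x)))) (f x).
Proof. by move=> fx; exists f; split=> //; exists 0; rewrite subrr mulr0. Qed.

Lemma sec1_rel1 x : sec1_rel (1 : Ost (sec1 x)) 1.
Proof. by have := sec1_rel_pull (Oreg1 x); rewrite rmorph1. Qed.

Definition sec1_st x : {rmorphism Ost (sec1 x) -> Ost x} :=
  sval (rel_rmorphism (@sec1_rel_total x) (@sec1_rel_fun x) (@sec1_relB x)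
    (@sec1_relM x) (sec1_rel1 x)).

Lemma sec1_stP x a : sec1_rel a (sec1_st x a).
Proof. by rewrite /sec1_st; case: rel_rmorphism => f fP; exact: fP. Qed.

Lemma sec1_stE x a (r : Ost x) : sec1_rel a r -> sec1_st x a = r.
Proof. exact: sec1_rel_fun (sec1_stP a). Qed.

Lemma sec1_continuous : continuous sec1.
Proof.
move=> x V; rewrite nbhsE => -[V' [oV' V'z] V'V].
have [U aU Ux] := sch_affine x; have aU' := @apr_affine _ _ Z _ aU.
have Uz : U (pr (sec1 x)) by rewrite pr_sec1.
have [G GU [Gz GV]] := aff_basis aU' Uz oV' V'z.
have [g Gg] := value_at1_ex aU GU.
have gx : g x \is a GRing.unit.
  by move: Gz; rewrite (value_at1_unit Gg Uz (acoord_sec1 x)) pr_sec1.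
have [gU _] := Gg.
have nU := open_nbhs_nbhs (conj (aff_open aU) Ux).
have ng := unit_near (gU x Ux) gx.
suff : \forall y \near x, V (sec1 y) by [].
move: nU ng; apply: filterS2 => y Uy gy; apply/V'V/GV; first by rewrite /= pr_sec1.
by rewrite (value_at1_unit Gg _ (acoord_sec1 y)) pr_sec1.
Qed.

Lemma sec1_m_local x (a : Ost (sec1 x)) : sec1_st x a \is a GRing.unit -> a \is a GRing.unit.
Proof. by have [f [_ <- cf]] := sec1_stP a; exact: congr1_unit cf. Qed.

Lemma sec1_m_reg x (g : forall z, Ost z) : Oreg (sec1 x) g ->
  Oreg x (fun y => sec1_st y (g (sec1 y))).
Proof.
move=> gz; have [f [fx _ [b eb]]] := sec1_stP (g (sec1 x)).
have [b' [breg bE]] := Oreg_germ b.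
have n1 : \forall z \near sec1 x, g z - mst pr z (f (pr z)) = (v z - 1) * b' z.
  apply: Oreg_eq; last by rewrite bE.
    by apply: OregB => //; exact: pullreg.
  exact: OregM (vreg x) breg.
have n2 := Oreg_near fx.
apply: (Oreg_ext fx); have n1' : \forall y \near x, g (sec1 y) -
    mst pr (sec1 y) (f (pr (sec1 y))) = (v (sec1 y) - 1) * b' (sec1 y).
  exact: (sec1_continuous n1).
move: n1' n2; apply: filterS2 => y e fy; apply/esym/sec1_stE.
by exists f; split=> //; exists (b' (sec1 y)).
Qed.

Lemma sec1_m_str x a : sec1_st x (str (sec1 x) a) = str x a.
Proof.
have := sec1_stE (sec1_rel_pull (str_reg x a)).
by rewrite m_str.
Qed.

Definition unit_section : mor X Z :=
  Build_mor sec1_continuous sec1_m_local sec1_m_reg sec1_m_str.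

(* The argument is a family because [pr (unit_section x)] is only provably equal
   to [x]. *)
Lemma unit_sectionK x f : Oreg x f ->
  mst unit_section x (mst pr (unit_section x) (f (pr (unit_section x)))) = f x.
Proof. by move=> fx; exact: sec1_stE (sec1_rel_pull fx). Qed.

Lemma unit_section_coord x : mst unit_section x (v (unit_section x)) = 1.
Proof.
apply: sec1_stE; exists (fun=> 1); split=> //; first exact: Oreg1.
by exists 1; rewrite rmorph1 mulr1.
Qed.

Lemma unit_section_ker x (a : Ost (unit_section x)) :
  mst unit_section x a = 0 <-> exists c, a = c * (v (unit_section x) - 1).
Proof.
split=> [a0|[c ->]]; last first.
  by rewrite rmorphM rmorphB rmorph1 unit_section_coord subrr mulr0.
have [f [fx fE [b eb]]] := sec1_stP a.
have f0 : f x = 0 by rewrite fE.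
have pf0 : mst pr (sec1 x) (f (pr (sec1 x))) = 0.
  by apply/eqP; rewrite [f _](_ : _ = 0) ?rmorph0 // pr_sec1.
by exists b; rewrite mulrC -eb pf0 subr0.
Qed.

Lemma unit_section_surj x (r : Ost x) : exists a, mst unit_section x a = r.
Proof.
have [f [fx <-]] := Oreg_germ r; eexists; exact: unit_sectionK fx.
Qed.

End UnitSection.

(** * Morphisms of Proj induced by surjections *)

Lemma pr_hc (A : comNzRingType) (R : gralg A) (q : R -> Prop) a i :
  proj_prime q -> q a -> q (hc a i).
Proof.
move=> pq /(pr_hom pq) [n [c [h e]]].
rewrite (hc_uniq i (fun i => (h i).1) e); case: ifP => _; first by case: (h i).
exact: (pr_0 pq).
Qed.

Section ProjMorphism.
Variables (A : comNzRingType) (R R' : gralg A) (P P' : ascheme A).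
Variables (HP : is_proj R P) (HP' : is_proj R' P') (q : {rmorphism R -> R'}).
Hypothesis q_deg : forall n a, deg n a -> deg n (q a).
Hypothesis q_surj : forall n b, deg n b -> exists2 a, deg n a & q a = b.
Hypothesis q_str : forall a, q (gstr R a) = gstr R' a.
Implicit Types (x : P') (y : P) (a b c : R).
Local Notation pP := (pt_prime HP).
Local Notation pP' := (pt_prime HP').

Lemma preim_proj_prime x : proj_prime (fun a => pP' x (q a)).
Proof.
have px := pt_primeP HP' x; split.
- by rewrite rmorph0; exact: (pr_0 px).
- by move=> a b; rewrite rmorphD; exact: (prD px).
- by move=> a b; rewrite rmorphM; exact: (prM px).
- by rewrite rmorph1; exact: (pr_1 px).
- by move=> a b; rewrite rmorphM => /(pr_prime px).
- move=> a qa; have [n hn] := hc_sum a; have [_ e] := hn n (leqnn n).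
  exists n, (hc a); split=> // i; split; first exact: hc_deg.
  have eq1 : q a = \sum_(j < n) q (hc a j) by rewrite [in LHS]e rmorph_sum.
  have := pr_hc i px qa.
  rewrite (hc_uniq i (fun i => q_deg (hc_deg a i)) eq1); case: ltnP => // ni _.
  by rewrite (hn i ni).1 rmorph0; exact: (pr_0 px).
(* Surjectivity in each degree keeps the preimage from containing all elements of positive
   degree. *)
- have [n [b [n0 /q_surj [a da <-] qb]]] := pr_irr px; by exists n, a.
Qed.

Definition proj_point x : P := sval (cid (pt_surj HP (preim_proj_prime x))).

Lemma proj_pointP x a : pP (proj_point x) a <-> pP' x (q a).
Proof. exact: (svalP (cid (pt_surj HP (preim_proj_prime x)))). Qed.

Let notP x a : ~ pP (proj_point x) a -> ~ pP' x (q a).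
Proof. by move=> h /proj_pointP. Qed.

Definition proj_rel x (u : Ost (proj_point x)) (r : Ost x) := exists n a b,
  [/\ deg n a, deg n b, ~ pP (proj_point x) b, u = fr HP (proj_point x) a b &
      r = fr HP' x (q a) (q b)].

Lemma proj_rel_total x (u : Ost (proj_point x)) : exists r, proj_rel u r.
Proof.
have [n [a [b [da db nb e]]]] := fr_surj_ HP u.
by exists (fr HP' x (q a) (q b)), n, a, b.
Qed.

Lemma proj_rel_fun x (u : Ost (proj_point x)) r r' : proj_rel u r -> proj_rel u r' -> r = r'.
Proof.
move=> [n [a [b [da db nb -> ->]]]] [m [c [d [dc dd nd e ->]]]].
have /(fr_eqP da db nb dc dd nd) [l [f [df nf E]]] := e.
apply/(fr_eqP (q_deg da) (q_deg db) (notP nb) (q_deg dc) (q_deg dd) (notP nd)).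
exists l, (q f); split; [exact: q_deg|exact: notP|].
by rewrite -!rmorphM -rmorphB -rmorphM E rmorph0.
Qed.

Lemma frB_ (B : gralg A) (Q : ascheme A) (HQ : is_proj B Q) (z : Q) (a b c d : B) n m :
  deg n a -> deg n b -> ~ pt_prime HQ z b -> deg m c -> deg m d -> ~ pt_prime HQ z d ->
  fr HQ z a b - fr HQ z c d = fr HQ z (a * d - c * b) (b * d).
Proof.
move=> da db nb dc dd nd.
have dad : deg (n + m) (a * d) by exact: degM.
have dcb : deg (n + m) (c * b) by rewrite addnC; exact: degM.
have dbd : deg (n + m) (b * d) by exact: degM.
have nbd : ~ pt_prime HQ z (b * d) by exact: pr_notM.
have e : fr HQ z (a * d - c * b) (b * d) + fr HQ z c d = fr HQ z a b.
  have -> : fr HQ z c d = fr HQ z (c * b) (b * d).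
    by rewrite [b * d]mulrC (frMcancel dc dd nd db nb).
  by rewrite (frD_ (degB dad dcb) dcb dbd nbd) subrK (frMcancel da db nb dd nd).
by rewrite -e addrK.
Qed.

Lemma proj_relB x (u v : Ost (proj_point x)) r s : proj_rel u r -> proj_rel v s ->
  proj_rel (u - v) (r - s).
Proof.
move=> [n [a [b [da db nb -> ->]]]] [m [c [d [dc dd nd -> ->]]]].
exists (n + m)%N, (a * d - c * b), (b * d); split.
- by apply: degB; [exact: degM|rewrite addnC; exact: degM].
- exact: degM.
- exact: pr_notM.
- exact: (frB_ da db nb dc dd nd).
- rewrite (frB_ (q_deg da) (q_deg db) (notP nb) (q_deg dc) (q_deg dd) (notP nd)).
  by rewrite rmorphB !rmorphM.
Qed.

Lemma proj_relM x (u v : Ost (proj_point x)) r s : proj_rel u r -> proj_rel v s ->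
  proj_rel (u * v) (r * s).
Proof.
move=> [n [a [b [da db nb -> ->]]]] [m [c [d [dc dd nd -> ->]]]].
exists (n + m)%N, (a * c), (b * d); split.
- exact: degM.
- exact: degM.
- exact: pr_notM.
- exact: (frM_ da db nb dc dd nd).
- rewrite (frM_ (q_deg da) (q_deg db) (notP nb) (q_deg dc) (q_deg dd) (notP nd)).
  by rewrite !rmorphM.
Qed.

Lemma proj_rel1 x : proj_rel (1 : Ost (proj_point x)) 1.
Proof.
exists 0%N, 1, 1; split; rewrite ?rmorph1 ?fr11 //; try exact: deg1.
exact: pr_not1.
Qed.

Definition proj_st x : {rmorphism Ost (proj_point x) -> Ost x} :=
  sval (rel_rmorphism (@proj_rel_total x) (@proj_rel_fun x) (@proj_relB x)
    (@proj_relM x) (proj_rel1 x)).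

Lemma proj_stP x u : proj_rel u (proj_st x u).
Proof. by rewrite /proj_st; case: rel_rmorphism => f fP; exact: fP. Qed.

Lemma proj_st_fr x n a b : deg n a -> deg n b -> ~ pP (proj_point x) b ->
  proj_st x (fr HP (proj_point x) a b) = fr HP' x (q a) (q b).
Proof.
by move=> da db nb; apply: proj_rel_fun (proj_stP _) _; exists n, a, b.
Qed.

Lemma proj_continuous : continuous proj_point.
Proof.
move=> x V Vx; have [n [a [n0 da qa aV]]] := pr_basis HP Vx.
suff : \forall y \near x, V (proj_point y) by [].
apply: filterS (pr_near (q_deg da) (notP qa)) => y nqa; apply: aV.
by move=> /proj_pointP.
Qed.

Lemma proj_m_local x u : proj_st x u \is a GRing.unit -> u \is a GRing.unit.
Proof.
have [n [a [b [da db nb -> ->]]]] := proj_stP u.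
move=> /(fr_unit (q_deg da) (q_deg db) (notP nb)) nqa.
by apply/(fr_unit da db nb) => /proj_pointP.
Qed.

Lemma proj_m_reg x (g : forall y, Ost y) : Oreg (proj_point x) g ->
  Oreg x (fun z => proj_st z (g (proj_point z))).
Proof.
move=> /(fr_reg HP) [a [b nab]]; apply/(fr_reg HP'); exists (q a), (q b).
have : \forall z \near x, frac_at (pP (proj_point z)) 0 a b /\
    g (proj_point z) = fr HP (proj_point z) a b by exact: (proj_continuous nab).
apply: filterS => z [[n [da db nb]] ->]; rewrite addn0 in da; split.
  by apply: (frac0 (k := n)); [exact: q_deg|exact: q_deg|exact: notP].
exact: proj_st_fr da db nb.
Qed.

Lemma proj_m_str x (a : A) : proj_st x (str (proj_point x) a) = str x a.
Proof.
rewrite -(fr_str HP) (proj_st_fr (deg_str _ a) (deg1 R)); last exact: pr_not1.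
by rewrite q_str rmorph1 fr_str.
Qed.

Definition proj_mor : mor P' P :=
  Build_mor proj_continuous proj_m_local proj_m_reg proj_m_str.

Lemma proj_morP : proj_map HP HP' q proj_mor.
Proof.
move=> x; split; first exact: proj_pointP.
move=> a b [n [da db nb]]; rewrite addn0 in da; exact: proj_st_fr da db nb.
Qed.

Lemma proj_mor_inj x x' : proj_mor x = proj_mor x' -> x = x'.
Proof.
move=> e; apply: (Defs.pt_inj (i := HP')).
have key n (b : R') : deg n b -> pP' x b <-> pP' x' b.
  by move=> /q_surj [a _ <-]; rewrite -!proj_pointP -[proj_point x]/(proj_mor x) e.
have sub (z z' : P') (b : R') : (forall n (b : R'), deg n b -> pP' z b -> pP' z' b) -> pP' z b -> pP' z' b.
  move=> h /(pr_hom (pt_primeP HP' z)) [n [c [hc ->]]].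
  elim/big_ind: _ => [||j _]; [exact: (pr_0 (pt_primeP HP' _))|exact: (prD (pt_primeP HP' _))|].
  by case: (hc j) => dj zj; exact: h dj zj.
by move=> b; split; apply: sub => n c dc; rewrite (key n c dc).
Qed.

Lemma proj_mor_surj x r : exists u, mst proj_mor x u = r.
Proof.
have [n [b [c [/q_surj [a da <-] /q_surj [d dd <-] nd ->]]]] := fr_surj_ HP' r.
exists (fr HP (proj_point x) a d); apply: proj_st_fr da dd _.
by move=> /proj_pointP.
Qed.

(** A prime that contains the homogeneous kernel does not distinguish homogeneous elements of the
    same degree and image ([kd]), so it descends degree by degree to a homogeneous prime of [R']. *)
Lemma proj_mor_image y : (forall n a, deg n a -> q a = 0 -> pP y a) ->
  exists x, proj_mor x = y.
Proof.
move=> ky; have py := pt_primeP HP y.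
have kd n a a' : deg n a -> deg n a' -> q a = q a' -> pP y a -> pP y a'.
  move=> da da' e ya; rewrite -[a'](subrK a) addrC; apply: (prD py) => //.
  by apply: (ky n); [exact: degB|rewrite rmorphB e subrr].
pose q0 n (b : R') := exists2 a, deg n a & q a = b /\ pP y a.
have hq0 : homog_prime q0.
  split.
  - by move=> n; exists 0; [exact: deg0|split; [rewrite rmorph0|exact: (pr_0 py)]].
  - move=> n _ _ _ _ [a da [<- ya]] [a' da' [<- ya']].
    by exists (a + a'); [exact: degD|rewrite rmorphD; split=> //; exact: (prD py)].
  - move=> m n _ _ /q_surj [a da <-] _ [a' da' [<- ya']].
    by exists (a * a'); [exact: degM|rewrite rmorphM; split=> //; exact: (prM py)].
  - move=> [a da [e ya]]; apply: (pr_1 py).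
    by apply: (kd 0%N a) => //; [exact: deg1|rewrite rmorph1].
  - move=> m n _ _ /q_surj [a da <-] /q_surj [b db <-] [c dc [e yc]].
    have : pP y (a * b).
      by apply: (kd _ _ _ dc) => //; [exact: degM|rewrite rmorphM].
    by case/(pr_prime py) => [ya|yb]; [left; exists a|right; exists b].
  - have [n [a [n0 da ya]]] := pr_irr py; exists n, (q a); split=> //; first exact: q_deg.
    by move=> [a' da' [e ya']]; apply: ya; exact: kd da' da e ya'.
have [x hx] := pt_surj HP' (homog_proj_prime hq0); exists x.
apply: (Defs.pt_inj (i := HP)).
have key n a : deg n a -> pP (proj_mor x) a <-> pP y a.
  move=> da; rewrite proj_pointP hx (homog_primeE hq0 (q_deg da)).
  by split=> [[a' da' [e ya']]|ya]; [exact: kd da' da e ya'|exists a].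
have sub (z z' : P) b : (forall n b, deg n b -> pP z b -> pP z' b) -> pP z b -> pP z' b.
  move=> h /(pr_hom (pt_primeP HP z)) [n [c [hc ->]]].
  elim/big_ind: _ => [||j _]; [exact: (pr_0 (pt_primeP HP _))|exact: (prD (pt_primeP HP _))|].
  by case: (hc j) => dj zj; exact: h dj zj.
by move=> b; split; apply: sub => n c dc; rewrite (key n c dc).
Qed.

(** The vanishing of [q a / q b] is witnessed by some [q e] outside the prime; expanding [a / b] by
    [e] brings the numerator into the kernel of [q]. *)
Lemma proj_mor_ker x u : mst proj_mor x u = 0 -> exists n a b,
  [/\ deg n a, deg n b, ~ pP (proj_mor x) b, u = fr HP (proj_mor x) a b & q a = 0].
Proof.
have [n [a [b [da db nb eu er]]]] := proj_stP u.
move=> u0; have : fr HP' x (q a) (q b) = 0 by rewrite -er; exact: u0.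
move=> /(fr_eq0 (q_deg da) (q_deg db) (notP nb)) [m [e' [/q_surj [e de <-] ne E]]].
have ne' : ~ pP (proj_mor x) e by move=> /proj_pointP.
exists (n + m)%N, (a * e), (b * e); split.
- exact: degM.
- exact: degM.
- exact: pr_notM.
- by rewrite (frMcancel da db nb de ne').
- by rewrite mulrC rmorphM.
Qed.

End ProjMorphism.

(** * The deformation *)

Section Deformation.
Variables (A : comNzRingType) (X Y : ascheme A) (L : modsheaf X).
Variables (T : tensor_algebra L) (S : section_ring T) (i : mor Y X).
Variable Df : deformation S i.
Local Notation I := (@ideal_of A X Y L T S i).
Local Notation D := (def_D Df).
Local Notation Z := (def_Z Df).
Local Notation W := (def_W Df).
Local Notation R := (def_rees Df).
Local Notation HW := (def_proj Df).
Local Notation j0 := (def_j0 Df).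
Local Notation jinf := (def_jinf Df).
Local Notation apr := (apr Z).
Local Notation qW := (pt_prime HW).
Local Notation tau := (tau R).
Local Notation qp := (pt_prime (pspaceP (def_P1 Df))).
Local Notation p := (def_p Df).
Implicit Types (x : X) (w : W) (d : D) (z : Z).

Lemma j0_inj z z' : j0 z = j0 z' -> z = z'.
Proof. by case: (def_j0_open Df) => h _ _; exact: h. Qed.

Lemma jinf_inj w w' : jinf w = jinf w' -> w = w'.
Proof. by case: (def_jinf_open Df) => h _ _; exact: h. Qed.

Lemma j0_st z : bijective (mst j0 z).
Proof. by case: (def_j0_open Df). Qed.

Lemma jinf_st w : bijective (mst jinf w).
Proof. by case: (def_jinf_open Df). Qed.

Lemma deg_u : deg 1 (uvar A). Proof. exact: deg_xvar. Qed.
Lemma deg_t : deg 1 (tvar A). Proof. exact: deg_xvar. Qed.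

Variables (N M : nat) (s : 'I_N.+1 -> forall x, L x) (t : 'I_M -> forall x, L x).
Variables (sg : 'I_N.+1 -> S) (tg : 'I_M -> S).
Hypotheses (s_reg : forall k x, Mreg x (s k)) (t_reg : forall k x, Mreg x (t k)).
Hypothesis sgE : forall k x, ev S x (sg k) = Tin T x (s k x).
Hypothesis tgE : forall k x, ev S x (tg k) = Tin T x (t k x).
Hypothesis IE : forall a, I a <-> exists c : 'I_M -> S, a = \sum_k c k * tg k.
Variables (PN : projspace A N) (psi : mor X PN).
Hypotheses (psi_ci : closed_immersion psi) (psi_ind : induced_by psi s).
Variables (PNM : projspace A (N + M)) (Phi : mor D PNM).
Variables (LZ : modsheaf Z) (hZ : forall z, L (apr z) -> LZ z).
Hypothesis pbZ : is_pullback hZ.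
Hypothesis Phi_ind : induced_by (compmor Phi j0)
    (fun (k : 'I_(N.+1 + M)) z =>
       match fintype.split k return LZ z with
       | inl k1 => hZ (s k1 (apr z))
       | inr k2 => acoord z *: hZ (t k2 (apr z))
       end).
Local Notation qP := (pt_prime (pspaceP PNM)).
Local Notation X_ k := (xvar A k).
Implicit Types (k l : 'I_(N.+1 + M)).

Lemma tg_deg (k : 'I_M) : deg 1 (tg k).
Proof. exact: (sec_deg1 (t_reg k) (tgE k)). Qed.

Lemma sg_deg' (k : 'I_N.+1) : deg 1 (sg k).
Proof. exact: (sec_deg1 (s_reg k) (sgE k)). Qed.

(** The sections [s_k] and [t_k] are treated together: coordinate [k] is [hsec k] times the power
    [hexp k] of [v] on the chart [Z], and [hel k] times the power [- hexp k] of [tau] on the chart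
    [W]. *)
Let hsec k x : L x := match fintype.split k with inl k1 => s k1 x | inr k2 => t k2 x end.
Let hexp k : nat := match fintype.split k with inl _ => 0%N | inr _ => 1%N end.
Let hel k : S := match fintype.split k with inl k1 => sg k1 | inr k2 => tg k2 end.
Let SS k z : LZ z := match fintype.split k return LZ z with
       | inl k1 => hZ (s k1 (apr z))
       | inr k2 => acoord z *: hZ (t k2 (apr z))
       end.
Local Notation Xi := (xi tg R sg).

Let xiE k : Xi k = re R (hexp k) (hel k).
Proof. by rewrite /hexp /hel /xi; case: (fintype.split k). Qed.

Let SSE k z : SS k z = acoord z ^+ hexp k *: hZ (hsec k (apr z)).
Proof.
by rewrite /SS /hexp /hsec; case: (fintype.split k) => k'; rewrite ?expr0 ?expr1 ?scale1r.
Qed.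

Let hel_ev k x : ev S x (hel k) = Tin T x (hsec k x).
Proof. by rewrite /hel /hsec; case: (fintype.split k). Qed.

Let hel_deg k : deg 1 (hel k).
Proof. by rewrite /hel; case: (fintype.split k) => k'; [exact: sg_deg'|exact: tg_deg]. Qed.

Let hel_pow k : idpow I (hexp k) (hel k).
Proof. by rewrite /hel /hexp; case: (fintype.split k) => // k'; exact: (idpow1_tg IE). Qed.

Lemma tau_deg0 : deg 0 tau.
Proof. by apply: (re_degP IE) => //; exact: deg1. Qed.

Lemma xi_deg1 k : deg 1 (Xi k).
Proof. by rewrite xiE; apply: (re_degP IE). Qed.

Lemma xi_cover w : exists k, ~ qW w (Xi k).
Proof.
apply: (rees_cover IE) (pt_primeP HW w).
exact: (sec_radical psi_ci psi_ind sgE).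
Qed.

Lemma tau_unit w : (fr HW w tau 1 \is a GRing.unit) <-> ~ qW w tau.
Proof. exact: (fr_unit tau_deg0 (deg1 _) (@pr_not1 _ _ _ HW w)). Qed.

Lemma tau_stalk w (r : Ost w) : fr HW w tau 1 * r = 0 -> r = 0.
Proof.
have [k [a [b [da db qb ->]]]] := fr_surj_ HW r.
rewrite (frM_ tau_deg0 (deg1 _) (@pr_not1 _ _ _ HW w) da db qb) mul1r.
move=> /(fr_eq0 (degM tau_deg0 da) db qb) [n [e [de qe h]]].
apply/(fr_eq0 da db qb); exists n, e; split=> //.
by apply: (tau_reg IE); rewrite mulrCA.
Qed.

(* [tau] is a nonzerodivisor, so the locus where it is invertible is
   schematically dense in the chart at infinity. *)
Lemma tau_dense w (F : forall w, Ost w) : Oreg w F ->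
  (\forall y \near w, ~ qW y tau -> F y = 0) -> F w = 0.
Proof.
move=> Fw F0.
have hw : Oreg w (fun y => fr HW y tau 1).
  exact: (fr_Oreg tau_deg0 (deg1 _) (@pr_not1 _ _ _ HW w)).
have [|m km] := kill_local hw Fw; first by apply: filterS F0 => y h /tau_unit.
have := nbhs_singleton km; elim: m {km} => [|m IH]; first by rewrite mul1r.
by rewrite exprS -mulrA => /tau_stalk.
Qed.

Let isgenZu (Q : comUnitRingType) (V : lmodType Q) (r : Q) (e : V) :
  r \is a GRing.unit -> (isgen (r *: e) <-> isgen e).
Proof.
move=> u; split=> g; last by apply/isgenZ.
rewrite -[e]scale1r -(mulVr u) -scalerA; apply/isgenZ => //; by rewrite unitrV.
Qed.

Lemma overlap_acoord z w : j0 z = jinf w -> acoord z \is a GRing.unit.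
Proof. by move=> e; apply/def_ovl0; exists w. Qed.

Lemma overlap_tau z w : j0 z = jinf w -> ~ qW w tau.
Proof. by move=> e; apply/def_ovlinf; exists z. Qed.

Let L_gen x : exists2 e : L x, isgen e & True.
Proof. by have [k gk] := ind_cover psi_ind x; exists (s k x). Qed.

Let SS_gen k z : acoord z \is a GRing.unit -> isgen (SS k z) <-> isgen (hsec k (apr z)).
Proof.
move=> u; have [e ge _] := L_gen (apr z).
by rewrite SSE isgenZu ?unitrX // (pullback_genP pbZ _ ge).
Qed.

Lemma tauX_re (l : nat) a : idpow I l a -> tau ^+ l * re R l a = re R 0 a.
Proof.
elim: l a => [|l IH] a ia; first by rewrite mul1r.
rewrite exprSr -mulrA tau_re // (_ : l.+1%:Z - 1 = l%:Z); last by lia.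
by apply: IH; exact: (idpow_dec IE (leqnSn l)).
Qed.

Let overlap_hel k z w : j0 z = jinf w -> ~ qW w (re R 0 (hel k)) <-> isgen (hsec k (apr z)).
Proof.
move=> e; have [e0 ge _] := L_gen (apr z).
by rewrite (def_ident_pt e (hel_deg k)) hel_ev (tgen1P _ _ ge).
Qed.

Lemma overlap_gen k z w : j0 z = jinf w -> isgen (SS k z) <-> ~ qW w (Xi k).
Proof.
move=> e; rewrite SS_gen; last exact: overlap_acoord e.
rewrite -(overlap_hel k e) -(tauX_re (hel_pow k)) xiE; split; first exact: pr_notM_r.
by apply: pr_notM; apply: pr_notX; exact: overlap_tau e.
Qed.

Let rho l k : forall d, Ost d := fun d => mst Phi d (fr (pspaceP PNM) (Phi d) (X_ l) (X_ k)).

Let rho_reg l k d : ~ qP (Phi d) (X_ k) -> Oreg d (rho l k).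
Proof. by move=> qk; exact: (m_reg (m := Phi) (fr_Oreg (deg_xvar A l) (deg_xvar A k) qk)). Qed.

Lemma overlap_coord k z w : j0 z = jinf w -> ~ qP (Phi (jinf w)) (X_ k) <-> ~ qW w (Xi k).
Proof.
by move=> e; rewrite -(overlap_gen k e) (ind_gen Phi_ind z k) /= e.
Qed.

(** On the overlap both sides are the function [c * v ^ n], with [c] the ratio of the two sections
    on [X]: the left one by the formula for [Phi] on [Z], the right one by [def_ident]. *)
Lemma overlap_ratio l k z w : j0 z = jinf w -> ~ qW w (Xi k) ->
  mst jinf w (rho l k (jinf w)) = fr HW w (Xi l) (Xi k).
Proof.
move=> e qk.
have gk : isgen (hsec k (apr z)).
  by apply/(SS_gen k (overlap_acoord e))/(overlap_gen k e).
have q0k : ~ qW w (re R 0 (hel k)) by apply/(overlap_hel k e).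
have qXk : ~ qP (Phi (j0 z)) (X_ k) by rewrite e; apply/(overlap_coord k e).
have u := overlap_acoord e.
have [c [ce _]] := gk (hsec l (apr z)).
(* [def_ident] takes denominators of index 0, so the whole power of [tau] in [Xi l / Xi k] is moved
   to the numerator. The exponent [n] can be [-1], where [idpowz] imposes nothing. *)
pose n : int := (hexp l)%:Z - (hexp k)%:Z.
have inl : idpowz I n (hel l).
  by apply: (idpowz_dec IE (z := hexp l)); [rewrite /n; lia|exact: hel_pow].
have dl : deg 1 (re R n (hel l)) by exact: (re_degP IE).
have dk : deg 1 (re R 0 (hel k)) by exact: (re_degP IE).
(* The fraction is realised by a section [ze] of [D], the form in which [def_ident] compares the two
   charts. *)
have [v vE] : exists v, mst jinf w v = fr HW w (re R n (hel l)) (re R 0 (hel k)).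
  by case: (jinf_st w) => g _ gK; exists (g (fr HW w (re R n (hel l)) (re R 0 (hel k)))).
have [ze [zreg zE]] := Oreg_germ v.
have zreg' : Oreg (j0 z) ze by rewrite e.
have zval : mst jinf w (ze (jinf w)) = fr HW w (re R n (hel l)) (re R 0 (hel k)).
  by rewrite zE.
have tg1 : tgen 1 (ev S (apr z) (hel k)).
  by rewrite hel_ev; apply/(tgen1P T _ gk).
have evc : ev S (apr z) (hel l) = c *: ev S (apr z) (hel k).
  by rewrite !hel_ev ce linearZ.
have key := def_ident e inl (hel_deg l) (hel_deg k) tg1 evc zreg' zval.
have rz : rho l k (j0 z) = ze (j0 z).
  case: (j0_st z) => g gK _; apply: (can_inj gK); rewrite key.
  have := ind_ratio Phi_ind l (x := z) qXk.
  rewrite -/(SS l z) -/(SS k z) !SSE ce (pb_scale pbZ) !scalerA.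
  move=> /(isgen_inj (pullback_gen pbZ gk)) h.
  apply: (mulIr (unitrX (hexp k) u)); rewrite /rho -[LHS]h mulrC -mulrA; congr (_ * _).
  rewrite -[acoord z ^+ hexp k]/(acoord z ^ (hexp k)%:Z) -exprzDr //.
  by rewrite /n subrK.
have rw : rho l k (jinf w) = ze (jinf w) by rewrite -e.
rewrite rw zval.
apply: (fr_eqM dl dk q0k (xi_deg1 l) (xi_deg1 k) qk).
by rewrite !xiE !reM // /n addr0 subrK.
Qed.

(** Non-vanishing is not an identity between functions, so density is applied to a product: the
    ratio of [X_ l] to [X_ m] and that of [Xi m] to [Xi l] are mutually inverse where both are
    defined. Some [Xi l] and some [X_ m] do not vanish at the point, and invertibility of the ratios
    gives the two directions. *)
Lemma chart_coord k w : ~ qP (Phi (jinf w)) (X_ k) <-> ~ qW w (Xi k).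
Proof.
have main l m : ~ qP (Phi (jinf w)) (X_ m) -> ~ qW w (Xi l) ->
    mst jinf w (rho l m (jinf w)) * fr HW w (Xi m) (Xi l) = 1.
  move=> qm ql; apply/eqP; rewrite -subr_eq0; apply/eqP.
  apply: (@tau_dense w (fun y => mst jinf y (rho l m (jinf y)) * fr HW y (Xi m) (Xi l) - 1)).
    apply: OregB; last exact: Oreg1.
    apply: OregM; first exact: (m_reg (m := jinf) (rho_reg l qm)).
    exact: fr_Oreg (xi_deg1 m) (xi_deg1 l) ql.
  have nm := near_mor (near_mor (pr_near (deg_xvar A m) qm)).
  have nl := pr_near (xi_deg1 l) ql.
  near=> y; move=> qt.
  have qmy : ~ qP (Phi (jinf y)) (X_ m) by near: y.
  have qly : ~ qW y (Xi l) by near: y.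
  have [z e] := (@def_ovlinf _ _ _ _ _ _ _ Df y).2 qt.
  have qmy' := (overlap_coord m e).1 qmy.
  rewrite (overlap_ratio l e qmy').
  rewrite (frM_ (xi_deg1 l) (xi_deg1 m) qmy' (xi_deg1 m) (xi_deg1 l) qly) mulrC.
  by rewrite (frvv (degM (xi_deg1 m) (xi_deg1 l)) (pr_notM qmy' qly)) subrr.
split=> qk.
  have [l ql] := xi_cover w; have := main l k qk ql => h.
  apply/(fr_unit (xi_deg1 k) (xi_deg1 l) ql); apply/unitrPr.
  by exists (mst jinf w (rho l k (jinf w))); rewrite mulrC.
have [m qm] := ind_coord Phi (jinf w); have h := main k m qm qk.
apply/(fr_unit (deg_xvar A k) (deg_xvar A m) qm).
rewrite -(mst_unit (f := Phi)) -(mst_unit (f := jinf)); apply/unitrPr.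
by exists (fr HW w (Xi m) (Xi k)).
Unshelve. all: by end_near. Qed.

Lemma chart_ratio l k w : ~ qW w (Xi k) ->
  mst jinf w (mst Phi (jinf w) (fr (pspaceP PNM) (Phi (jinf w)) (X_ l) (X_ k))) =
  fr HW w (Xi l) (Xi k).
Proof.
move=> qk; have qm : ~ qP (Phi (jinf w)) (X_ k) by apply/chart_coord.
apply/eqP; rewrite -subr_eq0; apply/eqP.
apply: (@tau_dense w (fun y => mst jinf y (rho l k (jinf y)) - fr HW y (Xi l) (Xi k))).
  apply: OregB; first exact: (m_reg (m := jinf) (rho_reg l qm)).
  exact: fr_Oreg (xi_deg1 l) (xi_deg1 k) qk.
apply: filterS (pr_near (xi_deg1 k) qk) => y qky /def_ovlinf [z e].
by rewrite (overlap_ratio l e qky) subrr.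
Qed.

Lemma chart0_coord (k : 'I_N.+1) z :
  isgen (s k (apr z)) -> ~ qP (Phi (j0 z)) (X_ (lshift M k)).
Proof.
move=> gk; apply/(ind_gen Phi_ind z); rewrite (unsplitK (inl k)).
exact: (pullback_gen pbZ gk).
Qed.

Lemma chart0_coordE (k : 'I_N.+1) z :
  ~ qP (Phi (j0 z)) (X_ (lshift M k)) <-> isgen (s k (apr z)).
Proof.
split; last exact: chart0_coord.
have [e ge _] := L_gen (apr z).
move=> /(ind_gen Phi_ind z); rewrite (unsplitK (inl k)).
by move=> /(pullback_genP pbZ _ ge).
Qed.

Lemma chart0_ratio (l k : 'I_N.+1) z c : isgen (s k (apr z)) ->
  s l (apr z) = c *: s k (apr z) ->
  mst j0 z (mst Phi (j0 z) (fr (pspaceP PNM) (Phi (j0 z)) (X_ (lshift M l)) (X_ (lshift M k)))) =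
  mst apr z c.
Proof.
move=> gk ce.
have := ind_ratio Phi_ind (lshift M l) (x := z) (chart0_coord gk).
rewrite (unsplitK (inl l)) (unsplitK (inl k)) ce (pb_scale pbZ).
by move=> /(isgen_inj (pullback_gen pbZ gk)) ->.
Qed.

(** On the chart at infinity [t / u] is [tau], so [t] is non-zero there exactly on the overlap with
    [Z]. *)
Lemma P1_t d : ~ qp (p d) (tvar A) <-> exists z, d = j0 z.
Proof.
split=> [qt|[z ->]]; last by case: (def_p0 z).
have [[z <-]|[w ew]] := def_cover d; first by exists z.
have [qu tauE] := @def_pinf _ _ _ _ _ _ _ Df w.
have qt' : ~ qp (p (jinf w)) (tvar A) by rewrite ew.
have : fr HW w tau 1 \is a GRing.unit.
  rewrite -tauE mst_unit; exact/(fr_unit deg_t deg_u qu).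
by move=> /tau_unit /def_ovlinf [z e]; exists z; rewrite e.
Qed.

Lemma P1_u d : ~ qp (p d) (uvar A) <-> exists w, d = jinf w.
Proof.
split=> [qu|[w ->]]; last by case: (def_pinf w).
have [[z ez]|[w <-]] := def_cover d; last by exists w.
have [qt vE] := @def_p0 _ _ _ _ _ _ _ Df z.
have qu' : ~ qp (p (j0 z)) (uvar A) by rewrite ez.
have : acoord z \is a GRing.unit.
  rewrite -vE mst_unit; exact/(fr_unit deg_u deg_t qt).
by move=> /def_ovl0 [w e]; exists w; rewrite -ez e.
Qed.


(** * Generators of L', the loci of its sections and ampleness *)

Variables (E1 E2 L' : modsheaf D).
Variables (h1 : forall d, pO1 PNM (Phi d) -> E1 d).
Variables (h2 : forall d, pO1 (def_P1 Df) (p d) -> E2 d).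
Variable b : forall d, E1 d -> E2 d -> L' d.
Hypotheses (pb1 : is_pullback h1) (pb2 : is_pullback h2) (tb : is_tensor b).
Implicit Types (g : mpoly_gralg A 2).

Let e1 k d := h1 (fr1 (pO1P PNM) (Phi d) (X_ k) 1).
Let e2 g d := h2 (fr1 (pO1P (def_P1 Df)) (p d) g 1).
Let eL k g d := b (e1 k d) (e2 g d).

Lemma eL_reg k g d : deg 1 g -> Mreg d (eL k g).
Proof.
move=> dg; apply: (ts_reg tb).
  exact: (pb_reg pb1 (fr1_Mreg (pO1P PNM) (Phi d) (deg_xvar A k))).
exact: (pb_reg pb2 (fr1_Mreg (pO1P (def_P1 Df)) (p d) dg)).
Qed.

Lemma eL_gen k g d : deg 1 g ->
  isgen (eL k g d) <-> ~ qP (Phi d) (X_ k) /\ ~ qp (p d) g.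
Proof.
move=> dg; have [l ql] := ind_coord Phi d; have [j qj] := ind_coord p d.
have g1 := fr1_gen (pO1P PNM) (deg_xvar A l) ql.
have g2 := fr1_gen (pO1P (def_P1 Df)) (deg_xvar A j) qj.
rewrite (tensor_genP tb _ _ (pullback_gen pb1 g1) (pullback_gen pb2 g2)).
rewrite (pullback_genP pb1 _ g1) (pullback_genP pb2 _ g2).
by rewrite (fr1_genP _ (deg_xvar A k) (deg_xvar A l) ql) (fr1_genP _ dg (deg_xvar A j) qj).
Qed.

Lemma eL_ratio l k g d : ~ qP (Phi d) (X_ k) ->
  eL l g d = mst Phi d (fr (pspaceP PNM) (Phi d) (X_ l) (X_ k)) *: eL k g d.
Proof.
move=> qk; rewrite /eL /e1 (fr1_ratio _ (deg_xvar A l) (deg_xvar A k) qk) (pb_scale pb1).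
by rewrite -[X in b _ X]scale1r (tensorZ tb) mulr1.
Qed.

Lemma chart_cases d :
  (exists z (k : 'I_N.+1), [/\ d = j0 z, isgen (s k (apr z)) & isgen (eL (lshift M k) (tvar A) d)]) \/
  (exists w k, [/\ d = jinf w, ~ qW w (Xi k) & isgen (eL k (uvar A) d)]).
Proof.
have [[z <-]|[w <-]] := def_cover d; [left|right].
  have [k gk] := ind_cover psi_ind (apr z); exists z, k; split=> //.
  apply/(eL_gen _ _ deg_t); split; first exact: chart0_coord.
  by apply/P1_t; exists z.
have [k qk] := xi_cover w; exists w, k; split=> //.
apply/(eL_gen _ _ deg_u); split; first exact/chart_coord.
by apply/P1_u; exists w.
Qed.

Lemma L'_line_bundle : line_bundle L'.
Proof.
move=> d; have [[z [k [-> _ /(eL_gen _ _ deg_t) [qk qt]]]]|[w [k [-> _ /(eL_gen _ _ deg_u) [qk qt]]]]] := chart_cases d.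
  exists (eL (lshift M k) (tvar A)); first exact: eL_reg deg_t.
  have n1 := near_mor (pr_near (deg_xvar A (lshift M k)) qk).
  have n2 := near_mor (pr_near deg_t qt).
  by move: n1 n2; apply: filterS2 => y q1 q2; apply/(eL_gen _ _ deg_t).
exists (eL k (uvar A)); first exact: eL_reg deg_u.
have n1 := near_mor (pr_near (deg_xvar A k) qk).
have n2 := near_mor (pr_near deg_u qt).
by move: n1 n2; apply: filterS2 => y q1 q2; apply/(eL_gen _ _ deg_u).
Qed.

Let locus0 (k : 'I_N.+1) := j0 @` (apr @^-1` [set x | ~ pt_prime (pspaceP PN) (psi x) (xvar A k)]).
Let locusinf k := jinf @` [set w | ~ qW w (Xi k)].

Lemma affine_locus0 (k : 'I_N.+1) : affine_open (locus0 k).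
Proof.
apply: (open_affine (def_j0_open Df)); apply: apr_affine.
exact: ci_affine psi_ci _ (deg_xvar A k).
Qed.

Lemma affine_locusinf k : affine_open (locusinf k).
Proof. by apply: (open_affine (def_jinf_open Df)); apply: proj_affine; exact: xi_deg1. Qed.

Lemma deformation_compact : compact [set: D].
Proof.
apply: (@compact_union _ ('I_N.+1 + 'I_(N.+1 + M))%type
  (fun c => match c with inl k1 => locus0 k1 | inr k2 => locusinf k2 end)).
  by case=> k; apply: affine_compact; [exact: affine_locus0|exact: affine_locusinf].
move=> d; have [[z [k [-> gk _]]]|[w [k [-> qk _]]]] := chart_cases d.
  by exists (inl k); exists z => //; apply/(ind_gen psi_ind).
by exists (inr k); exists w.
Qed.

Lemma locus0E (k : 'I_N.+1) : [set d | isgen (eL (lshift M k) (tvar A) d)] = locus0 k.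
Proof.
apply/seteqP; split=> d.
  move=> /(eL_gen _ _ deg_t) [qk /P1_t [z ez]]; subst d; exists z => //.
  by apply/(ind_gen psi_ind)/chart0_coordE.
move=> [z /(ind_gen psi_ind) gk <-]; apply/(eL_gen _ _ deg_t); split.
  exact: chart0_coord.
by apply/P1_t; exists z.
Qed.

Lemma locusinfE k : [set d | isgen (eL k (uvar A) d)] = locusinf k.
Proof.
apply/seteqP; split=> d.
  move=> /(eL_gen _ _ deg_u) [qk /P1_u [w ew]]; subst d; exists w => //.
  exact/chart_coord.
move=> [w qk <-]; apply/(eL_gen _ _ deg_u); split; first exact/chart_coord.
by apply/P1_u; exists w.
Qed.

Lemma deformation_ample (T' : tensor_algebra L') : ample T'.
Proof.
split; [exact: L'_line_bundle|exact: deformation_compact|].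
have treg1 k g d : deg 1 g -> treg 1 d (fun y => Tin T' y (eL k g y)).
  move=> dg; apply: (treg_ext (treg_pow T' 1 (eL_reg k d dg) (Oreg1 d))).
  by apply: nearW => y; rewrite scale1r expr1.
have tgE' (l : forall d, L' d) : [set y | tgen 1 (Tin T' y (l y))] = [set y | isgen (l y)].
  apply/seteqP; split=> y; have [e _ /nbhs_singleton ge] := L'_line_bundle y.
    by move/(tgen1P T' _ ge).
  by move=> gl; apply/(tgen1P T' _ ge).
have tgP (l : forall d, L' d) d : tgen 1 (Tin T' d (l d)) <-> isgen (l d).
  by have [e _ /nbhs_singleton ge] := L'_line_bundle d; exact: tgen1P.
move=> d; have [[z [k [_ _ gk]]]|[w [k [_ _ gk]]]] := chart_cases d; exists 1%N.
  exists (fun y => Tin T' y (eL (lshift M k) (tvar A) y)); split=> //.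
  - by move=> y; exact: treg1 deg_t.
  - exact/tgP.
  - by rewrite tgE' locus0E; exact: affine_locus0.
exists (fun y => Tin T' y (eL k (uvar A) y)); split=> //.
- by move=> y; exact: treg1 deg_u.
- exact/tgP.
- by rewrite tgE' locusinfE; exact: affine_locusinf.
Qed.

(** * The fibre over 1 *)

Let sigma : mor X Z := unit_section Z.
Let ut : mpoly_gralg A 2 := uvar A - tvar A.

Let deg_ut : deg 1 ut. Proof. exact: degB deg_u deg_t. Qed.

Lemma ut_frac z :
  mst j0 z (mst p (j0 z) (fr (pspaceP (def_P1 Df)) (p (j0 z)) ut (tvar A))) = acoord z - 1.
Proof.
have [qt uE] := @def_p0 _ _ _ _ _ _ _ Df z.
rewrite -uE -[mst (compmor p j0) z _]/(mst j0 z (mst p (j0 z) _)).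
rewrite -(frD_ deg_u (degN deg_t) deg_t qt) !rmorphD; congr (_ + _).
have : fr (pspaceP (def_P1 Df)) (p (j0 z)) (tvar A) (tvar A) +
    fr (pspaceP (def_P1 Df)) (p (j0 z)) (- tvar A) (tvar A) = 0.
  by rewrite (frD_ deg_t (degN deg_t) deg_t qt) subrr (fr0 deg_t qt).
rewrite (frvv deg_t qt) addrC => /eqP; rewrite addr_eq0 => /eqP ->.
by rewrite !rmorphN !rmorph1.
Qed.

Lemma fiber1P d : qp (p d) ut <-> exists x, d = j0 (sigma x).
Proof.
split=> [qut|[x ->]]; last first.
  have [qt _] := @def_p0 _ _ _ _ _ _ _ Df (sigma x).
  rewrite -(fr_nonunit deg_ut deg_t qt) -(mst_unit (f := p)) -(mst_unit (f := j0)) ut_frac.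
  exact: acoord_sec1.
have qt : ~ qp (p d) (tvar A).
  (* If [t] vanished together with [u - t], both coordinates of the projective line would vanish at
     [d]. *)
  move=> qt; have [k] := ind_coord p d; apply.
  have qu : qp (p d) (uvar A).
    by rewrite -[uvar A](subrK (tvar A)); exact: (prD (pt_primeP _ _) qut qt).
  case: k => -[|[|//]] kP; first by rewrite (_ : Ordinal kP = 0) //; exact: val_inj.
  by rewrite (_ : Ordinal kP = 1) //; exact: val_inj.
have [z ez] := (P1_t d).1 qt; subst d.
exists (apr z); congr (j0 _); apply: sec1_uniq.
rewrite -ut_frac !mst_unit; exact/(fr_nonunit deg_ut deg_t qt).
Qed.

Lemma fiber1_closed_immersion : closed_immersion (compmor j0 sigma).
Proof.
split.
- move=> x x' e; have e' : sigma x = sigma x' by exact: j0_inj e.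
  by have : apr (sigma x) = apr (sigma x') by [rewrite e']; rewrite !pr_sec1.
- move=> C cC; rewrite -[_ @` _]setCK; apply: open_closedC.
  (* The complement of the image is the union of two open sets: the locus where [u - t] does not
     vanish, and the part of the chart [Z] over the complement of [C]. *)
  have -> : ~` (compmor j0 sigma @` C) =
      [set d | ~ qp (p d) ut] `|` j0 @` (apr @^-1` ~` C).
    apply/seteqP; split=> d.
      move=> nd; have [/fiber1P [x ex]|?] := pselect (qp (p d) ut); last by left.
      right; exists (sigma x) => // Cx; apply: nd; exists x => //=.
      by move: Cx; rewrite pr_sec1.
    case=> [nq [x Cx e]|[z nC ez] [x Cx e]]; first by apply: nq; apply/fiber1P; exists x.
    apply: nC; have -> : z = sigma x by apply: j0_inj; rewrite ez -e.
    by rewrite /= pr_sec1.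
  apply: openU; first by rewrite openE => d qd; exact: (near_mor (pr_near deg_ut qd)).
  have [_ jo _] := def_j0_open Df; apply: jo; apply: open_comp.
    by move=> z _; exact: m_cont.
  exact: closed_openC.
- move=> x r; have [a ar] := unit_section_surj Z r.
  by case: (j0_st (sigma x)) => g _ gK; exists (g a); rewrite /= gK.
Qed.

Lemma fiber1 : is_fiber p ut (compmor j0 sigma).
Proof.
split; [exact: fiber1_closed_immersion| |].
  by move=> d; rewrite fiber1P; split=> -[x e]; exists x.
move=> x g dg qg r.
have [qt _] := @def_p0 _ _ _ _ _ _ _ Df (sigma x).
set z := sigma x in qt *.
(* The unit [t / g] relates the equation [(u - t) / g] of the fibre to [v - 1], which generates the
   kernel of the stalk map of [sigma]. *)
pose c0 := mst j0 z (mst p (j0 z) (fr (pspaceP (def_P1 Df)) (p (j0 z)) (tvar A) g)).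
have u0 : c0 \is a GRing.unit by rewrite !mst_unit; apply/(fr_unit deg_t dg qg).
have E : mst j0 z (mst p (j0 z) (fr (pspaceP (def_P1 Df)) (p (j0 z)) ut g)) =
    (acoord z - 1) * c0.
  rewrite -ut_frac -!rmorphM (frM_ deg_ut deg_t qt deg_t dg qg) [tvar A * g]mulrC.
  by rewrite (frMcancel deg_ut dg qg deg_t qt).
rewrite -[mst (compmor j0 sigma) x r]/(mst sigma x (mst j0 z r)).
rewrite unit_section_ker; case: (j0_st z) => h hK hK'.
split=> [[c ec]|[c ->]]; last first.
  by rewrite rmorphM; exists (mst j0 z c * c0); rewrite [in LHS]E; ring.
exists (h (c / c0)); apply: (can_inj hK); rewrite ec rmorphM hK' E.
by rewrite mulrA mulrAC divrK // mulrC.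
Qed.

(** The fibre lies in the chart [Z], which is covered by the loci of the sections [x_k t] with
    [k <= N]. Their ratios are pulled back from the ratios of the [s_k] on [X], and [unit_sectionK]
    returns these unchanged. *)
Lemma fiber1_pullback : exists h, @is_pullback A X D (compmor j0 sigma) L' L h.
Proof.
have Gc x (k : 'I_N.+1) : isgen (s k x) -> isgen (s k (apr (sigma x))).
  by rewrite pr_sec1.
apply: (@pullback_of_gens _ _ _ (compmor j0 sigma) L' L 'I_N.+1
  (fun m => eL (lshift M m) (tvar A)) s (fun m x => isgen (s m x))).
- exact: (ind_cover psi_ind).
- by move=> k x; exact: (ind_near psi_ind).
- by move=> k x _; split; [exact: (eL_reg _ _ deg_t)|exact: s_reg].
- move=> k x gk; split=> //; apply/(eL_gen _ _ deg_t); split.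
    by apply: chart0_coord; exact: Gc.
  by apply/P1_t; exists (sigma x).
move=> k l x r gk gk' er.
have qk : ~ qP (Phi (j0 (sigma x))) (X_ (lshift M k)) by apply: chart0_coord; exact: Gc.
have gL : isgen (eL (lshift M k) (tvar A) (j0 (sigma x))).
  by apply/(eL_gen _ _ deg_t); split=> //; apply/P1_t; exists (sigma x).
have rE : r = mst Phi (j0 (sigma x)) (fr (pspaceP PNM) (Phi (j0 (sigma x)))
    (X_ (lshift M l)) (X_ (lshift M k))).
  by apply: (isgen_inj gL); rewrite -er; exact: eL_ratio.
have [c [ce _]] := gk (s l x).
have [a [ax ac nac]] := Mreg_coord (s_reg k x) (s_reg l x) ce.
have Pa : s l (apr (sigma x)) = a (apr (sigma x)) *: s k (apr (sigma x)).
  by rewrite pr_sec1; exact: nbhs_singleton nac.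
rewrite -[mst (compmor j0 sigma) x r]/(mst sigma x (mst j0 (sigma x) r)) rE.
rewrite (chart0_ratio (Gc _ _ gk) Pa) unit_sectionK //.
exact: nbhs_singleton nac.
Qed.

Lemma unit_section_mor_eq : mor_eq (compmor apr sigma) (idmor X).
Proof.
move=> x; split; first exact: pr_sec1.
move=> f fx; have {}fx : Oreg x f by move: fx; rewrite /= pr_sec1.
exact: unit_sectionK fx.
Qed.

(** * The fibre over infinity *)

Variables (G : assoc_graded I) (P : ascheme A) (HP : is_proj G P).
Variables (O1 : modsheaf P) (HO1 : is_twist1 HP O1).
Implicit Types (y : P).

Let q : {rmorphism R -> G} := rees_to_graded IE G.
Let q_deg n f : deg n f -> deg n (q f). Proof. exact: rees_to_graded_deg. Qed.
Let q_surj n (g : G) : deg n g -> exists2 f, deg n f & q f = g.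
Proof. exact: rees_to_graded_surj. Qed.
Let q_re (l : nat) a : idpow I l a -> q (re R l a) = gc G l a.
Proof. by move=> ia; rewrite /q /= rees_to_graded_re. Qed.
Let q_str a : q (gstr R a) = gstr G a.
Proof. by rewrite re_str q_re // gc_str. Qed.
Let q_tau : q tau = 0. Proof. exact: rees_to_graded_tau. Qed.

Let kap : mor P W := proj_mor HW HP q_deg q_surj q_str.
Let kapP y f : qW (kap y) f <-> pt_prime HP y (q f).
Proof. exact: proj_pointP. Qed.

Let kap_fr y n (f g : R) : deg n f -> deg n g -> ~ qW (kap y) g ->
  mst kap y (fr HW (kap y) f g) = fr HP y (q f) (q g).
Proof. exact: proj_st_fr. Qed.

Let q_ker n f : deg n f -> q f = 0 -> exists2 f0, deg n f0 & f = tau * f0.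
Proof. exact: (@rees_to_graded_ker _ _ _ _ _ IE R G n f). Qed.

Lemma kap_image w : (exists y, kap y = w) <-> qW w tau.
Proof.
split=> [[y <-]|qt].
  by apply/kapP; rewrite q_tau; exact: (pr_0 (pt_primeP HP y)).
apply: (proj_mor_image HP q_deg q_surj q_str) => n f df /(q_ker df) [g _ ->].
by rewrite mulrC; exact: (prM (pt_primeP HW w)).
Qed.

Lemma fiberinfP d : qp (p d) (tvar A) <-> exists y, d = jinf (kap y).
Proof.
split=> [qt|[y ->]].
  have [[z ez]|[w ew]] := def_cover d.
    by exfalso; apply: (P1_t d).2 qt; exists z.
  subst d; have [y ey] : exists y, kap y = w; last by exists y; rewrite ey.
  apply/kap_image; apply: contrapT => nq.
  have [z ez] := (@def_ovlinf _ _ _ _ _ _ _ Df w).2 nq.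
  by apply: (P1_t (jinf w)).2 qt; exists z.
apply: contrapT => /P1_t [z ez].
by apply: (overlap_tau (esym ez)); apply/kap_image; exists y.
Qed.

Lemma fiberinf_closed_immersion : closed_immersion (compmor jinf kap).
Proof.
split.
- move=> y y' e; have e' : kap y = kap y' by exact: jinf_inj e.
  exact: proj_mor_inj e'.
- move=> C cC; rewrite -[_ @` _]setCK; apply: open_closedC.
  have -> : ~` (compmor jinf kap @` C) =
      [set d | ~ qp (p d) (tvar A)] `|` jinf @` (~` (kap @` C)).
    apply/seteqP; split=> d.
      move=> nd; have [/fiberinfP [y ey]|?] := pselect (qp (p d) (tvar A)); last by left.
      right; exists (kap y) => // -[y' Cy' e]; apply: nd; exists y' => //=.
      by rewrite ey; congr (jinf _).
    case=> [nq [y Cy e]|[w nC ew] [y Cy e]]; first by apply: nq; apply/fiberinfP; exists y.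
    by apply: nC; exists y => //; apply: jinf_inj; rewrite ew.
  apply: openU; first by rewrite openE => d qd; exact: (near_mor (pr_near deg_t qd)).
  (* Points where [tau] does not vanish have a neighbourhood that misses the image of [kap]. At a
     point [kap y], a basic open set of [P] around [y] and disjoint from [C] is given by an element
     [g] of [G], and a lift of [g] along [q] gives the neighbourhood in [W]. *)
  have [_ jo _] := def_jinf_open Df; apply: jo; rewrite openE => w nw.
  have [qt|nqt] := pselect (qW w tau); last first.
    apply: filterS (pr_near tau_deg0 nqt) => w' nqt' [y _ ey]; apply: nqt'.
    by apply/kap_image; exists y.
  have [y ey] := (kap_image w).2 qt; subst w.
  have nCy : ~ C y by move=> Cy; apply: nw; exists y.
  have oC : nbhs y (~` C) by apply: open_nbhs_nbhs; split=> //; exact: closed_openC.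
  have [n [g [n0 dg ng gC]]] := pr_basis HP oC.
  have [f df fg] := q_surj dg.
  have nf : ~ qW (kap y) f by move/kapP; rewrite fg.
  apply: filterS (pr_near df nf) => w' nf' [y' Cy' e]; apply: (gC y') => //.
  by rewrite -fg => /kapP; rewrite e.
- move=> y r; have [u <-] := proj_mor_surj HW HP q_deg q_surj q_str r.
  case: (jinf_st (kap y)) => g _ gK; exists (g u).
  by rewrite -[LHS]/(mst kap y (mst jinf (kap y) (g u))) gK.
Qed.

Lemma kap_st_ker y (u : Ost (kap y)) :
  mst kap y u = 0 <-> exists c, u = c * fr HW (kap y) tau 1.
Proof.
have d1 := deg1 R; have n1 := @pr_not1 _ _ _ HW (kap y).
split=> [u0|[c ->]]; last first.
  rewrite rmorphM; have -> : mst kap y (fr HW (kap y) tau 1) = 0.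
    rewrite (kap_fr tau_deg0 d1 n1) q_tau rmorph1; exact: fr01.
  by rewrite mulr0.
have [n [a [b0 [da db nb eu qa]]]] := proj_mor_ker u0.
have [f df ef] := q_ker da qa; exists (fr HW (kap y) f b0).
by rewrite eu ef (frM_ df db nb tau_deg0 d1 n1) mulr1 mulrC.
Qed.

Lemma fiberinf : is_fiber p (tvar A) (compmor jinf kap).
Proof.
split; [exact: fiberinf_closed_immersion| |].
  by move=> d; rewrite fiberinfP; split=> -[y e]; exists y.
move=> y g dg qg r.
have [qu tE] := @def_pinf _ _ _ _ _ _ _ Df (kap y).
set w := kap y in qu tE *.
(* As over 1, the unit [u / g] relates [t / g] to [tau], which generates the kernel of the stalk map
   of [kap]. *)
pose c0 := mst jinf w (mst p (jinf w) (fr (pspaceP (def_P1 Df)) (p (jinf w)) (uvar A) g)).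
have u0 : c0 \is a GRing.unit by rewrite !mst_unit; apply/(fr_unit deg_u dg qg).
have E : mst jinf w (mst p (jinf w) (fr (pspaceP (def_P1 Df)) (p (jinf w)) (tvar A) g)) =
    fr HW w tau 1 * c0.
  rewrite -tE -[mst (compmor p jinf) w _]/(mst jinf w (mst p (jinf w) _)) -!rmorphM.
  rewrite (frM_ deg_t deg_u qu deg_u dg qg) [uvar A * g]mulrC.
  by rewrite (frMcancel deg_t dg qg deg_u qu).
rewrite -[mst (compmor jinf kap) y r]/(mst kap y (mst jinf w r)).
rewrite kap_st_ker; case: (jinf_st w) => h hK hK'.
split=> [[c ec]|[c ->]]; last first.
  by rewrite rmorphM; exists (mst jinf w c * c0); rewrite [in LHS]E; ring.
exists (h (c / c0)); apply: (can_inj hK); rewrite ec rmorphM hK' E.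
by rewrite mulrA mulrAC divrK // mulrC.
Qed.

Let xi_cover_inf y : exists k, ~ pt_prime HP y (q (Xi k)).
Proof. by have [k qk] := xi_cover (kap y); exists k => /kapP. Qed.

Let dqX k : deg 1 (q (Xi k)). Proof. by apply: q_deg; exact: xi_deg1. Qed.

Lemma twist_line_bundle : line_bundle O1.
Proof.
move=> y; have [k qk] := xi_cover_inf y.
exists (fun y => fr1 HO1 y (q (Xi k)) 1); first exact: fr1_Mreg.
by apply: filterS (pr_near (dqX k) qk) => z qz; exact: fr1_gen.
Qed.

(** The elements [q (Xi k)] have degree one and no common zero on [P], so they give local generators
    of [O1]. The ratios of the sections [x_k u] are [Xi l / Xi k] by [chart_ratio], and [q] sends
    these to the ratios in [O1]. *)
Lemma fiberinf_pullback : exists h, @is_pullback A P D (compmor jinf kap) L' O1 h.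
Proof.
have nk y k : ~ pt_prime HP y (q (Xi k)) -> ~ qW (kap y) (Xi k) by move=> h /kapP.
have gL y k : ~ pt_prime HP y (q (Xi k)) -> isgen (eL k (uvar A) (jinf (kap y))).
  move=> h; apply/(eL_gen _ _ deg_u); split; first by apply/chart_coord; exact: nk.
  by apply/P1_u; exists (kap y).
apply: (@pullback_of_gens _ _ _ (compmor jinf kap) L' O1 'I_(N.+1 + M)
  (fun k => eL k (uvar A)) (fun k y => fr1 HO1 y (q (Xi k)) 1)
  (fun k y => ~ pt_prime HP y (q (Xi k)))).
- exact: xi_cover_inf.
- by move=> k y; exact: pr_near (dqX k).
- by move=> k y _; split; [exact: (eL_reg _ _ deg_u)|exact: fr1_Mreg].
- by move=> k y h; split; [exact: gL|exact: fr1_gen].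
move=> k l y r gk gl er.
have rE : r = mst Phi (jinf (kap y)) (fr (pspaceP PNM) (Phi (jinf (kap y))) (X_ l) (X_ k)).
  apply: (isgen_inj (gL _ _ gk)); rewrite -er; apply: eL_ratio.
  by apply/chart_coord; exact: nk.
rewrite -[mst (compmor jinf kap) y r]/(mst kap y (mst jinf (kap y) r)) rE.
rewrite chart_ratio; last exact: nk.
rewrite (kap_fr (xi_deg1 l) (xi_deg1 k)); last exact: nk.
exact: fr1_ratio.
Qed.

Lemma deformation_at_infinity :
     [/\ line_bundle O1,
         generated_in_degree1_over_index0 G,
         generated_in_degree1 S -> generated_in_degree1 G &
         exists (q : {rmorphism def_rees Df -> G}) (k : mor P (def_W Df)),
           [/\ forall (l : nat) a, idpow I l a -> q (re (def_rees Df) l a) = gc G l a,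
               q tau = 0,
               proj_map HW HP q k,
               is_fiber p (tvar A) (compmor jinf k) &
               exists h, @is_pullback A P D (compmor jinf k) L' O1 h]].
Proof.
split.
- exact: twist_line_bundle.
- exact: (assoc_graded_gen0 tg_deg IE).
- exact: (assoc_graded_gen1 tg_deg IE).
- exists q, kap; split=> //.
  + exact: proj_morP.
  + exact: fiberinf.
  + exact: fiberinf_pullback.
Qed.

End Deformation.

Theorem proposition5p9 (A : comNzRingType) (hA : field_or_Z A)
    (X : ascheme A) (hX : projective X)
    (L : modsheaf X) (hL : line_bundle L) (hva : very_ample L)
    (T : tensor_algebra L) (S : section_ring T)
    (Y : ascheme A) (i : mor Y X) (hY : hyperplane_section S i)
    (Df : deformation S i)
    (L' : modsheaf (def_D Df)) (hL' : def_bundle L')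
    (T' : tensor_algebra L') :
  ample T' /\
  (exists sigma : mor X (def_Z Df),
     [/\ mor_eq (compmor (apr (def_Z Df)) sigma) (idmor X),
         forall x, mst sigma x (acoord (sigma x)) = 1,
         is_fiber (def_p Df) (uvar A - tvar A) (compmor (def_j0 Df) sigma) &
         exists h, @is_pullback A X (def_D Df)
                     (compmor (def_j0 Df) sigma) L' L h]) /\
  (forall (G : assoc_graded (@ideal_of A X Y L T S i))
      (P : ascheme A) (HP : is_proj G P)
      (O1 : modsheaf P) (HO1 : is_twist1 HP O1),
     [/\ line_bundle O1,
         generated_in_degree1_over_index0 G,
         generated_in_degree1 S -> generated_in_degree1 G &
         exists (q : {rmorphism def_rees Df -> G}) (k : mor P (def_W Df)),
           [/\ forall (l : nat) a, idpow (@ideal_of A X Y L T S i) l a ->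
                 q (re (def_rees Df) l a) = gc G l a,
               q (tau (def_rees Df)) = 0,
               proj_map (def_proj Df) HP q k,
               is_fiber (def_p Df) (tvar A) (compmor (def_jinf Df) k) &
               exists h, @is_pullback A P (def_D Df)
                           (compmor (def_jinf Df) k) L' O1 h]]).
Proof.
have [N [M [s [t [s_reg [t_reg [IE [[PN [psi [psi_ci psi_ind]]] rest]]]]]]]] := hL'.
have [PNM [Phi [LZ [hZ [pbZ [Phi_ind [E1 [E2 [h1 [h2 [b [pb1 [pb2 tb]]]]]]]]]]]]] := rest.
have sec (l : forall x, L x) : (forall x, Mreg x l) ->
    exists a : S, forall x, ev S x a = Tin T x (l x).
  move=> lr; apply: (@ev_surj _ _ _ _ S 1 (fun x => Tin T x (l x))) => x.
  apply: (treg_ext (treg_pow T 1 (lr x) (Oreg1 x))).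
  by apply: nearW => y; rewrite scale1r expr1.
have /choice [sg sgE] : forall k, exists a : S, forall x, ev S x a = Tin T x (s k x).
  by move=> k; exact: sec (s_reg k).
have /choice [tg tgE] : forall k, exists a : S, forall x, ev S x a = Tin T x (t k x).
  by move=> k; exact: sec (t_reg k).
(* [def_bundle] states the generation of the ideal germ by germ; [ev_inj] makes it an identity in
   [S], as the study of the powers of the ideal requires. *)
have {}IE a : @ideal_of A X Y L T S i a <-> exists c : 'I_M -> S, a = \sum_k c k * tg k.
  rewrite IE; split=> -[c ac]; exists c.
    apply: (@ev_inj _ _ _ _ S) => x; rewrite ac rmorph_sum; apply: eq_bigr => k _.
    by rewrite rmorphM /= tgE.
  move=> x; rewrite ac rmorph_sum; apply: eq_bigr => k _.
  by rewrite rmorphM /= tgE.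
split; last split.
- exact: (deformation_ample s_reg t_reg sgE tgE IE psi_ci psi_ind pbZ Phi_ind pb1 pb2 tb).
- exists (unit_section (def_Z Df)); split.
  + exact: unit_section_mor_eq.
  + exact: unit_section_coord.
  + exact: (fiber1 Df IE).
  + exact: (fiber1_pullback s_reg IE psi_ind pbZ Phi_ind pb1 pb2 tb).
- move=> G P HP O1 HO1.
  exact: (deformation_at_infinity s_reg t_reg sgE tgE IE psi_ci psi_ind pbZ Phi_ind
    pb1 pb2 tb HO1).
Qed.
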